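(* Consider the problem $\min_xg(x)-h(x)+r(x)$ with possibly non-smooth non-convex $r$, assume $h$ is differentiable and has $(L,\nu)$-H\''older continuous gradient for some $\nu\in(0,1]$, and apply the stagewise algorithm to its DC reformulation with smoothing parameter $\mu$. Let $\tau\in\{1,\dots,K\}$ be the sampled index and $w_\tau=\mathrm{prox}_{\mu r}(x_\tau)$. Denote by $( * )$ the guarantee $$\mathbb{E}[\|x_\tau-w_\tau\|]\le O(\epsilon),\qquad\mathbb{E}\big[\mathrm{dist}\big(\nabla h(w_\tau),\nabla g(w_\tau)+\hat\partial r(w_\tau)\big)\big]\le O(\epsilon^\nu).\qquad( * )$$ (a) If (R1) and (S) hold, then using SPG with $\mu=\epsilon$, $\gamma_k=3Lk^{1/3}$, $T_k=3Lk/\gamma_k+3$, the algorithm returns after $K=O(1/\epsilon^{\frac{3(1+\nu)}2})$ stages a solution $x_\tau$ satisfying $( * )$, and the total iteration complexity is $\sum_{k=1}^KT_k\le O(K^{5/3})=O(1/\epsilon^{\frac{5(1+\nu)}2})$. (b) If (R2) and (S) hold, then using SPG with $\mu=\epsilon^2$, $\gamma_k=3Lk^{1/2}$, $T_k=3Lk/\gamma_k+3$, the algorithm returns after $K=O(1/\epsilon^{\frac{4(2+\nu)}3})$ stages a solution $x_\tau$ satisfying $( * )$, and the total iteration complexity is $\sum_{k=1}^KT_k\le O(K^{3/2})=O(1/\epsilon^{2(2+\nu)})$. (c) If $g=\frac1{n_1}\sum_{i=1}^{n_1}g_i$ and $h=\frac1{n_2}\sum_{j=1}^{n_2}h_j$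 have a finite-sum form with each $g_i$ $L$-smooth, and (R1) holds, then using SVRG with $\mu=\epsilon$, $\gamma_k=ck^{1/3}$, $T_k\ge\max(2,200L/\gamma_k)$, $S_k=\lceil\log_2(k)\rceil$, the algorithm returns after $K=O(1/\epsilon^{\frac{3(1+\nu)}2})$ stages a solution $x_\tau$ satisfying $( * )$, and the total gradient complexity is $\widetilde O(n/\epsilon^{\frac{3(1+\nu)}2})$. (d) If $g=\frac1{n_1}\sum_{i=1}^{n_1}g_i$ and $h=\frac1{n_2}\sum_{j=1}^{n_2}h_j$ have a finite-sum form with each $g_i$ $L$-smooth, and (R2) or (R3) holds, then using SVRG with $\mu=\epsilon^2$, $\gamma_k=ck^{1/2}$, $T_k\ge\max(2,200L/\gamma_k)$, $S_k=\lceil\log_2(k)\rceil$, the algorithm returns after $K=O(1/\epsilon^{\frac{4(2+\nu)}3})$ stages a solution $x_\tau$ satisfying $( * )$, and the total gradient complexity is $\widetilde O(n/\epsilon^{\frac{4(2+\nu)}3})$.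
   Context: Setting: $g,h:\mathbb{R}^d\to\mathbb{R}$ are lower-semicontinuous convex, $g$ is $L$-smooth (differentiable with $L$-Lipschitz gradient), $r$ is a proper lower-semicontinuous (possibly non-smooth and non-convex) function whose proximal mapping $\mathrm{prox}_{\mu r}(x)=\arg\min_y\{\frac1{2\mu}\|y-x\|^2+r(y)\}$ exists. Write $f=g-h$, $n=n_1+n_2$; $c>0$ is a constant. $(L,\nu)$-H\''older continuous gradient means $\|\nabla h(x)-\nabla h(y)\|\le L\|x-y\|^\nu$ for all $x,y$. $\mathrm{prox}_{\mu r}(x)$ may be set-valued; when used as a vector it denotes a fixed selection (the same wherever it appears). $\hat\partial r(\bar x)=\{v:\liminf_{x\to\bar x}\frac{r(x)-r(\bar x)-v^\top(x-\bar x)}{\|x-\bar x\|}\ge0\}$ is the Fr\'echet subdifferential; $\mathrm{dist}$ is the distance between sets. In (a),(b), $g=\mathbb{E}_\xi[g(\cdot;\xi)]$ and $h=\mathbb{E}_\varsigma[h(\cdot;\varsigma)]$ with unbiased stochastic gradients $\nabla g(x;\xi)$, $\partial h(x;\varsigma)$. DC reformulation: $r_\mu(x)=\min_y\{\frac1{2\mu}\|y-x\|^2+r(y)\}=\frac1{2\mu}\|x\|^2-R_\mu(x)$ with $R_\mu(x)=\max_y\{\frac1\mu y^\top x-\frac1{2\mu}\|y\|^2-r(y)\}$ convex and $\frac1\mu\mathrm{prox}_{\mu r}(x)\subseteq\partial R_\mu(x)$. The algorithm is applied to $F(x)=g(x)+\frac1{2\mu}\|x\|^2-(h(x)+R_\mu(x))=f(x)+r_\mu(x)$.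 Stagewise algorithm: from $x_1$, for $k=1,\dots,K$ obtain $x_{k+1}$ by running the subproblem solver, initialized at $x_k$, on $$F_k(x)=g(x)+\tfrac1{2\mu}\|x\|^2-\big(\nabla h(x_k)+\tfrac1\mu\mathrm{prox}_{\mu r}(x_k)\big)^\top(x-x_k)+\tfrac{\gamma_k}2\|x-x_k\|^2.$$ Return $x_\tau$ with $\tau$ sampled by $p(\tau=k)=k^\alpha/\sum_{j=1}^Kj^\alpha$, $\alpha\ge1$ fixed. SPG at stage $k$ ($T_k$ iterations, rounded up, $\eta_t=3/(\gamma_k(t+1))$): $y_1=x_k$; for $t=1,\dots,T_k$ with fresh independent samples, $$y_{t+1}=\arg\min_xx^\top\big(\nabla g(y_t;\xi_t)-\partial h(x_k;\varsigma_t)-\tfrac1\mu\mathrm{prox}_{\mu r}(x_k)\big)+\tfrac1{2\mu}\|x\|^2+\tfrac{\gamma_k}2\|x-x_k\|^2+\tfrac1{2\eta_t}\|x-y_t\|^2;$$ output $x_{k+1}=\sum_{t=2}^{T_k+1}ty_t/\sum_{t=2}^{T_k+1}t$. SVRG at stage $k$ (step size $\eta=0.05/L$): $\bar x^{(0)}=x_k$; for $s=1,\dots,S_k$ set $\bar g_s=\nabla g(\bar x^{(s-1)})-\nabla h(x_k)-\frac1\mu\mathrm{prox}_{\mu r}(x_k)$, $x_0^{(s)}=\bar x^{(s-1)}$; for $t=1,\dots,T_k$ pick $i_t\in\{1,\dots,n_1\}$ uniformly, $v_t=\nabla g_{i_t}(x^{(s)}_{t-1})-\nabla g_{i_t}(\bar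 x^{(s-1)})+\bar g_s$, $x^{(s)}_t=\arg\min_x\langle v_t,x-x^{(s)}_{t-1}\rangle+\frac1{2\eta}\|x-x^{(s)}_{t-1}\|^2+\frac1{2\mu}\|x\|^2+\frac{\gamma_k}2\|x-x_k\|^2$; $\bar x^{(s)}=\frac1{T_k}\sum_{t=1}^{T_k}x^{(s)}_t$. Output $x_{k+1}=\bar x^{(S_k)}$. The total gradient complexity is $\sum_{k=1}^K(n+T_k)S_k$, with $T_k$ taken of the order of its lower bound. Conditions. (S): $g$ is $L$-smooth and there is $G>0$ with $\mathbb{E}\|(\nabla g(x;\xi)-\partial h(x;\varsigma))-\mathbb{E}[\nabla g(x;\xi)-\partial h(x;\varsigma)]\|^2\le G^2$. (R1): $r$ is Lipschitz continuous. (R2): $r$ is lower bounded and finite-valued over $\mathbb{R}^d$. (R3): $f+r_\mu$ is level bounded for a small $\mu<1$, $r$ is finite-valued on a compact set, and $r$ is lower bounded over $\mathbb{R}^d$. Standing assumption: there is $\Delta>0$ (independent of $\epsilon$) with $\mathbb{E}[F(x_k)-\min_xF(x)]\le\Delta$ for all $k\in\{1,\dots,K\}$ when SPG is used, and $F(x_1)-\min_xF(x)\le\Delta$ when SVRG is used. ''After $K=O(q(\epsilon))$ stages'' means $K=\lceil Cq(\epsilon)\rceil$ for a constant $C$ independent of $\epsilon\in(0,1)$; all $O(\cdot)$ constants are independent of $\epsilon$; $\widetilde O$ hides logarithmic factors. *)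

(* Defs.v *)
(* Vectors of R^d are row vectors. *)
From HB Require Import structures.
From mathcomp Require Export all_boot all_order all_algebra.
From mathcomp Require Export all_classical all_reals all_analysis.

Set Implicit Arguments.
Unset Strict Implicit.
Unset Printing Implicit Defensive.

Export Order.TTheory GRing.Theory Num.Theory.
Export numFieldNormedType.Exports.

Local Open Scope classical_set_scope.
Local Open Scope ring_scope.

Section euclidean.
Context {R : realType} {d : nat}.
Local Notation V := 'rV[R]_d.

Definition dotr (u v : V) : R := \sum_i u 0 i * v 0 i.

(* The library norm on 'rV[R]_d is the sup norm (it induces the same
   topology); all estimates are in the Euclidean norm. *)
Definition enorm (u : V) : R := Num.sqrt (dotr u u).

(* Only meaningful at points where f is differentiable. *)
Definition grad (f : V -> R) (x : V) : V :=
  \row_i 'D_(delta_mx 0 i) (f : V -> R^o) x.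

Definition differentiable_everywhere (f : V -> R) : Prop :=
  forall x, differentiable (f : V -> R^o) x.

Definition smooth (L : R) (f : V -> R) : Prop :=
  differentiable_everywhere f /\
  forall x y, enorm (grad f x - grad f y) <= L * enorm (x - y).

Definition holder_grad (L nu : R) (f : V -> R) : Prop :=
  differentiable_everywhere f /\
  forall x y, enorm (grad f x - grad f y) <= L * enorm (x - y) `^ nu.

Definition convex_lsc (f : V -> R) : Prop :=
  lower_semicontinuous (EFin \o f) /\
  convex_function (setT : set (convex_lmodType V)) f.

Definition minimizes (phi : V -> R) (x : V) : Prop := forall y, phi x <= phi y.

Definition attains_min (F : V -> \bar R) (m : R) : Prop :=
  (exists x, F x = m%:E) /\ forall x, (m%:E <= F x)%E.

Definition proper (r : V -> \bar R) : Prop :=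
  (forall x, r x != -oo%E) /\ exists x, r x \is a fin_num.

(* w is an element of the (possibly set-valued) prox_{mu r}(x). *)
Definition is_prox (mu : R) (r : V -> \bar R) (x w : V) : Prop :=
  forall y, (((2 * mu)^-1 * enorm (w - x) ^+ 2)%:E + r w <=
             ((2 * mu)^-1 * enorm (y - x) ^+ 2)%:E + r y)%E.

Definition moreau (mu : R) (r : V -> \bar R) (x : V) : \bar R :=
  ereal_inf (range (fun y => ((2 * mu)^-1 * enorm (y - x) ^+ 2)%:E + r y)%E).

Definition smoothed_objective (g h : V -> R) (r : V -> \bar R) (mu : R)
    (x : V) : \bar R :=
  ((g x - h x)%:E + moreau mu r x)%E.

(* For d > 0 this is empty where r is +oo, because +oo - +oo = -oo. *)
Definition frechet_subdiff (r : V -> \bar R) (xbar : V) : set V :=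
  [set v | (0 <= limf_einf (fun x =>
      (r x - r xbar - (dotr v (x - xbar))%:E) * ((enorm (x - xbar))^-1)%:E)
    (xbar^'))%E].

(* +oo when one of the sets is empty. *)
Definition set_dist (A B : set V) : \bar R :=
  ereal_inf [set z | exists a b, [/\ A a, B b & z = (enorm (a - b))%:E]].

Definition lipschitz_reg (r : V -> \bar R) : Prop :=
  (forall x, r x \is a fin_num) /\
  exists l : R, forall x y, `|fine (r x) - fine (r y)| <= l * enorm (x - y).

Definition lower_bounded (r : V -> \bar R) : Prop :=
  exists b : R, forall x, (b%:E <= r x)%E.

Definition finite_lower_bounded (r : V -> \bar R) : Prop :=
  lower_bounded r /\ forall x, r x \is a fin_num.

Definition level_bounded (F : V -> \bar R) : Prop :=
  forall a : R, bounded_set [set x | (F x <= a%:E)%E].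

Definition level_bounded_reg (g h : V -> R) (r : V -> \bar R) : Prop :=
  [/\ exists mu : R, [/\ 0 < mu, mu < 1 &
                      level_bounded (smoothed_objective g h r mu)],
      exists A : set V, [/\ A !=set0, compact A &
                         forall x, A x -> r x \is a fin_num] &
      lower_bounded r].

Definition finite_sum (n : nat) (f : V -> R) (fs : 'I_n -> V -> R) : Prop :=
  (0 < n)%N /\ forall x, f x = n%:R^-1 * \sum_i fs i x.

End euclidean.

Notation borel R d := (g_sigma_algebraType (@open 'rV[R]_d)).

(* The ceiling of a nonnegative real as a natural number. *)
Definition natceil {R : realType} (x : R) : nat := `|Num.ceil x|%N.

Section probability_notions.
Context {R : realType}.

Definition mutually_independent dO (O : measurableType dO)
    (P : probability O R) (I : eqType) (F : I -> set (set O)) : Prop :=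
  forall (J : seq I) (A : I -> set O), uniq J ->
    (forall i, i \in J -> F i (A i)) ->
    fine (P (\bigcap_(i in [set` J]) A i)) = \prod_(i <- J) fine (P (A i)).

Definition sigma_of dO (O : measurableType dO) dX (X : measurableType dX)
    (f : O -> X) : set (set O) :=
  preimage_set_system setT f measurable.

Definition vexp {d : nat} dX (X : measurableType dX) (Q : probability X R)
    (f : X -> 'rV[R]_d) : 'rV[R]_d :=
  \row_i fine ('E_Q[fun s => (f s 0 i)%R])%E.

(* f = E f(.;s), and D(x;s) is jointly measurable, integrable and an unbiased
   estimator of grad f x. *)
Definition unbiased_oracle {d : nat} dX (X : measurableType dX)
    (Q : probability X R) (f : 'rV[R]_d -> R) (fs : 'rV[R]_d -> X -> R)
    (D : 'rV[R]_d -> X -> 'rV[R]_d) : Prop :=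
  [/\ forall x, Q.-integrable setT (EFin \o fs x),
      forall x, (f x)%:E = ('E_Q[fs x])%E,
      measurable_fun [set: (borel R d * X)%type]
        (fun z => D z.1 z.2 : borel R d),
      forall x i, Q.-integrable setT (fun s => (D x s 0 i)%:E) &
      forall x, vexp Q (D x) = grad f x].

Definition stochastic_gradient {d : nat} dX (X : measurableType dX)
    (Q : probability X R) (f : 'rV[R]_d -> R) (fs : 'rV[R]_d -> X -> R)
    (D : 'rV[R]_d -> X -> 'rV[R]_d) : Prop :=
  unbiased_oracle Q f fs D /\
  forall x, {ae Q, forall s,
    differentiable (fs ^~ s : 'rV[R]_d -> R^o) x /\ D x s = grad (fs ^~ s) x}.

Definition stochastic_subgradient {d : nat} dX (X : measurableType dX)
    (Q : probability X R) (f : 'rV[R]_d -> R) (fs : 'rV[R]_d -> X -> R)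
    (D : 'rV[R]_d -> X -> 'rV[R]_d) : Prop :=
  unbiased_oracle Q f fs D /\
  forall x, {ae Q, forall s,
    frechet_subdiff (fun y => (fs y s)%:E) x (D x s)}.

(* The two samples are independent: the noise of the difference is taken under
   the product law. *)
Definition bounded_variance {d : nat}
    dX (X : measurableType dX) dY (Y : measurableType dY)
    (QX : probability X R) (QY : probability Y R)
    (Dg : 'rV[R]_d -> X -> 'rV[R]_d) (Dh : 'rV[R]_d -> Y -> 'rV[R]_d)
    : Prop :=
  exists2 G : R, 0 < G &
  forall x, (\int[QX \x QY]_z
     (enorm ((Dg x z.1 - Dh x z.2) -
             vexp (QX \x QY)%E (fun z' => Dg x z'.1 - Dh x z'.2)) ^+ 2)%:E
   <= (G ^+ 2)%:E)%E.

Definition sampled_index dO (O : measurableType dO) (P : probability O R)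
    (alpha : R) (K : nat) (tau : {RV P >-> nat}) : Prop :=
  (forall w, (1 <= tau w <= K)%N) /\
  forall k, (1 <= k <= K)%N ->
    P [set w | tau w = k] =
    (k%:R `^ alpha / \sum_(1 <= j < K.+1) j%:R `^ alpha)%:E.

End probability_notions.

Section algorithms.
Context {R : realType} {d : nat}.
Local Notation V := 'rV[R]_d.

(* x k w is x_k, y k t w is the t-th inner iterate y_t of stage k, and Z k t
   is the pair of samples (xi_t, varsigma_t) drawn at that iteration. *)
Record spg_run (p : V -> V) (mu alpha : R) (gam : nat -> R) (T : nat -> nat)
    (K : nat) (x1 : V)
    dX (X : measurableType dX) dY (Y : measurableType dY)
    (QX : probability X R) (QY : probability Y R)
    (Dg : V -> X -> V) (Dh : V -> Y -> V)
    dO (O : measurableType dO) (P : probability O R)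
    (Z : nat -> nat -> {RV P >-> (X * Y)%type}) (tau : {RV P >-> nat})
    (x : nat -> O -> V) (y : nat -> nat -> O -> V) : Prop := {
  spg_tau : sampled_index alpha K tau ;
  spg_law : forall k t A, measurable A ->
    distribution P (Z k t) A = (QX \x QY)%E A ;
  spg_indep : mutually_independent P (fun i : option (nat * nat) =>
    if i is Some kt then sigma_of (Z kt.1 kt.2) else sigma_of tau) ;
  spg_init : forall w, x 1%N w = x1 ;
  spg_stage_init : forall k w, (1 <= k <= K)%N -> y k 1%N w = x k w ;
  spg_step : forall k t w, (1 <= k <= K)%N -> (1 <= t <= T k)%N ->
    minimizes (fun u =>
      dotr u (Dg (y k t w) (Z k t w).1 - Dh (x k w) (Z k t w).2
              - mu^-1 *: p (x k w))
      + (2 * mu)^-1 * enorm u ^+ 2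
      + gam k / 2 * enorm (u - x k w) ^+ 2
      + (2 * (3 / (gam k * t.+1%:R)))^-1 * enorm (u - y k t w) ^+ 2)
    (y k t.+1 w) ;
  spg_output : forall k w, (1 <= k <= K)%N ->
    x k.+1 w = (\sum_(2 <= t < (T k).+2) t%:R)^-1 *:
               \sum_(2 <= t < (T k).+2) t%:R *: y k t w
}.

(* x k w is x_k, xb k s w is the snapshot of epoch s at stage k, xi k s t w is
   the t-th inner iterate of that epoch, and I k s t the index drawn there. *)
Record svrg_run (n : nat) (g h : V -> R) (gs : 'I_n -> V -> R) (p : V -> V)
    (L mu alpha : R) (gam : nat -> R) (T S : nat -> nat) (K : nat) (x1 : V)
    dO (O : measurableType dO) (P : probability O R)
    (I : nat -> nat -> nat -> O -> 'I_n) (tau : {RV P >-> nat})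
    (x : nat -> O -> V) (xb : nat -> nat -> O -> V)
    (xi : nat -> nat -> nat -> O -> V) : Prop := {
  svrg_tau : sampled_index alpha K tau ;
  svrg_meas : forall k s t i, measurable (I k s t @^-1` [set i]) ;
  svrg_law : forall k s t i, P (I k s t @^-1` [set i]) = (n%:R^-1)%:E ;
  svrg_indep : mutually_independent P (fun i : option (nat * nat * nat) =>
    if i is Some kst then preimage_set_system setT (I kst.1.1 kst.1.2 kst.2) setT
    else sigma_of tau) ;
  svrg_init : forall w, x 1%N w = x1 ;
  svrg_stage_init : forall k w, (1 <= k <= K)%N -> xb k 0%N w = x k w ;
  svrg_epoch_init : forall k s w, (1 <= k <= K)%N -> (1 <= s <= S k)%N ->
    xi k s 0%N w = xb k s.-1 w ;
  svrg_step : forall k s t w, (1 <= k <= K)%N -> (1 <= s <= S k)%N ->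
    (1 <= t <= T k)%N ->
    let gbar := grad g (xb k s.-1 w) - grad h (x k w) - mu^-1 *: p (x k w) in
    let v := grad (gs (I k s t w)) (xi k s t.-1 w)
             - grad (gs (I k s t w)) (xb k s.-1 w) + gbar in
    let eta := 5 / 100 / L in
    minimizes (fun u =>
      dotr v (u - xi k s t.-1 w)
      + (2 * eta)^-1 * enorm (u - xi k s t.-1 w) ^+ 2
      + (2 * mu)^-1 * enorm u ^+ 2
      + gam k / 2 * enorm (u - x k w) ^+ 2)
    (xi k s t w) ;
  svrg_snapshot : forall k s w, (1 <= k <= K)%N -> (1 <= s <= S k)%N ->
    xb k s w = (T k)%:R^-1 *: \sum_(1 <= t < (T k).+1) xi k s t w ;
  svrg_output : forall k w, (1 <= k <= K)%N -> x k.+1 w = xb k (S k) w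
}.

Definition spg_iters (L : R) (gam : nat -> R) (k : nat) : nat :=
  natceil (3 * L * k%:R / gam k + 3).

Definition svrg_iters_lb (L : R) (gam : nat -> R) (k : nat) : R :=
  Num.max 2 (200 * L / gam k).



(* The guarantee on x_tau and w_tau = p x_tau, with O-constant B. *)
Definition nearly_critical (g h : V -> R) (r : V -> \bar R) (p : V -> V)
    (nu B eps : R) dO (O : measurableType dO) (P : probability O R)
    (xtau : O -> V) : Prop :=
  ('E_P[fun w => enorm (xtau w - p (xtau w))%R] <= (B * eps)%:E)%E /\
  (\int[P]_w set_dist [set grad h (p (xtau w))]
      [set (grad g (p (xtau w)) + v)%R | v in frechet_subdiff r (p (xtau w))]
   <= (B * eps `^ nu)%:E)%E.

End algorithms.

Definition svrg_epochs (R : realType) (k : nat) : nat :=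
  natceil (ln k%:R / ln 2 : R).

(* Every run of the algorithm with smoothing parameter mu and K stages that
   meets the standing assumption returns an eps-nearly critical point. The
   selection p of the proximal mapping, the probability space and the samples
   are arbitrary; Borel measurability of p makes the iterates random vectors. *)
Definition spg_guarantee (R : realType) (d : nat) (g h : 'rV[R]_d -> R)
    (r : 'rV[R]_d -> \bar R) (nu alpha Delta : R) (x1 : 'rV[R]_d)
    dX (X : measurableType dX) dY (Y : measurableType dY)
    (QX : probability X R) (QY : probability Y R)
    (Dg : 'rV[R]_d -> X -> 'rV[R]_d) (Dh : 'rV[R]_d -> Y -> 'rV[R]_d)
    (gam : nat -> R) (T : nat -> nat) (K : nat) (mu B eps : R) : Prop :=
  forall (p : 'rV[R]_d -> 'rV[R]_d),
    measurable_fun [set: borel R d] (p : borel R d -> borel R d) ->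
    (forall x, is_prox mu r x (p x)) ->
  forall dO (O : measurableType dO) (P : probability O R)
    (Z : nat -> nat -> {RV P >-> (X * Y)%type}) (tau : {RV P >-> nat})
    (x : nat -> O -> 'rV[R]_d) (y : nat -> nat -> O -> 'rV[R]_d),
    spg_run p mu alpha gam T K x1 QX QY Dg Dh Z tau x y ->
    (exists2 m : R, attains_min (smoothed_objective g h r mu) m &
      forall k, (1 <= k <= K)%N ->
        (\int[P]_w (smoothed_objective g h r mu (x k w) - m%:E)
         <= Delta%:E)%E) ->
    nearly_critical g h r p nu B eps P (fun w => x (tau w) w).

Definition svrg_guarantee (R : realType) (d : nat) (g h : 'rV[R]_d -> R)
    (r : 'rV[R]_d -> \bar R) (L nu alpha Delta : R) (x1 : 'rV[R]_d)
    (n : nat) (gs : 'I_n -> 'rV[R]_d -> R)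
    (gam : nat -> R) (T S : nat -> nat) (K : nat) (mu B eps : R) : Prop :=
  forall (p : 'rV[R]_d -> 'rV[R]_d),
    (forall x, is_prox mu r x (p x)) ->
  forall dO (O : measurableType dO) (P : probability O R)
    (I : nat -> nat -> nat -> O -> 'I_n) (tau : {RV P >-> nat})
    (x : nat -> O -> 'rV[R]_d) (xb : nat -> nat -> O -> 'rV[R]_d)
    (xi : nat -> nat -> nat -> O -> 'rV[R]_d),
    svrg_run g h gs p L mu alpha gam T S K x1 I tau x xb xi ->
    (exists2 m : R, attains_min (smoothed_objective g h r mu) m &
      (smoothed_objective g h r mu x1 - m%:E <= Delta%:E)%E) ->
    nearly_critical g h r p nu B eps P (fun w => x (tau w) w).

(* Main.v *)
(* With s = 1/mu + gamma_k and q = grad h x_k + (prox x_k)/mu + gamma_k x_k, the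
   stage objective is, up to a constant, u |-> g u + s/2 |u|^2 - <q, u>; let D_k
   and E_k be its optimality gaps at x_k and x_(k+1). Convexity of h gives
   F x_(k+1) + D_k + gamma_k/2 |x_(k+1) - x_k|^2 <= F x_k + E_k, and for both
   solvers E[E_k] <= E[D_k]/2 + c/k. Averaging with the weights k^alpha gives
   E[D_tau] = O(1/K). The gradient of the stage objective at x_tau has squared
   norm O((L + s) D_tau), and (x_tau - w_tau)/mu is a Frechet subgradient of r at
   w_tau, so it remains to bound |x_tau - w_tau|: by 2 l mu when r is
   l-Lipschitz, and by comparing F with its value at another smoothing parameter
   when r is only bounded below.
   For SPG, E_k is controlled by a telescoping potential. For SVRG the components
   g_i need not be convex; since s >= 1/mu >= 100 L once eps is small, an epoch
   nevertheless contracts the distance to the minimizer pathwise, and for the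
   other eps the number of stages is bounded, so that crude growth bounds
   suffice. *)
From HB Require Import structures.
Require Import Defs.
From mathcomp Require Import ring lra zify measurable_realfun.

Set Implicit Arguments.
Unset Strict Implicit.
Unset Printing Implicit Defensive.

Local Open Scope classical_set_scope.
Local Open Scope ring_scope.

(** * Euclidean inner product *)

Section dot_product.
Context {R : realType} {d : nat}.
Implicit Types (u v w : 'rV[R]_d) (a b : R).

Lemma dotrC u v : dotr u v = dotr v u.
Proof. by apply: eq_bigr => i _; rewrite mulrC. Qed.

Lemma dotrDl u v w : dotr (u + v) w = dotr u w + dotr v w.
Proof.
by rewrite /dotr -big_split; apply: eq_bigr => i _; rewrite mxE mulrDl.
Qed.

Lemma dotrZl a u w : dotr (a *: u) w = a * dotr u w.
Proof. by rewrite /dotr mulr_sumr; apply: eq_bigr => i _; rewrite mxE mulrA. Qed.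

Lemma dotrNl u w : dotr (- u) w = - dotr u w.
Proof. by rewrite -scaleN1r dotrZl mulN1r. Qed.

Lemma dotr0l w : dotr 0 w = 0.
Proof. by rewrite -(scale0r 0) dotrZl mul0r. Qed.

Lemma dotrDr u v w : dotr w (u + v) = dotr w u + dotr w v.
Proof. by rewrite !(dotrC w) dotrDl. Qed.

Lemma dotrZr a u w : dotr w (a *: u) = a * dotr w u.
Proof. by rewrite !(dotrC w) dotrZl. Qed.

Lemma dotrNr u w : dotr w (- u) = - dotr w u.
Proof. by rewrite !(dotrC w) dotrNl. Qed.

Lemma dotr0r w : dotr w 0 = 0.
Proof. by rewrite dotrC dotr0l. Qed.

Definition dotrE := (dotrDl, dotrDr, dotrZl, dotrZr, dotrNl, dotrNr, dotr0l, dotr0r).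

Lemma dotr_sumr (I : Type) (s : seq I) (P : pred I) (F : I -> 'rV[R]_d) w :
  dotr w (\sum_(i <- s | P i) F i) = \sum_(i <- s | P i) dotr w (F i).
Proof.
by apply: (big_morph (dotr w)) => [u v|]; [exact: dotrDr|exact: dotr0r].
Qed.

Lemma dotr_ge0 u : 0 <= dotr u u.
Proof. by apply: sumr_ge0 => i _; rewrite -expr2 sqr_ge0. Qed.

Lemma sqr_enorm u : enorm u ^+ 2 = dotr u u.
Proof. by rewrite sqr_sqrtr // dotr_ge0. Qed.

Lemma enorm_ge0 u : 0 <= enorm u. Proof. exact: sqrtr_ge0. Qed.

Lemma enorm0 : enorm (0 : 'rV[R]_d) = 0.
Proof. by rewrite /enorm dotr0l sqrtr0. Qed.

Lemma enorm0_eq0 u : enorm u = 0 -> u = 0.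
Proof.
move=> u0; have : dotr u u = 0 by rewrite -sqr_enorm u0 expr0n.
move/eqP; rewrite psumr_eq0 => [/allP u0'|i _]; last by rewrite -expr2 sqr_ge0.
apply/rowP => i; rewrite mxE.
by have /= := u0' i (mem_index_enum _); rewrite -expr2 sqrf_eq0 => /eqP.
Qed.

Lemma enormN u : enorm (- u) = enorm u.
Proof. by rewrite /enorm !dotrE opprK. Qed.

Lemma enormB u v : enorm (u - v) = enorm (v - u).
Proof. by rewrite -enormN opprB. Qed.

Lemma enormZ a u : enorm (a *: u) = `|a| * enorm u.
Proof. by rewrite /enorm !dotrE mulrA -expr2 sqrtrM ?sqr_ge0 // sqrtr_sqr. Qed.

Lemma dotr_enorm u v : dotr u v <= enorm u * enorm v.
Proof.
have [u0|u0] := eqVneq (enorm u) 0.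
  by rewrite (enorm0_eq0 u0) dotr0l enorm0 mul0r.
have [v0|v0] := eqVneq (enorm v) 0.
  by rewrite (enorm0_eq0 v0) dotr0r enorm0 mulr0.
have un0 : 0 < enorm u by rewrite lt_def u0 enorm_ge0.
have vn0 : 0 < enorm v by rewrite lt_def v0 enorm_ge0.
have := dotr_ge0 (enorm v *: u - enorm u *: v).
rewrite !dotrE (dotrC v u) -!sqr_enorm => h.
rewrite -(ler_pM2l (mulr_gt0 un0 vn0)); move: h; move: (dotr u v) => c h.
nra.
Qed.

Lemma enormD u v : enorm (u + v) <= enorm u + enorm v.
Proof.
rewrite -(ler_pXn2r (ltn0Sn 1)) ?nnegrE ?addr_ge0 ?enorm_ge0 //.
rewrite sqr_enorm !dotrE sqrrD !sqr_enorm (dotrC v u).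
have := dotr_enorm u v; lra.
Qed.

Lemma sqr_enormD_le u v : dotr (u + v) (u + v) <= 2 * dotr u u + 2 * dotr v v.
Proof. have := dotr_ge0 (u - v); rewrite !dotrE (dotrC v u); lra. Qed.

Lemma sqr_enormB_le u v : dotr (u - v) (u - v) <= 2 * dotr u u + 2 * dotr v v.
Proof. have := dotr_ge0 (u + v); rewrite !dotrE (dotrC v u); lra. Qed.

Lemma enorm_coord u i : `|u 0 i| <= enorm u.
Proof.
rewrite -sqrtr_sqr ler_sqrt ?dotr_ge0 // /dotr (bigD1 i) //= -expr2 lerDl.
by apply: sumr_ge0 => j _; rewrite -expr2 sqr_ge0.
Qed.

Lemma mx_norm_le_enorm u : `|u| <= enorm u.
Proof.
rewrite [leLHS]/Num.norm /= mx_normrE; apply/bigmax_leP; split => [|[i j] _ /=].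
  exact: enorm_ge0.
by rewrite ord1; exact: enorm_coord.
Qed.

Lemma enorm_le_mx_norm u : enorm u <= d%:R * `|u|.
Proof.
have le_coord i : `|u 0 i| <= `|u|.
  rewrite [leRHS]/Num.norm /= mx_normrE; apply/bigmax_geP; right => /=.
  by exists (0, i).
rewrite -(ler_pXn2r (ltn0Sn 1)) ?nnegrE ?mulr_ge0 ?enorm_ge0 //.
rewrite sqr_enorm exprMn.
apply: (@le_trans _ _ (\sum_(i < d) `|u| ^+ 2)).
  apply: ler_sum => i _; rewrite -expr2 -real_normK ?num_real //.
  by rewrite lerXn2r ?nnegrE.
rewrite sumr_const card_ord -[leLHS]mulr_natl; apply: ler_wpM2r; first exact: sqr_ge0.
rewrite -natrX ler_nat; case: d => // n; exact: leq_pmulr.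
Qed.

Lemma min_quadratic (b y : 'rV[R]_d) (a : R) : 0 < a ->
  (forall u, dotr b y + a / 2 * dotr y y <= dotr b u + a / 2 * dotr u u) ->
  a *: y = - b.
Proof.
move=> a0 /(_ (- a^-1 *: b)) h.
have an0 : a != 0 by rewrite gt_eqF.
have : dotr (a *: y + b) (a *: y + b) <= 0.
  have ai0 : 0 < a^-1 by rewrite invr_gt0.
  rewrite -(pmulr_rle0 _ ai0).
  move: h; rewrite !dotrE (dotrC y b).
  have -> : dotr b b = a * (a^-1 * dotr b b) by rewrite mulVKf.
  set B := a^-1 * dotr b b; move: B (dotr b y) (dotr y y) => B c e.
  rewrite [X in _ <= X -> _](_ : _ = - B / 2); last by field.
  rewrite [X in _ -> X <= _](_ : _ = a * e + 2 * c + B); last by field.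
  lra.
move=> ab0; have : dotr (a *: y + b) (a *: y + b) == 0.
  by rewrite eq_le ab0 dotr_ge0.
rewrite -sqr_enorm sqrf_eq0 => /eqP/enorm0_eq0 /eqP.
by rewrite addr_eq0 => /eqP.
Qed.

End dot_product.

(** * Quadratically regularized convex functions *)

Section convex_gradient.
Context {R : realType} {d : nat}.
Local Notation V := 'rV[R]_d.
Implicit Types (f g : V -> R) (u v x y : V).

Lemma derive_grad f x v : differentiable (f : V -> R^o) x ->
  'D_v (f : V -> R^o) x = dotr (grad f x) v.
Proof.
move=> df; rewrite deriveE // [in LHS](row_sum_delta v) linear_sum /dotr.
by apply: eq_bigr => i _; rewrite linearZ /= mxE deriveE // mulrC.
Qed.

Lemma convex_grad g x y : convex_lsc g -> differentiable_everywhere g ->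
  g x + dotr (grad g x) (y - x) <= g y.
Proof.
move=> [_ cg] dg; rewrite -derive_grad // -lerBrDl.
have /cvg_dnbhs_at_right cD := @diff_derivable _ _ _ _ _ (y - x) (dg x).
rewrite -[leLHS](cvg_lim _ cD) //.
apply: limr_le; first by apply: cvgP cD.
near=> t.
have t0 : 0 < t by near: t; exact: nbhs_right_gt.
have t1 : t <= 1 by near: t; apply: nbhs_right_le.
have := cg (Itv01 (ltW t0) t1) y x (in_setT _) (in_setT _).
rewrite /conv /= /unstable.onem => h.
rewrite /= [_ *: _]mulrC ler_pdivrMr //.
have -> : t *: (y - x) + x = t *: y + (1 - t) *: x.
  by rewrite scalerBr scalerBl scale1r addrAC addrA.
apply: (le_trans (lerB h (lexx _))).
change (t * g y + (1 - t) * g x - g x <= (g y - g x) * t).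
lra.
Unshelve. all: by end_near. Qed.

Lemma lipschitz_grad_upper g L x y : convex_lsc g -> smooth L g ->
  g y <= g x + dotr (grad g x) (y - x) + L * dotr (y - x) (y - x).
Proof.
move=> cg [dg Lg]; have := convex_grad y x cg dg.
have : dotr (grad g y - grad g x) (y - x) <= L * dotr (y - x) (y - x).
  apply: (le_trans (dotr_enorm _ _)).
  by rewrite -sqr_enorm expr2 mulrA ler_wpM2r ?enorm_ge0.
by rewrite !dotrE; lra.
Qed.

Lemma continuous_coord i : continuous (fun u : V => u 0 i : R).
Proof. exact: coord_continuous. Qed.

Lemma continuous_dotr (T : topologicalType) (f g : T -> V) :
  continuous f -> continuous g -> continuous (fun t => dotr (f t) (g t) : R).
Proof.
move=> cf cg t; rewrite /dotr; apply: cvg_big => [|i _]; first exact: add_continuous.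
apply: cvgM.
- by apply: (continuous_comp (g := fun u : V => u 0 i) (cf t)); exact: continuous_coord.
- by apply: (continuous_comp (g := fun u : V => u 0 i) (cg t)); exact: continuous_coord.
Qed.

End convex_gradient.

Section quadratic_stage.
Context {R : realType} {d : nat}.
Local Notation V := 'rV[R]_d.
Variables (g : V -> R) (L s : R) (q : V).
Hypotheses (L0 : 0 < L) (s0 : 0 < s) (g_convex : convex_lsc g).
Hypothesis (g_smooth : smooth L g).
Implicit Types (u v x y z : V).

Definition qobj u := g u + s / 2 * dotr u u - dotr q u.

Definition qgrad u := grad g u + s *: u - q.

Lemma qobj_lower x y :
  qobj x + dotr (qgrad x) (y - x) + s / 2 * dotr (y - x) (y - x) <= qobj y.
Proof.
have := convex_grad x y g_convex g_smooth.1.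
rewrite /qobj /qgrad !dotrE (dotrC y x); lra.
Qed.

Lemma qobj_upper x y : qobj y <=
  qobj x + dotr (qgrad x) (y - x) + (L + s / 2) * dotr (y - x) (y - x).
Proof.
have := lipschitz_grad_upper x y g_convex g_smooth.
rewrite /qobj /qgrad !dotrE (dotrC y x); lra.
Qed.

Lemma qobj_continuous : continuous (qobj : V -> R).
Proof.
move=> x.
have c1 : g u @[u --> x] --> g x := differentiable_continuous (g_smooth.1 x).
have c2 : dotr u u @[u --> x] --> dotr x x.
  by apply: (continuous_dotr (f := id) (g := id)) => y; exact: cvg_id.
have c3 : dotr q u @[u --> x] --> dotr q x.
  by apply: (continuous_dotr (f := cst q) (g := id)) => y; [exact: cst_continuous|exact: cvg_id].
exact: cvgB (cvgD c1 (cvgM (cvg_cst (s / 2)) c2)) c3.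
Qed.

Lemma qobj_min : exists z, minimizes qobj z.
Proof.
pose M := 2 * enorm (qgrad 0) / s.
have M0 : 0 <= M by rewrite !mulr_ge0 ?enorm_ge0 // invr_ge0 ltW.
pose A := [set u : V | `|u| <= M].
have A0 : A !=set0 by exists 0; rewrite /A /= normr0.
have cA : compact A.
  apply: bounded_closed_compact.
    by exists M; split; [exact: num_real|move=> e Me x /= /le_trans; apply; exact: ltW].
  apply: (@preimage_closed _ _ (fun u : V => `|u|) [set x | x <= M]).
    by move=> x _; exact: norm_continuous.
  exact: closed_le.
have [|z zA zmin] := EVT_min_rV A0 cA (f := qobj).
  exact/continuous_subspaceT/qobj_continuous.
exists z => y; have [yM|My] := leP `|y| M; first by apply: zmin; rewrite inE.
apply: (@le_trans _ _ (qobj 0)); first by apply: zmin; rewrite inE /A /= normr0.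
have My' : M < enorm y := lt_le_trans My (mx_norm_le_enorm y).
have := qobj_lower 0 y; rewrite !subr0 -(sqr_enorm y).
have : - (enorm (qgrad 0) * enorm y) <= dotr (qgrad 0) y.
  by have := dotr_enorm (- qgrad 0) y; rewrite dotrNl enormN lerNl.
move: My'; rewrite /M ltr_pdivrMr // => h1 h2 h3.
have y0 : 0 <= enorm y := enorm_ge0 y.
nra.
Qed.

Definition qmin : V := xget 0 [set z | minimizes qobj z].

Lemma qmin_min u : qobj qmin <= qobj u.
Proof. by have [z zmin] := qobj_min; apply: (xgetPex 0 (ex_intro _ z zmin)). Qed.

Lemma sqr_qgrad_le u :
  dotr (qgrad u) (qgrad u) <= 4 * (L + s / 2) * (qobj u - qobj qmin).
Proof.
pose M := L + s / 2; have M0 : 0 < M by rewrite addr_gt0 // divr_gt0.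
have := qobj_upper u (u - (2 * M)^-1 *: qgrad u).
have := qmin_min (u - (2 * M)^-1 *: qgrad u).
rewrite (addrAC u) subrr add0r -scaleNr -/M !dotrZr !dotrZl.
move: (dotr _ _) => D h1 h2.
have {h1 h2} := le_trans h1 h2.
rewrite [X in _ <= X -> _](_ : _ = qobj u - D / (4 * M)); last first.
  by field; rewrite gt_eqF.
rewrite lerBrDr -lerBrDl ler_pdivrMr; last by rewrite mulr_gt0.
by rewrite mulrC.
Qed.

Lemma qgrad_qmin : qgrad qmin = 0.
Proof.
apply/enorm0_eq0/eqP; rewrite -sqrf_eq0 eq_le sqr_ge0 andbT sqr_enorm.
by apply: (le_trans (sqr_qgrad_le _)); rewrite subrr mulr0.
Qed.

Lemma qobj_qmin_lower u : s / 2 * dotr (u - qmin) (u - qmin) <= qobj u - qobj qmin.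
Proof. by have := qobj_lower qmin u; rewrite qgrad_qmin dotr0l; lra. Qed.

Lemma qobj_qmin_upper u :
  qobj u - qobj qmin <= (L + s / 2) * dotr (u - qmin) (u - qmin).
Proof. by have := qobj_upper qmin u; rewrite qgrad_qmin dotr0l; lra. Qed.

Lemma qobj_convex (I : eqType) (r : seq I) (w : I -> R) (y : I -> V) (m : V) :
  (forall i, 0 <= w i) -> \sum_(i <- r) w i != 0 ->
  m = (\sum_(i <- r) w i)^-1 *: \sum_(i <- r) w i *: y i ->
  (\sum_(i <- r) w i) * qobj m <= \sum_(i <- r) w i * qobj (y i).
Proof.
move=> w0 W0 mE.
have : dotr (qgrad m) (\sum_(i <- r) w i *: (y i - m)) = 0.
  under eq_bigr do rewrite scalerBr.
  rewrite sumrB -scaler_suml {2}mE scalerA mulfV // scale1r subrr dotr0r //.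
rewrite dotr_sumr => h.
rewrite mulr_suml -[leLHS]addr0 -[X in _ + X <= _]h -big_split /=.
apply: ler_sum => i _; rewrite dotrZr -mulrDr ler_wpM2l //.
apply: le_trans (qobj_lower m _); rewrite lerDl mulr_ge0 ?dotr_ge0 //.
by rewrite divr_ge0 // ltW.
Qed.

(* The error [e] is split off as [y' - yh = - (s + a)^-1 *: e] from the exact
   step [yh], so that the remaining inner product is linear in [e]. *)
Lemma qobj_prox_step (a : R) y y' yh e : 2 * L <= a ->
  (s + a) *: y' = a *: y + q - grad g y - e ->
  (s + a) *: yh = a *: y + q - grad g y ->
  qobj y' - qobj qmin + (s + a) / 2 * dotr (y' - qmin) (y' - qmin) <=
  a / 2 * dotr (y - qmin) (y - qmin) - dotr e (yh - qmin)
  + (s + a)^-1 * dotr e e.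
Proof.
move=> La y'E yhE; set z := qmin.
have a0 : 0 < a by apply: lt_le_trans La; rewrite mulr_gt0.
have sa0 : s + a != 0 by rewrite gt_eqF // addr_gt0.
have eE : e = (s + a) *: (yh - y') by rewrite scalerBr y'E yhE opprB addrCA subrr addr0.
have -> : (s + a)^-1 * dotr e e = dotr e (yh - y').
  by rewrite [in X in dotr _ X]eE dotrZr mulKf.
have qE : q = (s + a) *: y' - a *: y + grad g y + e by rewrite y'E; apply/rowP => i; rewrite !mxE; ring.
have := lipschitz_grad_upper y y' g_convex g_smooth.
have := convex_grad y z g_convex g_smooth.1.
have : L * dotr (y' - y) (y' - y) <= a / 2 * dotr (y' - y) (y' - y).
  by rewrite ler_wpM2r ?dotr_ge0 //; lra.
rewrite /qobj qE; move: (grad g y) => G.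
rewrite !dotrE (dotrC y' y) (dotrC z y') (dotrC z y); lra.
Qed.

End quadratic_stage.

(** * Proximal map and stage objective *)

Section prox.
Context {R : realType} {d : nat}.
Local Notation V := 'rV[R]_d.
Variables (r : V -> \bar R) (mu : R).
Hypotheses (r_proper : proper r) (mu0 : 0 < mu).
Implicit Types (u v x y w : V).

Lemma prox_fin_num x w : is_prox mu r x w -> r w \is a fin_num.
Proof.
move=> pw; case: r_proper => rN [y ry]; have := pw y.
rewrite fin_numE rN /= -(fineK ry) => h; apply/eqP => rw; move: h.
by rewrite rw addey.
Qed.

Lemma prox_le x w y : is_prox mu r x w -> r y \is a fin_num ->
  (2 * mu)^-1 * dotr (w - x) (w - x) + fine (r w) <=
  (2 * mu)^-1 * dotr (y - x) (y - x) + fine (r y).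
Proof.
move=> pw ry; have := pw y.
by rewrite -(fineK ry) -(fineK (prox_fin_num pw)) !sqr_enorm /= -!EFinD lee_fin.
Qed.

Lemma moreau_prox x w : is_prox mu r x w ->
  moreau mu r x = ((2 * mu)^-1 * dotr (w - x) (w - x) + fine (r w))%:E.
Proof.
move=> pw; rewrite EFinD fineK ?(prox_fin_num pw) // -sqr_enorm.
apply/eqP; rewrite eq_le; apply/andP; split.
  by apply: ereal_inf_lbound; exists w.
by apply: le_ereal_inf_tmp => _ [y _ <-]; exact: pw.
Qed.

Lemma moreau_le x w : r w \is a fin_num ->
  (moreau mu r x <= ((2 * mu)^-1 * dotr (w - x) (w - x) + fine (r w))%:E)%E.
Proof.
move=> rw; rewrite EFinD fineK // -sqr_enorm.
by apply: ereal_inf_lbound; exists w.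
Qed.

Lemma prox_frechet x w : is_prox mu r x w ->
  frechet_subdiff r w (mu^-1 *: (x - w)).
Proof.
move=> pw; rewrite /frechet_subdiff /= limf_einfE.
apply/lee_subgt0Pr => e e0; rewrite sub0e.
pose A := [set y : V | y != w /\ enorm (y - w) <= 2 * mu * e].
apply: (@le_trans _ _ (ereal_inf ((fun y =>
   (r y - r w - (dotr (mu^-1 *: (x - w)) (y - w))%:E) *
   ((enorm (y - w))^-1)%:E)%E @` A))); last first.
  apply: ereal_sup_ubound; exists A => //.
  have de0 : 0 < 2 * mu * e / d.+1%:R by rewrite divr_gt0 // !mulr_gt0.
  apply/nbhs_ballP; exists (2 * mu * e / d.+1%:R) => //= y yb yw; split=> //.
  apply: (le_trans (enorm_le_mx_norm _)).
  have : `|y - w| < 2 * mu * e / d.+1%:R by move: yb; rewrite -ball_normE /ball_ /= distrC.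
  rewrite ltr_pdivlMr // => h; apply: le_trans (ltW h).
  by rewrite mulrC ler_wpM2l // ler_nat.
apply: le_ereal_inf_tmp => _ [y [yw yd] <-].
have n0 : 0 < enorm (y - w).
  rewrite lt_def enorm_ge0 andbT; apply: contra yw => /eqP/enorm0_eq0/eqP.
  by rewrite subr_eq0.
have rN := r_proper.1 y.
case ry : (r y) rN => [s||] // _; last first.
  have E (a b : R) : (+oo - a%:E - b%:E = +oo :> \bar R)%E by [].
  rewrite -(fineK (prox_fin_num pw)) E.
  by rewrite gt0_mulye ?leey // lte_fin invr_gt0.
have ryf : r y \is a fin_num by rewrite ry.
have := prox_le pw ryf; rewrite ry -(fineK (prox_fin_num pw)) /=.
move: (fine (r w)) => t h.
rewrite -!EFinB -EFinM lee_fin -ler_pdivrMr ?invr_gt0 // invrK.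
have -> : mu^-1 *: (x - w) = (2 * mu)^-1 *: (2 *: (x - w)).
  by rewrite scalerA; congr (_ *: _); field; rewrite gt_eqF.
have : (2 * mu)^-1 * dotr (y - w) (y - w) <= e * enorm (y - w).
  rewrite ler_pdivrMl ?mulr_gt0 // -sqr_enorm expr2 mulrA.
  by rewrite ler_wpM2r // enorm_ge0.
move: h; rewrite dotrZl; move: (_^-1) => c; rewrite !dotrE.
rewrite (dotrC y x) (dotrC w x) (dotrC w y); lra.
Qed.

Lemma set_dist_le (a b c : V) (v : set V) : v b ->
  (set_dist [set a] [set (c + u)%R | u in v] <= (enorm (a - (c + b)))%:E)%E.
Proof.
by move=> vb; apply: ereal_inf_lbound; exists a, (c + b); split => //; exists b.
Qed.

Lemma set_dist_ge0 (A B : set V) : (0 <= set_dist A B)%E.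
Proof.
by apply: le_ereal_inf_tmp => _ [a [b [_ _ ->]]]; rewrite lee_fin enorm_ge0.
Qed.

End prox.

Section dc_stage.
Context {R : realType} {d : nat}.
Local Notation V := 'rV[R]_d.
Variables (g h : V -> R) (r : V -> \bar R) (L nu mu gam : R) (p : V -> V).
Hypotheses (r_proper : proper r) (mu0 : 0 < mu) (gam0 : 0 <= gam) (L0 : 0 < L).
Hypotheses (g_convex : convex_lsc g) (h_convex : convex_lsc h).
Hypotheses (g_smooth : smooth L g) (h_holder : holder_grad L nu h).
Hypothesis (p_prox : forall x, is_prox mu r x (p x)).
Implicit Types (u v x y w : V).

(* [F x] as a real number, for the selection [p] of the proximal map. *)
Definition sobj x := g x - h x + (2 * mu)^-1 * dotr (p x - x) (p x - x)
  + fine (r (p x)).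

Lemma smoothed_objectiveE x : smoothed_objective g h r mu x = (sobj x)%:E.
Proof.
by rewrite /smoothed_objective (moreau_prox r_proper (p_prox x)) -EFinD addrA.
Qed.

Lemma sobj_le x y : sobj y <= g y - h y +
  (2 * mu)^-1 * dotr (p x - y) (p x - y) + fine (r (p x)).
Proof.
have := moreau_le mu y (prox_fin_num r_proper (p_prox x)).
by rewrite (moreau_prox r_proper (p_prox y)) lee_fin /sobj -!addrA !lerD2l.
Qed.

Definition stage_modulus := mu^-1 + gam.

Definition stage_slope x := grad h x + mu^-1 *: p x + gam *: x.

Local Notation phi x := (qobj g stage_modulus (stage_slope x)).

Lemma stage_modulus_gt0 : 0 < stage_modulus.
Proof. by rewrite ltr_pwDl // invr_gt0. Qed.

Lemma sobj_descent x y :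
  sobj y + gam / 2 * dotr (y - x) (y - x) <= sobj x + (phi x y - phi x x).
Proof.
have := sobj_le x y; have := convex_grad x y h_convex h_holder.1.
rewrite /sobj /qobj /stage_slope /stage_modulus.
have -> : (2 * mu)^-1 = mu^-1 / 2 by rewrite invfM mulrC.
move: (mu^-1) => c; rewrite !dotrE.
rewrite (dotrC y x) (dotrC (p x) x) (dotrC (p x) y) => h1 h2; lra.
Qed.

Lemma dist_le x (w := p x) :
  (set_dist [set grad h w] [set (grad g w + v)%R | v in frechet_subdiff r w] <=
   (L * enorm (x - w) `^ nu + L * enorm (x - w)
    + enorm (qgrad g stage_modulus (stage_slope x) x))%:E)%E.
Proof.
apply: (le_trans (set_dist_le _ _ (prox_frechet r_proper mu0 (p_prox x)))).
rewrite lee_fin -/w.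
have -> : grad h w - (grad g w + mu^-1 *: (x - w)) =
  (grad h w - grad h x) + (grad g x - grad g w)
  - qgrad g stage_modulus (stage_slope x) x.
  by apply/rowP => i; rewrite /qgrad /stage_slope /stage_modulus !mxE; ring.
apply: (le_trans (enormD _ _)); rewrite enormN lerD2r.
apply: (le_trans (enormD _ _)).
rewrite (enormB x w) lerD //; first exact: h_holder.2.
by rewrite (enormB w); exact: g_smooth.2.
Qed.

End dc_stage.

(** * Weighted averages *)

Section weighted_averages.
Context {R : realType}.
Variable alpha : R.
Hypothesis alpha1 : 1 <= alpha.

Let alpha0 : 0 <= alpha. Proof. exact: le_trans alpha1. Qed.

Lemma ler_powR_nat (m n : nat) (a : R) : 0 <= a -> (m <= n)%N ->
  m%:R `^ a <= n%:R `^ a.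
Proof. by move=> a0 mn; rewrite ge0_ler_powR ?nnegrE ?ler0n ?ler_nat. Qed.

Lemma sum_powR_lower (K : nat) :
  K%:R * K%:R `^ alpha <= 2 `^ (alpha + 1) * \sum_(1 <= j < K.+1) j%:R `^ alpha.
Proof.
set S := \sum_(1 <= j < K.+1) _.
have -> : 2 `^ (alpha + 1) * S = 2 `^ alpha * (S + S).
  rewrite powRD ?powRr1 //; first by ring.
  by rewrite gt_eqF // ltr_wpDl.
rewrite {2}/S big_nat_rev /= /S -big_split /= mulr_sumr.
have -> : K%:R * K%:R `^ alpha = \sum_(1 <= j < K.+1) K%:R `^ alpha :> R.
  by rewrite sumr_const_nat subSS subn0 mulr_natl.
rewrite big_nat [leRHS]big_nat; apply: ler_sum => j /andP[j1 jK].
have h1 : j%:R `^ alpha + (1 + K.+1 - j.+1)%:R `^ alpha >= (K%:R / 2) `^ alpha :> R.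
  have [h|h] := leqP K (j * 2)%N.
    rewrite -[leLHS]addr0 lerD ?powR_ge0 // ge0_ler_powR ?nnegrE ?divr_ge0 //.
    by rewrite ler_pdivrMr // -natrM ler_nat.
  rewrite -[leLHS]add0r lerD ?powR_ge0 // ge0_ler_powR ?nnegrE ?divr_ge0 //.
  by rewrite ler_pdivrMr // -natrM ler_nat; lia.
apply: le_trans (ler_wpM2l (powR_ge0 _ _) h1).
by rewrite -powRM ?divr_ge0 // mulrC divfK.
Qed.

Lemma weighted_sum_le (a b : nat -> R) (D c : R) (K : nat) : 0 <= c ->
  (forall k, (1 <= k <= K)%N -> a k <= D) ->
  (forall k, (1 <= k <= K)%N -> a k.+1 + b k / 2 <= a k + c / k%:R) ->
  \sum_(1 <= k < K.+1) k%:R `^ alpha * b k <=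
  2 * (D + c - a K.+1) * K%:R `^ alpha.
Proof.
move=> c0; elim: K => [|K IH] aD ab.
  by rewrite big_nil powR0 ?mulr0 // gt_eqF // (lt_le_trans _ alpha1).
rewrite big_nat_recr //=.
have {}IH : \sum_(1 <= k < K.+1) k%:R `^ alpha * b k <=
    2 * (D + c - a K.+1) * K%:R `^ alpha.
  by apply: IH => k /andP[k1 kK]; [apply: aD|apply: ab]; rewrite k1 leqW.
apply: (le_trans (lerD IH (lexx _))).
have := ab K.+1 (leqnn _).
have := aD K.+1 (leqnn _).
set w := K.+1%:R `^ alpha; set w' := K%:R `^ alpha.
have w0 : 0 <= w := powR_ge0 _ _.
have ww' : w' <= w by exact: ler_powR_nat.
have wc : w' + w / K.+1%:R <= w.
  have K0 : K.+1%:R != 0 :> R by [].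
  have -> : w = K.+1%:R * K.+1%:R `^ (alpha - 1).
    by rewrite mulr_powRB1 // (lt_le_trans _ alpha1).
  have -> : w' = K%:R * K%:R `^ (alpha - 1).
    by rewrite mulr_powRB1 // (lt_le_trans _ alpha1).
  rewrite mulrAC mulfV // mul1r -[X in _ + X]mul1r.
  rewrite -[X in _ <= X * _]natr1 mulrDl lerD2r ler_wpM2l //.
  by apply: ler_powR_nat => //; rewrite subr_ge0.
move=> h1 h2.
have h3 : 0 <= (D - a K.+1) * (w - w') by rewrite mulr_ge0 // subr_ge0.
have wc' : 0 <= w - w' - w / K.+1%:R by rewrite -addrA -opprD subr_ge0.
have h4 := mulr_ge0 c0 wc'.
have h5 := ler_wpM2l w0 h2.
move: h3 h4 h5; move: (a K.+1) (a K.+2) (b K.+1) (K.+1%:R^-1) => x x' y i; lra.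
Qed.

Lemma weighted_average_le (a b : nat -> R) (D c : R) (K : nat) : 0 <= c ->
  (0 < K)%N -> 0 <= a K.+1 ->
  (forall k, (1 <= k <= K)%N -> a k <= D) ->
  (forall k, (1 <= k <= K)%N -> a k.+1 + b k / 2 <= a k + c / k%:R) ->
  0 <= D ->
  \sum_(1 <= k < K.+1)
    k%:R `^ alpha / (\sum_(1 <= j < K.+1) j%:R `^ alpha) * b k <=
  2 `^ (alpha + 2) * (D + c) / K%:R.
Proof.
move=> c0 K0 aK aD ab D0; have := weighted_sum_le c0 aD ab.
have := sum_powR_lower K; set S := \sum_(1 <= j < K.+1) j%:R `^ alpha => hS h.
have KR : 0 < K%:R :> R by rewrite ltr0n.
have w0 : 0 < K%:R `^ alpha by rewrite powR_gt0.
have t0 : 0 < 2 `^ (alpha + 1) :> R by rewrite powR_gt0.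
have S0 : 0 < S.
  by rewrite -(pmulr_rgt0 _ t0) (lt_le_trans _ hS) // mulr_gt0.
have -> : 2 `^ (alpha + 2) = 2 `^ (alpha + 1) * 2 :> R.
  have -> : alpha + 2 = (alpha + 1) + 1 by ring.
  by rewrite powRD ?powRr1 //; apply/implyP.
under eq_bigr do rewrite mulrAC.
rewrite -mulr_suml ler_pdivrMr //; apply: (le_trans h).
rewrite [leRHS]mulrAC ler_pdivlMr //.
have h1 : 0 <= a K.+1 * K%:R `^ alpha by rewrite mulr_ge0 // ltW.
have h2 : 0 <= D + c by rewrite addr_ge0.
have := ler_wpM2l h2 hS; nra.
Qed.

End weighted_averages.

(** * Independence and integration *)

Section nonmeasurable_le.
Context d (T : measurableType d) (R : realType) (mu : {measure set T -> \bar R}).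

Lemma ge0_le_integral_nonmeas (f1 f2 : T -> \bar R) :
  (forall x, 0 <= f1 x)%E -> (forall x, f1 x <= f2 x)%E ->
  (\int[mu]_x f1 x <= \int[mu]_x f2 x)%E.
Proof.
move=> f10 f12.
have f20 x : (0 <= f2 x)%E by apply: le_trans (f12 x).
rewrite !ge0_integralTE //; apply: ereal_sup_le => _ [h /= hf <-].
by exists h => // x; exact: le_trans (f12 x).
Qed.

End nonmeasurable_le.

Section history.
Context {R : realType} dO (O : measurableType dO) (P : probability O R).
Variables (I : choiceType) (F : I -> set (set O)).
Hypothesis F_indep : mutually_independent P F.
Hypothesis F_meas : forall i A, F i A -> measurable A.
Hypothesis F_setT : forall i, F i setT.
Hypothesis F_setI : forall i, setI_closed (F i).

Definition hist (J : set I) : set (set O) := [set A | exists2 i, J i & F i A].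

Lemma hist_sub_measurable (J : set I) : hist J `<=` (measurable : set (set O)).
Proof. by move=> A [i _ /F_meas]. Qed.

Let Pi (J : set I) : set (set O) := [set B | exists s : seq I, exists A : I -> set O,
  [/\ uniq s, forall i, i \in s -> J i, forall i, F i (A i)
    & B = \bigcap_(i in [set` s]) A i]].

Let Pi_setI J : setI_closed (Pi J).
Proof.
move=> _ _ [s [A [us sJ FA ->]]] [s' [A' [us' sJ' FA' ->]]].
exists (undup (s ++ s')).
exists (fun i => (if i \in s then A i else setT) `&`
                 (if i \in s' then A' i else setT)); split.
- exact: undup_uniq.
- by move=> i; rewrite mem_undup mem_cat => /orP[/sJ|/sJ'].
- by move=> i; apply: F_setI; case: ifP.
- apply/seteqP; split => w.
    move=> [h h'] i /= _; split; case: ifP => // is_; [exact: h|exact: h'].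
  move=> h; split => i /= is_; have := h i; rewrite /= mem_undup mem_cat is_ ?orbT.
    by case=> //.
  by case=> //.
Qed.

Lemma indep_hist (J : set I) i A B : ~ J i -> F i A -> <<s hist J >> B ->
  P (B `&` A) = (P A * P B)%E.
Proof.
move=> Ji FA hB.
have mA := F_meas FA.
have PA0 : 0 <= fine (P A) by apply: fine_ge0.
have -> : (P A * P B)%E = mscale (NngNum PA0) P B.
  by rewrite /mscale /= fineK // fin_num_measure.
have PiM : Pi J `<=` (measurable : set (set O)).
  move=> _ [s [A' [_ _ FA' ->]]]; rewrite bigcap_seq; apply: bigsetI_measurable => k _.
  exact: F_meas (FA' k).
have PiT : Pi J setT.
  by exists [::], (fun=> setT); split => //; apply/seteqP; split.
have histPi : hist J `<=` Pi J.
  move=> C [j Jj FC]; exists [:: j], (fun k => if k == j then C else setT); split=> //.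
  - by move=> k; rewrite inE => /eqP ->.
  - by move=> k; case: ifP => // /eqP ->.
  - apply/seteqP; split => w; first by move=> Cw k /=; rewrite inE => /eqP ->; rewrite eqxx.
    by move=> /(_ j); rewrite /= inE eqxx; exact.
have hB' : <<s Pi J >> B by move: hB; apply: sub_sigma_algebra2.
rewrite -[LHS]/(mrestr P mA B).
apply: (@g_sigma_algebra_measure_unique _ _ _ (Pi J) PiM (fun=> setT)
   _ _ _ _ _ _ _ _ hB') => //.
- by apply/seteqP; split => // w _; exists 0%N.
- move=> _ [s [A' [us sJ FA' ->]]].
  have is_ : i \notin s by apply/negP => /sJ.
  have := @F_indep (i :: s) (fun k => if k == i then A else A' k).
  rewrite /= is_ us => /(_ isT) h.
  have E : \bigcap_(k in [set` s]) A' k =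
           \bigcap_(k in [set` s]) (if k == i then A else A' k).
    apply: eq_bigcapr => k /= ks; case: eqP => // ki.
    by move: is_; rewrite -ki ks.
  have h2 := @F_indep s A' us (fun k _ => FA' k).
  rewrite /mrestr /mscale /=.
  have mB : measurable (\bigcap_(k in [set` s]) A' k).
    by rewrite bigcap_seq; apply: bigsetI_measurable => k _; exact: F_meas (FA' k).
  rewrite -[LHS]fineK ?fin_num_measure //; last exact: measurableI.
  rewrite -[X in _ = (_ * X)%E]fineK ?fin_num_measure // -EFinM; congr EFin.
  rewrite h2.
  have -> : \bigcap_(k in [set` s]) A' k `&` A =
     \bigcap_(k in [set` i :: s]) (if k == i then A else A' k).
    apply/seteqP; split => w.
      move=> [h3 h4] k /=; rewrite inE => /orP[/eqP ->|ks]; first by rewrite eqxx.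
      by case: eqP => // _; exact: h3.
    move=> h3; split; last by have := h3 i; rewrite /= inE eqxx; exact.
    move=> k /= ks; have := h3 k; rewrite /= inE ks orbT => /(_ isT).
    by case: eqP => // ki; move: is_; rewrite -ki ks.
  rewrite h; last first.
    by move=> k _; case: ifP => // /eqP ->.
  rewrite big_cons eqxx; congr (_ * _).
  by apply: eq_big_seq => k ks; case: eqP => // ki; move: is_; rewrite -ki ks.
- move=> _ /=; rewrite /mrestr setTI.
  by rewrite (le_lt_trans (probability_le1 P mA)) // ltry.
Qed.

End history.

Section joint_law.
Context {R : realType} dO (O : measurableType dO) (P : probability O R).
Context dW (W : measurableType dW) dS (S : measurableType dS).
Variables (G : set (set O)) (f : O -> W) (Z : {RV P >-> S}) (Q : probability S R).
Hypothesis G_meas : G `<=` (measurable : set (set O)).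
Hypothesis f_meas :
  measurable_fun [set: g_sigma_algebraType G] (f : g_sigma_algebraType G -> W).
Hypothesis Z_law : forall C, measurable C -> P (Z @^-1` C) = Q C.
Hypothesis Z_indep : forall B C, <<s G >> B -> measurable C ->
  P (B `&` Z @^-1` C) = (P B * P (Z @^-1` C))%E.

Lemma sub_measurable_fun : measurable_fun setT f.
Proof.
move=> _ B mB; have := f_meas measurableT mB; apply: smallest_sub => //.
exact: sigma_algebra_measurable.
Qed.

Lemma ge0_integral_joint (phi : (W * S)%type -> \bar R) :
  measurable_fun [set: (W * S)%type] phi -> (forall z, 0 <= phi z)%E ->
  (\int[P]_w phi (f w, Z w) = \int[P]_w \int[Q]_s phi (f w, s))%E.
Proof.
move=> mphi phi0.
pose X : {RV P >-> W} := HB.pack f (isMeasurableFun.Build _ _ _ _ f sub_measurable_fun).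
have mfZ : measurable_fun setT (fun w => (f w, Z w)).
  by apply/measurable_fun_pair => //; exact: sub_measurable_fun.
pose XZ : {RV P >-> (W * S)%type} :=
  HB.pack (fun w => (f w, Z w)) (isMeasurableFun.Build _ _ _ _ _ mfZ).
transitivity (\int[distribution P XZ]_z phi z)%E.
  by rewrite ge0_integral_distribution.
transitivity (\int[distribution P X \x Q]_z phi z)%E.
  apply: eq_measure_integral => A mA _.
  apply/esym/product_measure_unique => // B C mB mC.
  change (P (f @^-1` B `&` Z @^-1` C) = P (f @^-1` B) * Q C)%E.
  rewrite -(Z_law mC) Z_indep //.
  by have := f_meas measurableT mB; rewrite setTI.
rewrite fubini_tonelli1 // ge0_integral_distribution //.
- exact: measurable_fun_fubini_tonelli_F.
- by move=> w; apply: integral_ge0.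
Qed.

End joint_law.

Section sampled_index_mixture.
Context {R : realType} dO (O : measurableType dO) (P : probability O R).
Variables (alpha : R) (K : nat) (tau : {RV P >-> nat}) (G : set (set O)).
Hypothesis tau_sampled : sampled_index alpha K tau.
Hypothesis G_meas : G `<=` (measurable : set (set O)).
Hypothesis tau_indep : forall (C : set nat) B, <<s G >> B ->
  P (B `&` tau @^-1` C) = (P B * P (tau @^-1` C))%E.

Lemma integral_sampled (X : nat -> O -> R) (f : O -> \bar R) :
  (forall k, measurable_fun [set: g_sigma_algebraType G]
    (X k : g_sigma_algebraType G -> R)) ->
  (forall k w, 0 <= X k w) -> (forall w, 0 <= f w)%E ->
  (forall w, f w <= (X (tau w) w)%:E)%E ->
  (\int[P]_w f w <= \sum_(1 <= k < K.+1)
     (k%:R `^ alpha / \sum_(1 <= j < K.+1) j%:R `^ alpha)%:E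
     * \int[P]_w (X k w)%:E)%E.
Proof.
move=> mX X0 f0 fX.
have [tauK tauP] := tau_sampled.
have mX' k : measurable_fun setT (X k) by exact: (sub_measurable_fun G_meas (mX k)).
have mtau k : measurable (tau @^-1` [set k]) by rewrite -[X in measurable X]setTI; apply: measurable_funP.
apply: (@le_trans _ _ (\int[P]_w (\sum_(1 <= k < K.+1)
   (X k w)%:E * (\1_(tau @^-1` [set k]) w)%:E))%E).
  apply: ge0_le_integral_nonmeas => // w; apply: (le_trans (fX w)).
  have /andP[t1 tK] := tauK w.
  rewrite (bigD1_seq (tau w)) ?mem_index_iota ?t1 ?ltnS ?iota_uniq //=.
  rewrite indicE mem_set //= mule1 leeDl //.
  by apply: sume_ge0 => k _; rewrite mule_ge0 ?lee_fin.
rewrite ge0_integral_sum //; last 2 first.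
- move=> k; apply: emeasurable_funM; first exact/measurable_EFinP/mX'.
  exact/measurable_EFinP/measurable_indic.
- by move=> k w _; rewrite mule_ge0 ?lee_fin.
rewrite big_nat [leRHS]big_nat; apply: lee_sum => k kK.
have -> : (k%:R `^ alpha / \sum_(1 <= j < K.+1) j%:R `^ alpha)%:E
  = P (tau @^-1` [set k]) by rewrite -tauP.
have mT : measurable_fun setT (fun w => tau w == k).
  by apply: (measurableT_comp (f := fun n : nat => n == k)).
pose T : {RV P >-> bool} := HB.pack (fun w => tau w == k)
  (isMeasurableFun.Build _ _ _ _ (fun w => tau w == k) mT).
pose phi (z : (g_sigma_algebraType G * bool)%type) := ((X k z.1)%:E * (z.2%:R)%:E)%E.
have TE : T @^-1` [set true] = tau @^-1` [set k].
  by apply/seteqP; split => w /= /eqP.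
have iE w : (\1_(tau @^-1` [set k]) w)%:E = ((T w)%:R)%:E :> \bar R.
  rewrite indicE -TE; case Tw : (T w); first by rewrite mem_set.
  by rewrite memNset // => Tw'; move: Tw; rewrite Tw'.
under eq_integral do rewrite iE.
rewrite (@ge0_integral_joint _ _ _ P _ (g_sigma_algebraType G) _ _ G id T
   (distribution P T) G_meas _ _ _ phi) //=.
- have mb : measurable_fun setT (fun b : bool => (b%:R)%:E : \bar R).
    by apply/measurable_EFinP; exact: (measurableT_comp (f := fun b : bool => b%:R : R)).
  have intphi w : (\int[distribution P T]_s phi (w, s) =
      (X k w)%:E * \int[distribution P T]_s (s%:R)%:E)%E.
    rewrite /phi /= ge0_integralZl // ?lee_fin //.
  under eq_integral do rewrite intphi.
  rewrite ge0_integralZr //.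
  + rewrite muleC ge0_integral_distribution //.
    rewrite le_eqVlt; apply/orP; left; apply/eqP; congr (_ * _)%E.
    transitivity (\int[P]_w (\1_(tau @^-1` [set k]) w)%:E)%E.
      by apply: eq_integral => w _; rewrite iE.
    by rewrite integral_indic // setIT.
  + exact/measurable_EFinP.
  + by move=> w _; rewrite lee_fin.
  + by apply: integral_ge0 => b _; rewrite lee_fin.
- move=> B C hB _.
  exact: (tau_indep [set n | C (n == k)] hB).
- apply: emeasurable_funM; apply/measurable_EFinP.
  + exact: (measurableT_comp (mX k) measurable_fst).
  + by apply: (measurableT_comp (f := fun b : bool => b%:R : R)).
- by move=> z; rewrite mule_ge0 ?lee_fin.
Qed.

Hypothesis K_gt0 : (0 < K)%N.

Lemma integral_sampled_affine (N D : nat -> O -> R) (n dd : nat -> R)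
    (a0 a1 a2 SN SD : R) (f : O -> \bar R) :
  (forall k, (1 <= k <= K)%N -> measurable_fun [set: g_sigma_algebraType G]
    (N k : g_sigma_algebraType G -> R)) ->
  (forall k, (1 <= k <= K)%N -> measurable_fun [set: g_sigma_algebraType G]
    (D k : g_sigma_algebraType G -> R)) ->
  (forall k w, 0 <= N k w) -> (forall k w, (1 <= k <= K)%N -> 0 <= D k w) ->
  (forall k, (1 <= k <= K)%N -> \int[P]_w (N k w)%:E <= (n k)%:E)%E ->
  (forall k, (1 <= k <= K)%N -> \int[P]_w (D k w)%:E <= (dd k)%:E)%E ->
  0 <= a0 -> 0 <= a1 -> 0 <= a2 ->
  \sum_(1 <= k < K.+1)
     (k%:R `^ alpha / \sum_(1 <= j < K.+1) j%:R `^ alpha) * n k <= SN ->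
  \sum_(1 <= k < K.+1)
     (k%:R `^ alpha / \sum_(1 <= j < K.+1) j%:R `^ alpha) * dd k <= SD ->
  (forall w, 0 <= f w)%E ->
  (forall w, (1 <= tau w <= K)%N ->
    f w <= (a0 + a1 * N (tau w) w + a2 * D (tau w) w)%:E)%E ->
  (\int[P]_w f w <= (a0 + a1 * SN + a2 * SD)%:E)%E.
Proof.
move=> mN mD N0 D0 nE dE a00 a10 a20 hSN hSD f0 fX.
pose c := \sum_(1 <= j < K.+1) j%:R `^ alpha : R.
pose X k w := if (1 <= k <= K)%N then a0 + a1 * N k w + a2 * D k w else 0.
have mX k : measurable_fun [set: g_sigma_algebraType G]
    (X k : g_sigma_algebraType G -> R).
  rewrite /X; case kK : (0 < k <= K)%N => //.
  apply: measurable_funD; first apply: measurable_funD => //.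
  - by apply: measurable_funM => //; exact: mN.
  - by apply: measurable_funM => //; exact: mD.
have X0 k w : 0 <= X k w.
  by rewrite /X; case: ifP => // kK; rewrite !addr_ge0 // mulr_ge0 // D0.
have [tauK _] := tau_sampled.
have fX' w : (f w <= (X (tau w) w)%:E)%E by rewrite /X tauK; exact: fX.
apply: (le_trans (integral_sampled mX X0 f0 fX')).
have c0 : 0 < c.
  rewrite /c big_nat_recl //= (@lt_le_trans _ _ (1 `^ alpha)) ?powR_gt0 //.
  by rewrite lerDl sumr_ge0 // => j _; exact: powR_ge0.
have pk k : 0 <= k%:R `^ alpha / c by rewrite divr_ge0 ?powR_ge0 // ltW.
apply: (@le_trans _ _ (\sum_(1 <= k < K.+1)
  (k%:R `^ alpha / c * (a0 + a1 * n k + a2 * dd k))%:E)%E).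
  rewrite big_nat [leRHS]big_nat; apply: lee_sum => k kK.
  have kK' : (1 <= k <= K)%N by [].
  rewrite [leRHS]EFinM; apply: lee_wpmul2l; first by rewrite lee_fin.
  have mN' := sub_measurable_fun G_meas (mN k kK).
  have mD' := sub_measurable_fun G_meas (mD k kK).
  have -> : (\int[P]_w (X k w)%:E = \int[P]_w
    (a0%:E + (a1%:E * (N k w)%:E + a2%:E * (D k w)%:E)))%E.
    by apply: eq_integral => w _; rewrite /X kK' -!EFinM -!EFinD addrA.
  rewrite ge0_integralD //; first last.
  - apply: emeasurable_funD; apply: emeasurable_funM => //; exact/measurable_EFinP.
  - by move=> w _; rewrite adde_ge0 // mule_ge0 ?lee_fin // D0.
  rewrite integral_cst // [X in (_ * X + _)%E](_ : _ = 1%E); last exact: probability_setT.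
  rewrite mule1 ge0_integralD //; first last.
  - by apply: emeasurable_funM => //; exact/measurable_EFinP.
  - by move=> w _; rewrite mule_ge0 ?lee_fin // D0.
  - by apply: emeasurable_funM => //; exact/measurable_EFinP.
  - by move=> w _; rewrite mule_ge0 ?lee_fin.
  have EZ (a : R) (Y : O -> R) : 0 <= a -> measurable_fun setT Y ->
      (forall w, 0 <= Y w) ->
      (\int[P]_w (a%:E * (Y w)%:E) = a%:E * \int[P]_w (Y w)%:E)%E.
    move=> a_ge0 mY Y0; apply: ge0_integralZl => //; first exact/measurable_EFinP.
    by move=> w _; rewrite lee_fin.
  rewrite !EZ //; last by move=> w; exact: D0.
  rewrite -addrA !EFinD !EFinM leeD2l // leeD // lee_wpmul2l ?lee_fin //.
  - exact: nE.
  - exact: dE.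
rewrite sumEFin lee_fin.
under eq_bigr do rewrite !mulrDr.
rewrite !big_split /= -mulr_suml lerD // ?lerD //.
- by rewrite -mulr_suml divff ?mul1r // gt_eqF.
- apply: le_trans (ler_wpM2l a10 hSN); rewrite mulr_sumr.
  by apply: ler_sum => k _; rewrite mulrCA.
- apply: le_trans (ler_wpM2l a20 hSD); rewrite mulr_sumr.
  by apply: ler_sum => k _; rewrite mulrCA.
Qed.

End sampled_index_mixture.

(** * Stagewise descent *)

Lemma lee_cancel_half (R : realType) (A B q : \bar R) (e c : R) :
  (A + (e%:E + q) <= B + ((2^-1)%:E * e%:E + c%:E))%E ->
  (A + (2^-1)%:E * e%:E + q <= B + c%:E)%E.
Proof.
case: A => [a||]; case: q => [q||]; case: B => [b||] //.
by rewrite -!EFinM -!EFinD !lee_fin; lra.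
all: by move=> _; first [exact: leey | exact: leNye].
Qed.

Section stagewise.
Context {R : realType} {d : nat}.
Local Notation V := 'rV[R]_d.
Variables (g h : V -> R) (r : V -> \bar R) (L nu mu alpha : R) (p : V -> V).
Hypotheses (r_proper : proper r) (mu0 : 0 < mu) (L0 : 0 < L).
Hypotheses (nu0 : 0 < nu) (nu1 : nu <= 1) (alpha1 : 1 <= alpha).
Hypotheses (g_convex : convex_lsc g) (h_convex : convex_lsc h).
Hypotheses (g_smooth : smooth L g) (h_holder : holder_grad L nu h).
Hypothesis (p_prox : forall x, is_prox mu r x (p x)).
Variable gam : nat -> R.
Hypothesis gam0 : forall k, 0 <= gam k.

(* [F_k] for [x_k = x], up to a constant independent of [u]. *)
Definition stage_obj k (x u : V) : R :=
  qobj g (stage_modulus mu (gam k)) (stage_slope h mu (gam k) p x) u.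

Definition stage_min k (x : V) : V :=
  qmin g (stage_modulus mu (gam k)) (stage_slope h mu (gam k) p x).

Definition stage_gap k (x y : V) : R :=
  stage_obj k x y - stage_obj k x (stage_min k x).

Let sk0 k : 0 < stage_modulus mu (gam k).
Proof. exact: stage_modulus_gt0. Qed.

Lemma stage_gap_ge0 k x y : 0 <= stage_gap k x y.
Proof. by rewrite subr_ge0; exact: (qmin_min _ _ g_convex g_smooth). Qed.

Lemma stage_gap_le k x m : (forall y, m <= sobj g h r mu p y) ->
  stage_gap k x x <= sobj g h r mu p x - m.
Proof.
move=> hm; have := sobj_descent g (gam k) r_proper h_convex h_holder p_prox x (stage_min k x).
have := hm (stage_min k x).
have : 0 <= gam k / 2 * dotr (stage_min k x - x) (stage_min k x - x).
  by rewrite mulr_ge0 ?dotr_ge0 // divr_ge0.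
rewrite /stage_gap /stage_obj; lra.
Qed.

Lemma stage_descent k x y :
  sobj g h r mu p y + stage_gap k x x + gam k / 2 * dotr (y - x) (y - x) <=
  sobj g h r mu p x + stage_gap k x y.
Proof.
have := sobj_descent g (gam k) r_proper h_convex h_holder p_prox x y.
rewrite /stage_gap /stage_obj; lra.
Qed.

Context dO (O : measurableType dO) (P : probability O R).
Variables (K : nat) (tau : {RV P >-> nat}) (G : set (set O)) (x : nat -> O -> V).
Hypothesis tau_sampled : sampled_index alpha K tau.
Hypothesis G_meas : G `<=` (measurable : set (set O)).
Hypothesis tau_indep : forall (C : set nat) B, <<s G >> B ->
  P (B `&` tau @^-1` C) = (P B * P (tau @^-1` C))%E.
Hypothesis K_gt0 : (0 < K)%N.

Local Notation Gmeasurable f := (measurable_fun [set: g_sigma_algebraType G]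
    (f : g_sigma_algebraType G -> R)).

Variables (m Delta c : R).
Hypothesis c0 : 0 <= c.
Hypothesis m_le : forall y, m <= sobj g h r mu p y.
Hypothesis sobj_meas : forall k, (1 <= k <= K.+1)%N ->
  Gmeasurable (fun w => sobj g h r mu p (x k w)).
Hypothesis gap_meas : forall k, (1 <= k <= K)%N ->
  Gmeasurable (fun w => stage_gap k (x k w) (x k w)).
Hypothesis gap_meas' : forall k, (1 <= k <= K)%N ->
  Gmeasurable (fun w => stage_gap k (x k w) (x k.+1 w)).
Hypothesis step_meas : forall k, (1 <= k <= K)%N ->
  Gmeasurable (fun w => dotr (x k.+1 w - x k w) (x k.+1 w - x k w)).
Hypothesis res_meas : forall k, (1 <= k <= K)%N ->
  Gmeasurable (fun w => dotr (x k w - p (x k w)) (x k w - p (x k w))).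
Hypothesis Esobj_le : forall k, (1 <= k <= K)%N ->
  (\int[P]_w (sobj g h r mu p (x k w) - m)%:E <= Delta%:E)%E.
Hypothesis Egap_le : forall k, (1 <= k <= K)%N ->
  (\int[P]_w (stage_gap k (x k w) (x k.+1 w))%:E <=
   2^-1%:E * \int[P]_w (stage_gap k (x k w) (x k w))%:E + (c / k%:R)%:E)%E.

Let Phi k w := sobj g h r mu p (x k w) - m.
Let D k w := stage_gap k (x k w) (x k w).
Let E k w := stage_gap k (x k w) (x k.+1 w).
Let Q k w := dotr (x k.+1 w - x k w) (x k.+1 w - x k w).
Let N k w := dotr (x k w - p (x k w)) (x k w - p (x k w)).

Let Phi0 k w : 0 <= Phi k w. Proof. by rewrite subr_ge0. Qed.
Let D0 k w : 0 <= D k w. Proof. exact: stage_gap_ge0. Qed.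
Let E0 k w : 0 <= E k w. Proof. exact: stage_gap_ge0. Qed.
Let Q0 k w : 0 <= Q k w. Proof. exact: dotr_ge0. Qed.
Let gQ0 k w : 0 <= gam k / 2 * Q k w.
Proof. by apply: mulr_ge0 (Q0 _ _); rewrite divr_ge0. Qed.

Let Gsub (f : O -> R) : Gmeasurable f -> measurable_fun [set: O] f.
Proof. by move=> mf; exact: (sub_measurable_fun G_meas mf). Qed.

Let mPhi k : (1 <= k <= K.+1)%N -> measurable_fun setT (Phi k).
Proof. by move=> kK; apply: measurable_funB; [exact: (Gsub (sobj_meas kK))|exact: measurable_cst]. Qed.

Let Delta0 : 0 <= Delta.
Proof.
rewrite -lee_fin; apply: le_trans (Esobj_le (k := 1) _); last by rewrite K_gt0.
by apply: integral_ge0 => w _; rewrite lee_fin; exact: Phi0.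
Qed.

Let ED_le k : (1 <= k <= K)%N -> (\int[P]_w (D k w)%:E <= Delta%:E)%E.
Proof.
move=> kK; apply: le_trans (Esobj_le kK).
by apply: ge0_le_integral_nonmeas => w; rewrite lee_fin ?D0 // stage_gap_le.
Qed.

Let ED_fin k : (1 <= k <= K)%N -> (\int[P]_w (D k w)%:E)%E \is a fin_num.
Proof.
move=> kK; rewrite ge0_fin_numE; last by apply: integral_ge0 => w _; rewrite lee_fin.
exact: le_lt_trans (ED_le kK) (ltry _).
Qed.

Let rec k : (1 <= k <= K)%N ->
  (\int[P]_w (Phi k.+1 w)%:E + (2^-1)%:E * \int[P]_w (D k w)%:E
   + (gam k / 2)%:E * \int[P]_w (Q k w)%:E
   <= \int[P]_w (Phi k w)%:E + (c / k%:R)%:E)%E.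
Proof.
move=> kK.
have kK1 : (1 <= k <= K.+1)%N by lia.
have kK2 : (1 <= k.+1 <= K.+1)%N by lia.
have m1 := mPhi kK2; have m2 := Gsub (gap_meas kK).
have m3 := Gsub (step_meas kK); have m4 := mPhi kK1.
have m5 := Gsub (gap_meas' kK).
have g2 : 0 <= gam k / 2 by rewrite divr_ge0.
have : (\int[P]_w ((Phi k.+1 w)%:E + ((D k w)%:E + (gam k / 2)%:E * (Q k w)%:E)) <=
        \int[P]_w ((Phi k w)%:E + (E k w)%:E))%E.
  apply: ge0_le_integral_nonmeas => w.
    by rewrite -EFinM -!EFinD lee_fin; exact: addr_ge0 (Phi0 _ _) (addr_ge0 (D0 _ _) (gQ0 _ _)).
  rewrite -EFinM -!EFinD lee_fin.
  have := stage_descent k (x k w) (x k.+1 w).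
  rewrite /Phi /D /E /Q; lra.
have EQ : (\int[P]_w ((gam k / 2)%:E * (Q k w)%:E) =
           (gam k / 2)%:E * \int[P]_w (Q k w)%:E)%E.
  apply: ge0_integralZl => //; first exact/measurable_EFinP.
  by move=> w _; rewrite lee_fin Q0.
rewrite ge0_integralD //; first last.
- apply: emeasurable_funD; first exact/measurable_EFinP.
  by apply: emeasurable_funM => //; exact/measurable_EFinP.
- by move=> w _; rewrite -EFinM -EFinD lee_fin; exact: addr_ge0 (D0 _ _) (gQ0 _ _).
- exact/measurable_EFinP.
- by move=> w _; rewrite lee_fin ?Phi0 ?D0 ?E0.
rewrite ge0_integralD //; first last.
- by apply: emeasurable_funM => //; exact/measurable_EFinP.
- by move=> w _; rewrite -EFinM lee_fin; exact: gQ0.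
- exact/measurable_EFinP.
- by move=> w _; rewrite lee_fin ?Phi0 ?D0 ?E0.
rewrite EQ ge0_integralD //; first last.
- exact/measurable_EFinP.
- by move=> w _; rewrite lee_fin ?Phi0 ?D0 ?E0.
- exact/measurable_EFinP.
- by move=> w _; rewrite lee_fin ?Phi0 ?D0 ?E0.
move=> h1; have {h1} := le_trans h1 (leeD2l _ (Egap_le kK)).
have -> : (\int[P]_w (D k w)%:E = (fine (\int[P]_w (D k w)%:E))%:E)%E.
  by rewrite fineK // ED_fin.
exact: lee_cancel_half.
Qed.

Let EPhi_ge0 k : (0 <= \int[P]_w (Phi k w)%:E)%E.
Proof. by apply: integral_ge0 => w _; rewrite lee_fin Phi0. Qed.

Let ED_ge0 k : (0 <= \int[P]_w (D k w)%:E)%E.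
Proof. by apply: integral_ge0 => w _; rewrite lee_fin D0. Qed.

Let EQ_ge0 k : (0 <= (gam k / 2)%:E * \int[P]_w (Q k w)%:E)%E.
Proof.
apply: mule_ge0; first by rewrite lee_fin divr_ge0.
by apply: integral_ge0 => w _; rewrite lee_fin Q0.
Qed.

Let hED_ge0 k : (0 <= (2^-1)%:E * \int[P]_w (D k w)%:E)%E.
Proof. by apply: mule_ge0 => //; rewrite lee_fin. Qed.

Let EPhi_next k : (1 <= k <= K)%N ->
  (\int[P]_w (Phi k.+1 w)%:E <= (Delta + c / k%:R)%:E)%E.
Proof.
move=> kK; rewrite EFinD; apply: le_trans (leeD2r _ (Esobj_le kK)).
apply: le_trans (rec kK); rewrite -addeA leeDl //.
exact: adde_ge0.
Qed.

Let EPhi_fin k : (1 <= k <= K.+1)%N -> (\int[P]_w (Phi k w)%:E)%E \is a fin_num.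
Proof.
move=> /andP[k1 kK]; rewrite ge0_fin_numE //.
move: kK; rewrite leq_eqVlt => /predU1P[->|kK].
  by apply: le_lt_trans (EPhi_next _) (ltry _); rewrite K_gt0 leqnn.
by apply: le_lt_trans (Esobj_le _) (ltry _); rewrite k1.
Qed.

Lemma expected_step_le k : (1 <= k <= K)%N ->
  ((gam k / 2)%:E * \int[P]_w (dotr (x k.+1 w - x k w) (x k.+1 w - x k w))%:E
   <= (Delta + c)%:E)%E.
Proof.
move=> kK; apply: (@le_trans _ _ (Delta%:E + (c / k%:R)%:E)%E); last first.
  rewrite -EFinD lee_fin lerD2l ler_piMr // invf_le1 ?ltr0n ?ler1n;
  by case/andP: kK.
apply: le_trans (leeD2r _ (Esobj_le kK)).
by apply: le_trans (rec kK); rewrite leeDr // adde_ge0.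
Qed.

Lemma expected_gap_average :
  \sum_(1 <= k < K.+1) k%:R `^ alpha / (\sum_(1 <= j < K.+1) j%:R `^ alpha) *
    fine (\int[P]_w (stage_gap k (x k w) (x k w))%:E) <=
  2 `^ (alpha + 2) * (Delta + c) / K%:R.
Proof.
apply: (weighted_average_le alpha1 (a := fun k => fine (\int[P]_w (Phi k w)%:E))) => //.
- exact: fine_ge0.
- by move=> k kK; rewrite -lee_fin fineK ?Esobj_le // EPhi_fin //; lia.
- move=> k kK; have kK1 : (1 <= k <= K.+1)%N by lia.
  have kK2 : (1 <= k.+1 <= K.+1)%N by lia.
  rewrite -lee_fin !EFinD mulrC EFinM !fineK ?EPhi_fin ?ED_fin //.
  by apply: le_trans (rec kK); rewrite leeDl.
Qed.

Lemma expected_gap_fin k : (1 <= k <= K)%N ->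
  (\int[P]_w (stage_gap k (x k w) (x k w))%:E)%E \is a fin_num.
Proof. exact: ED_fin. Qed.

Let powR_le_affine (e s : R) : 0 < e -> 0 <= s ->
  s `^ nu <= e `^ nu * (1 + s ^+ 2 / e ^+ 2).
Proof.
move=> e0 s0; pose t := s / e.
have t0 : 0 <= t by rewrite divr_ge0 // ltW.
have -> : s = e * t by rewrite mulrC divfK // gt_eqF.
rewrite powRM ?(ltW e0) // ler_wpM2l ?powR_ge0 //.
have -> : (e * t) ^+ 2 / e ^+ 2 = t ^+ 2 by field; rewrite gt_eqF.
have [t1|t1] := leP t 1.
  apply: (@le_trans _ _ 1); last by rewrite lerDl sqr_ge0.
  have -> : 1 = 1 `^ nu :> R by rewrite powR1.
  by apply: ge0_ler_powR; rewrite ?nnegrE //; exact: ltW.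
apply: (le_trans (ler1_powR (ltW t1) nu1)); nra.
Qed.

Let le_sqr_affine (e s : R) : 0 < e -> s <= e / 2 + s ^+ 2 / (2 * e).
Proof.
move=> e0; have : 0 <= (s - e) ^+ 2 / (2 * e) by rewrite divr_ge0 ?sqr_ge0 // mulr_ge0 // ltW.
suff -> : (s - e) ^+ 2 / (2 * e) = e / 2 + s ^+ 2 / (2 * e) - s by rewrite subr_ge0.
by field; rewrite gt_eqF.
Qed.

Lemma stagewise_nearly_critical (eps A A3 M B : R) : 0 < eps < 1 ->
  0 <= A ->
  (forall k, (1 <= k <= K)%N ->
     \int[P]_w (dotr (x k w - p (x k w)) (x k w - p (x k w)))%:E
     <= (A * eps ^+ 2)%:E)%E ->
  0 <= M ->
  (forall k, (1 <= k <= K)%N -> 4 * (L + stage_modulus mu (gam k) / 2) <= M) ->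
  M * (2 `^ (alpha + 2) * (Delta + c) / K%:R) <= A3 * (eps `^ nu) ^+ 2 ->
  (1 + A) + 2 * L * (1 + A) + 1 + A3 <= B ->
  nearly_critical g h r p nu B eps P (fun w => x (tau w) w).
Proof.
move=> /andP[e0 e1] A0 hN M0 hM hA3 hB.
have en0 : 0 < eps `^ nu by rewrite powR_gt0.
have een : eps <= eps `^ nu by apply: ger1_powR => //; rewrite e0 ltW.
have A30 : 0 <= A3.
  rewrite -(pmulr_lge0 _ (exprn_gt0 2 en0)); apply: le_trans hA3.
  by rewrite mulr_ge0 // divr_ge0 // mulr_ge0 ?powR_ge0 // addr_ge0.
have LA : 0 <= L * (1 + A) by rewrite mulr_ge0 ?addr_ge0 // ltW.
have Sp : \sum_(1 <= k < K.+1)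
     (k%:R `^ alpha / \sum_(1 <= j < K.+1) j%:R `^ alpha) * (A * eps ^+ 2)
     <= A * eps ^+ 2.
  rewrite -mulr_suml -mulr_suml; set S := (\sum_(1 <= j < K.+1) _).
  rewrite ler_piMl ?mulr_ge0 ?(ltW e0) //.
  by have [->|S0] := eqVneq S 0; [rewrite mul0r|rewrite divff].

have main (a0 a1 a2 : R) (f : O -> \bar R) : 0 <= a0 -> 0 <= a1 -> 0 <= a2 ->
    (forall w, 0 <= f w)%E ->
    (forall w, (1 <= tau w <= K)%N ->
      f w <= (a0 + a1 * N (tau w) w + a2 * D (tau w) w)%:E)%E ->
    (\int[P]_w f w <= (a0 + a1 * (A * eps ^+ 2)
      + a2 * (2 `^ (alpha + 2) * (Delta + c) / K%:R))%:E)%E.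
  move=> a00 a10 a20 f0 fle.
  apply: (integral_sampled_affine tau_sampled G_meas tau_indep K_gt0
    res_meas gap_meas _ _ hN _ a00 a10 a20 Sp expected_gap_average f0 fle).
  - by move=> k w; exact: dotr_ge0.
  - by move=> k w _; exact: D0.
  - by move=> k kK; rewrite fineK // expected_gap_fin.
split.
- rewrite unlock.
  apply: (le_trans (main (eps / 2) (2 * eps)^-1 0 _ _ _ _ _ _)) => //.
  + by rewrite divr_ge0 // ltW.
  + by rewrite invr_ge0 mulr_ge0 // ltW.
  + by move=> w; rewrite lee_fin enorm_ge0.
  + move=> w _; rewrite lee_fin mul0r addr0 /N -sqr_enorm [X in _ <= _ + X]mulrC.
    exact: le_sqr_affine.
  + rewrite lee_fin mul0r addr0.
    have -> : eps / 2 + (2 * eps)^-1 * (A * eps ^+ 2) = (1 + A) / 2 * eps.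
      by field; rewrite gt_eqF.
    by rewrite ler_wpM2r ?(ltW e0) //; lra.
- apply: (le_trans (main (L * eps `^ nu + L * (eps / 2) + eps `^ nu / 2)
     (L * eps `^ nu / eps ^+ 2 + L / (2 * eps)) (M / (2 * eps `^ nu))
     _ _ _ _ _ _)) => //.
  + by rewrite !addr_ge0 ?mulr_ge0 ?divr_ge0 // ?ltW.
  + by rewrite !addr_ge0 ?mulr_ge0 ?divr_ge0 // ?invr_ge0 ?exprn_ge0 ?mulr_ge0 // ltW.
  + by rewrite divr_ge0 // mulr_ge0 // ltW.
  + by move=> w; exact: set_dist_ge0.
  + move=> w tK; set k := tau w; set y := x k w.
    apply: (le_trans (dist_le (gam k) r_proper mu0 g_smooth h_holder p_prox y)).
    rewrite lee_fin.
    set t := enorm (y - p y).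
    have h1 := powR_le_affine e0 (enorm_ge0 (y - p y)); rewrite -/t in h1.
    have h2 := le_sqr_affine t e0.
    set v := qgrad _ _ _ _.
    have h3 := le_sqr_affine (enorm v) en0.
    have h4 : enorm v ^+ 2 <= M * D k w.
      rewrite sqr_enorm; apply: (le_trans (sqr_qgrad_le _ L0 (sk0 k) g_convex g_smooth y)).
      by apply: ler_wpM2r; [exact: D0|exact: hM].
    have -> : N k w = t ^+ 2 by rewrite /N sqr_enorm.
    have h5 : enorm v ^+ 2 / (2 * eps `^ nu) <= M * D k w / (2 * eps `^ nu).
      by rewrite ler_wpM2r // invr_ge0 mulr_ge0 // ltW.
    have h6 := ler_wpM2l (ltW L0) h1.
    have h7 := ler_wpM2l (ltW L0) h2.
    rewrite [leRHS](_ : _ = L * (eps `^ nu * (1 + t ^+ 2 / eps ^+ 2)) +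
       L * (eps / 2 + t ^+ 2 / (2 * eps)) +
       (eps `^ nu / 2 + M * D k w / (2 * eps `^ nu))); last first.
      by field; rewrite !gt_eqF.
    by rewrite !lerD // (le_trans h3) // lerD2l.
  + rewrite lee_fin.
    have h1 : M / (2 * eps `^ nu) * (2 `^ (alpha + 2) * (Delta + c) / K%:R) <=
        A3 / 2 * eps `^ nu.
      rewrite mulrAC ler_pdivrMr ?mulr_gt0 //; apply: (le_trans hA3).
      by rewrite le_eqVlt; apply/orP; left; apply/eqP; field.
    apply: (le_trans (lerD (lexx _) h1)).
    rewrite [leLHS](_ : _ = (L * (1 + A) + 2^-1 + A3 / 2) * eps `^ nu +
      L * (1 + A) / 2 * eps); last by field; rewrite gt_eqF.
    apply: (@le_trans _ _ ((L * (1 + A) + 2^-1 + A3 / 2) * eps `^ nu +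
      L * (1 + A) / 2 * eps `^ nu)).
      by rewrite lerD2l ler_wpM2l // divr_ge0.
    rewrite -mulrDl ler_wpM2r ?(ltW en0) //; lra.
Qed.

End stagewise.

(** * Rates in eps *)

Section rates.
Context {R : realType}.

Lemma natceil_ge (y : R) : 0 <= y -> y <= (natceil y)%:R.
Proof.
move=> y0; rewrite /natceil.
have c0 : 0 <= Num.ceil y by rewrite ceil_ge0 (lt_le_trans _ y0) // ltrN10.
rewrite -[leRHS]/((`|Num.ceil y|%N : int)%:~R) gez0_abs //; exact: ceil_ge.
Qed.

Lemma natceil_le (y : R) : 0 <= y -> (natceil y)%:R <= y + 1.
Proof.
move=> y0; rewrite /natceil.
have c0 : 0 <= Num.ceil y by rewrite ceil_ge0 (lt_le_trans _ y0) // ltrN10.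
rewrite -[leLHS]/((`|Num.ceil y|%N : int)%:~R) gez0_abs //.
by have := ceilB1_lt y; rewrite intrD -lerBlDr => /ltW.
Qed.

Lemma natceil_gt0 (y : R) : 0 < y -> (0 < natceil y)%N.
Proof.
move=> y0; rewrite -(@ltr_nat R); exact: lt_le_trans y0 (natceil_ge (ltW y0)).
Qed.

Variables (C q eps : R).
Hypotheses (C0 : 0 < C) (q0 : 0 <= q) (eps01 : 0 < eps < 1).
Let K := natceil (C * (1 / eps) `^ q).

Let e0 : 0 < eps. Proof. by case/andP: eps01. Qed.
Let ie1 : 1 <= 1 / eps.
Proof. by rewrite div1r invf_ge1 // ltW //; case/andP: eps01. Qed.

Lemma inv_eps_powR_ge1 (s : R) : 0 <= s -> 1 <= (1 / eps) `^ s.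
Proof. by move=> s0; rewrite -[leLHS](powRr0 (1 / eps)) ler_powR. Qed.

Lemma inv_eps_powR_le (s t : R) : s <= t -> (1 / eps) `^ s <= (1 / eps) `^ t.
Proof. by move=> st; rewrite ler_powR. Qed.

Lemma stages_gt0 : (0 < K)%N.
Proof. by rewrite natceil_gt0 // mulr_gt0 // powR_gt0 // divr_gt0. Qed.

Lemma stages_ge : C * (1 / eps) `^ q <= K%:R.
Proof. by rewrite natceil_ge // mulr_ge0 ?powR_ge0 // ltW. Qed.

Lemma stages_le : K%:R <= (C + 1) * (1 / eps) `^ q.
Proof.
apply: le_trans (natceil_le _) _; first by rewrite mulr_ge0 ?powR_ge0 // ltW.
by rewrite mulrDl lerD2l (le_trans (inv_eps_powR_ge1 q0)) // [leRHS]mul1r.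
Qed.

Lemma stages_powR_le (b : R) : 0 <= b ->
  K%:R `^ b <= (C + 1) `^ b * (1 / eps) `^ (q * b).
Proof.
move=> b0; rewrite powRrM -powRM ?powR_ge0 //; last by rewrite addr_ge0 // ltW.
apply: ge0_ler_powR; rewrite ?nnegrE ?ler0n //; last exact: stages_le.
by rewrite mulr_ge0 ?powR_ge0 // addr_ge0 // ltW.
Qed.

Variables (L b cg : R) (a : nat).
Hypotheses (L0 : 0 < L) (b0 : 0 <= b) (cg0 : 0 < cg) (qba : q * b <= a%:R).

Definition smoothness_const := 4 * L + 2 + 2 * cg * (C + 1) `^ b.

Lemma smoothness_const_gt0 : 0 < smoothness_const.
Proof.
have : 0 <= 2 * cg * (C + 1) `^ b by rewrite !mulr_ge0 ?powR_ge0 // ltW.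
rewrite /smoothness_const; move: (2 * cg * _) => y y0.
by rewrite ltr_pwDl // addr_gt0 // mulr_gt0.
Qed.

Lemma stage_smoothness_le (k : nat) : (k <= K)%N ->
  4 * (L + stage_modulus (eps ^+ a) (cg * k%:R `^ b) / 2) <=
  smoothness_const * (1 / eps) `^ a%:R.
Proof.
move=> kK; rewrite /stage_modulus /smoothness_const.
have -> : (eps ^+ a)^-1 = (1 / eps) `^ a%:R.
  by rewrite powR_mulrn ?divr_ge0 ?ltW // div1r exprVn.
have h1 := inv_eps_powR_ge1 (ler0n R a).
have h2 : k%:R `^ b <= (C + 1) `^ b * (1 / eps) `^ a%:R.
  apply: le_trans (ler_powR_nat b0 kK) (le_trans (stages_powR_le b0) _).
  by rewrite ler_wpM2l ?powR_ge0 // inv_eps_powR_le.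
have h3 := ler_wpM2l (ltW cg0) h2.
have h4 := ler_wpM2l (ltW L0) h1.
move: ((1 / eps) `^ a%:R) h1 h2 h3 h4 => E *; nra.
Qed.

Variables (nu X : R).
Hypotheses (X0 : 0 <= X) (qnu : 2 * nu + a%:R <= q).

Lemma gap_rate_le :
  smoothness_const * (1 / eps) `^ a%:R * (X / K%:R) <=
  smoothness_const * X / C * (eps `^ nu) ^+ 2.
Proof.
have K0 : 0 < K%:R :> R by rewrite ltr0n stages_gt0.
have E : (eps `^ nu) ^+ 2 = ((1 / eps) `^ (2 * nu))^-1.
  rewrite -powR_mulrn ?powR_ge0 // -powRrM mulrC -powRN.
  by rewrite div1r -powR_inv1 ?ltW // -powRrM mulN1r opprK.
have h1 : (1 / eps) `^ (2 * nu) * (1 / eps) `^ a%:R <= K%:R / C.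
  rewrite -powRD; last by apply/implyP => _; rewrite gt_eqF // divr_gt0.
  rewrite ler_pdivlMr // mulrC; apply: le_trans stages_ge.
  by rewrite ler_wpM2l ?(ltW C0) // inv_eps_powR_le.
have P0 : 0 < (1 / eps) `^ (2 * nu) by rewrite powR_gt0 // divr_gt0.
rewrite E ler_pdivlMr //.
have -> : smoothness_const * (1 / eps) `^ a%:R * (X / K%:R) * (1 / eps) `^ (2 * nu) =
   smoothness_const * X / K%:R * ((1 / eps) `^ (2 * nu) * (1 / eps) `^ a%:R) by ring.
apply: (@le_trans _ _ (smoothness_const * X / K%:R * (K%:R / C))).
  by rewrite ler_wpM2l // divr_ge0 ?ler0n // mulr_ge0 // ltW // smoothness_const_gt0.
by rewrite le_eqVlt; apply/orP; left; apply/eqP; field; rewrite !gt_eqF.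
Qed.

End rates.

(** * The proximal residual *)

Section prox_residual.
Context {R : realType} {d : nat}.
Local Notation V := 'rV[R]_d.
Variables (g h : V -> R) (r : V -> \bar R) (mu : R) (p : V -> V).
Hypotheses (r_proper : proper r) (mu0 : 0 < mu).
Hypothesis p_prox : forall x, is_prox mu r x (p x).

Local Notation res x := (dotr (x - p x) (x - p x)).

Lemma dotrBC (u v : V) : dotr (u - v) (u - v) = dotr (v - u) (v - u).
Proof. by rewrite -(opprB v u) dotrNl dotrNr opprK. Qed.

Lemma residual_lipschitz (l : R) x : (forall x, r x \is a fin_num) ->
  (forall x y, `|fine (r x) - fine (r y)| <= l * enorm (x - y)) ->
  res x <= 4 * l ^+ 2 * mu ^+ 2.
Proof.
move=> rf rl; have := prox_le r_proper (p_prox x) (rf x).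
rewrite subrr dotr0r mulr0 add0r dotrBC -sqr_enorm => h1.
have h2 := le_trans (ler_norm _) (rl x (p x)).
set n := enorm _ in h1 h2 *.
have n0 : 0 <= n := enorm_ge0 _.
have : (2 * mu)^-1 * n ^+ 2 <= l * n by lra.
rewrite ler_pdivrMl ?mulr_gt0 // => h3.
have [->|n1] := eqVneq n 0.
  by rewrite expr0n /=; apply: mulr_ge0 (sqr_ge0 _); apply: mulr_ge0 (sqr_ge0 _).
have np : 0 < n by rewrite lt_def n1.
have h4 : n <= 2 * mu * l by rewrite -(ler_pM2r np) -expr2 (le_trans h3) // mulrA.
have -> : 4 * l ^+ 2 * mu ^+ 2 = (2 * mu * l) ^+ 2 by ring.
by rewrite lerXn2r // nnegrE // (le_trans n0).
Qed.

Lemma residual_minorant (mu' m' : R) x : 2 * mu <= mu' ->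
  attains_min (smoothed_objective g h r mu') m' ->
  res x <= 4 * mu * (sobj g h r mu p x - m').
Proof.
move=> mumu' [_ hm]; have mu'0 : 0 < mu' by apply: lt_le_trans mumu'; rewrite mulr_gt0.
have rp := prox_fin_num r_proper (p_prox x).
have := le_trans (hm x) (leeD2l _ (moreau_le mu' x rp)).
rewrite -EFinD lee_fin /sobj !(dotrBC (p x) x).
have : (2 * mu')^-1 <= (4 * mu)^-1 by rewrite lef_pV2 ?posrE ?mulr_gt0 //; lra.
have -> : (2 * mu)^-1 = 2 * (4 * mu)^-1 by field; rewrite gt_eqF.
move: (dotr_ge0 (x - p x)); move: (res x) => N N0.
set i := (4 * mu)^-1 => h1 h2.
have i0 : 0 < i by rewrite invr_gt0 mulr_gt0.
have -> : 4 * mu = i^-1 by rewrite /i invrK.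
rewrite ler_pdivlMl //.
have := ler_wpM2r N0 h1; lra.
Qed.

Lemma sobj_min_le m y : r y \is a fin_num ->
  attains_min (smoothed_objective g h r mu) m -> m <= g y - h y + fine (r y).
Proof.
move=> ry [_ hm].
have := le_trans (hm y) (leeD2l _ (moreau_le mu y ry)).
by rewrite subrr dotr0l mulr0 add0r -EFinD lee_fin.
Qed.

Lemma residual_coarse (b0 : R) x x1 y : mu <= 1 ->
  (forall x, b0%:E <= r x)%E -> r y \is a fin_num ->
  res x <= 2 * (fine (r y) - b0) + 2 * dotr (y - x1) (y - x1)
           + 2 * dotr (x - x1) (x - x1).
Proof.
move=> mu1 rb ry.
have bp : b0 <= fine (r (p x)).
  by rewrite -lee_fin fineK // (prox_fin_num r_proper (p_prox x)).
have by' : b0 <= fine (r y) by rewrite -lee_fin fineK.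
have h1 := prox_le r_proper (p_prox x) ry.
have h2 : dotr (y - x) (y - x) <= 2 * dotr (y - x1) (y - x1) + 2 * dotr (x - x1) (x - x1).
  apply: le_trans (sqr_enormB_le _ _).
  by rewrite (_ : y - x1 - (x - x1) = y - x) //; apply/rowP => i; rewrite !mxE; ring.
rewrite (dotrBC x).
have h3 : (2 * mu)^-1 * dotr (p x - x) (p x - x) <=
          (2 * mu)^-1 * (dotr (y - x) (y - x)) + (fine (r y) - b0) by lra.
move: h3; rewrite ler_pdivrMl ?mulr_gt0 // mulrDr mulrA divff ?mul1r; last first.
  by rewrite gt_eqF // mulr_gt0.
have : 2 * mu * (fine (r y) - b0) <= 2 * (fine (r y) - b0).
  by rewrite ler_wpM2r ?subr_ge0 //; lra.
lra.
Qed.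

Variables (x1 : V) (x : nat -> V).
Hypothesis x_init : x 1%N = x1.

Lemma displacement_le k : (1 <= k)%N ->
  dotr (x k - x1) (x k - x1) <=
  2 ^+ k * \sum_(1 <= j < k) dotr (x j.+1 - x j) (x j.+1 - x j).
Proof.
elim: k => // -[_ _|k IH _]; first by rewrite x_init subrr dotr0l big_nil mulr0.
rewrite big_nat_recr //=.
have -> : x k.+2 - x1 = (x k.+1 - x1) + (x k.+2 - x k.+1).
  by apply/rowP => i; rewrite !mxE; ring.
apply: (le_trans (sqr_enormD_le _ _)); rewrite mulrDr exprS lerD //.
  by rewrite -mulrA ler_wpM2l // IH.
by rewrite ler_wpM2r ?dotr_ge0 // ler_peMr // exprn_ege1 // ler1n.
Qed.

End prox_residual.

Section residual_integral.
Context {R : realType} {d : nat}.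
Local Notation V := 'rV[R]_d.
Variables (g h : V -> R) (r : V -> \bar R) (mu : R) (p : V -> V).
Hypotheses (r_proper : proper r) (mu0 : 0 < mu).
Hypothesis p_prox : forall x, is_prox mu r x (p x).
Context dO (O : measurableType dO) (P : probability O R).
Variables (x1 : V) (x : nat -> O -> V) (K : nat).
Local Notation N k w := (dotr (x k w - p (x k w)) (x k w - p (x k w))).

Lemma integral_residual_minorant (mu' m' m Delta : R) y k :
  2 * mu <= mu' -> attains_min (smoothed_objective g h r mu') m' ->
  attains_min (smoothed_objective g h r mu) m -> r y \is a fin_num ->
  measurable_fun setT (fun w => sobj g h r mu p (x k w)) ->
  (\int[P]_w (sobj g h r mu p (x k w) - m)%:E <= Delta%:E)%E ->
  (\int[P]_w (N k w)%:E <=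
    (4 * mu * (Delta + (g y - h y + fine (r y) - m')))%:E)%E.
Proof.
move=> mumu' hm' hm ry mx hD.
have h1 := sobj_min_le ry hm; have h2 := sobj_min_le ry hm'.
have hm0 z : m <= sobj g h r mu p z.
  by rewrite -lee_fin -(smoothed_objectiveE g h r_proper p_prox); exact: hm.2.
apply: (@le_trans _ _ (\int[P]_w ((4 * mu)%:E * ((sobj g h r mu p (x k w) - m)%:E
  + (g y - h y + fine (r y) - m')%:E)))%E).
  apply: ge0_le_integral_nonmeas => w; first by rewrite lee_fin dotr_ge0.
  rewrite -EFinD -EFinM lee_fin.
  have hr := residual_minorant r_proper mu0 p_prox (x k w) mumu' hm'.
  apply: (le_trans hr).
  by rewrite ler_wpM2l ?mulr_ge0 ?(ltW mu0) //; lra.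
have mS : measurable_fun setT (fun w => (sobj g h r mu p (x k w) - m)%:E).
  by apply/measurable_EFinP; apply: measurable_funB => //; exact: measurable_cst.
rewrite ge0_integralZl //; last 3 first.
- by apply: emeasurable_funD => //; exact: measurable_cst.
- by move=> w _; rewrite -EFinD lee_fin addr_ge0 // subr_ge0.
- by rewrite lee_fin mulr_ge0 // ltW.
rewrite ge0_integralD //; last 2 first.
- by move=> w _; rewrite lee_fin subr_ge0.
- by move=> w _; rewrite lee_fin subr_ge0.
rewrite integral_cst // [X in (_ + _ * X)%E](_ : _ = 1%E); last exact: probability_setT.
rewrite mule1 [leRHS]EFinM [in leRHS]EFinD; apply: lee_wpmul2l; first by rewrite lee_fin mulr_ge0 // ltW.
exact: leeD2r.
Qed.

Lemma integral_residual_coarse (b0 q : R) y (kmax : nat) k : mu <= 1 ->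
  (forall x, b0%:E <= r x)%E -> r y \is a fin_num ->
  (forall w, x 1%N w = x1) -> 0 <= q ->
  (1 <= k <= K)%N -> (K <= kmax)%N ->
  (forall j, (1 <= j <= K)%N ->
     measurable_fun setT (fun w => dotr (x j.+1 w - x j w) (x j.+1 w - x j w))) ->
  (forall j, (1 <= j <= K)%N ->
     \int[P]_w (dotr (x j.+1 w - x j w) (x j.+1 w - x j w))%:E <= q%:E)%E ->
  (\int[P]_w (N k w)%:E <=
   (2 * (fine (r y) - b0) + 2 * dotr (y - x1) (y - x1)
    + 2 * 2 ^+ kmax * (kmax%:R * q))%:E)%E.
Proof.
move=> mu1 rb ry xi q0 /andP[k1 kK] Kmax mQ hQ.
pose Q j w := dotr (x j.+1 w - x j w) (x j.+1 w - x j w).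
pose Q' j w := if (1 <= j <= K)%N then Q j w else 0.
have mQ' j : measurable_fun setT (fun w => (Q' j w)%:E).
  apply/measurable_EFinP; rewrite /Q'; case jK : (1 <= j <= K)%N => //.
  exact: mQ.
have Q'0 j w : (0 <= (Q' j w)%:E)%E.
  by rewrite lee_fin /Q'; case: ifP => // _; exact: dotr_ge0.
set c0 := 2 * (fine (r y) - b0) + 2 * dotr (y - x1) (y - x1).
have c00 : 0 <= c0.
  rewrite addr_ge0 // mulr_ge0 // ?dotr_ge0 // subr_ge0.
  by rewrite -lee_fin fineK.
set c1 := 2 * 2 ^+ kmax : R.
have c10 : 0 <= c1 by rewrite mulr_ge0 // exprn_ge0.
apply: (@le_trans _ _ (\int[P]_w (c0%:E + c1%:E * \sum_(1 <= j < k) (Q' j w)%:E))%E).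
  apply: ge0_le_integral_nonmeas => w; first by rewrite lee_fin dotr_ge0.
  rewrite sumEFin -EFinM -EFinD lee_fin.
  apply: (le_trans (residual_coarse r_proper mu0 p_prox (x k w) x1 mu1 rb ry)).
  rewrite lerD2l /c1 -mulrA ler_wpM2l //.
  apply: (le_trans (displacement_le (x := fun k => x k w) (xi w) k1)).
  have -> : \sum_(1 <= j < k) dotr (x j.+1 w - x j w) (x j.+1 w - x j w) =
     \sum_(1 <= j < k) Q' j w.
    by rewrite big_nat [RHS]big_nat; apply: eq_bigr => j jk; rewrite /Q' ifT //; lia.
  rewrite ler_wpM2r //; first by apply: sumr_ge0 => j _; have := Q'0 j w; rewrite lee_fin.
  by rewrite ler_eXn2l ?ltr1n //; exact: leq_trans Kmax.
have mS : measurable_fun setT (fun w => \sum_(1 <= j < k) (Q' j w)%:E)%E.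
  exact: emeasurable_sum.
have S0 w : (0 <= \sum_(1 <= j < k) (Q' j w)%:E)%E by apply: sume_ge0.
rewrite ge0_integralD //; last 2 first.
- by move=> w _; rewrite mule_ge0.
- by apply: emeasurable_funM => //; exact: measurable_cst.
rewrite integral_cst // [X in (_ * X + _)%E](_ : _ = 1%E); last exact: probability_setT.
rewrite mule1 [leRHS]EFinD; apply: leeD2l.
rewrite ge0_integralZl // [leRHS]EFinM; apply: lee_wpmul2l => //.
rewrite ge0_integral_sum //.
apply: (@le_trans _ _ (\sum_(1 <= j < k) q%:E)%E).
  rewrite big_nat [leRHS]big_nat; apply: lee_sum => j jk.
  have jK : (1 <= j <= K)%N by lia.
  have := hQ j jK; rewrite /Q' jK; exact.
rewrite sumEFin lee_fin sumr_const_nat -[leLHS]mulr_natl ler_wpM2r // ler_nat; lia.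
Qed.

End residual_integral.

(** * SVRG *)

Section svrg_epoch.
Context {R : realType} {d : nat}.
Local Notation V := 'rV[R]_d.
Variables (g : V -> R) (L s : R) (q z : V).
Hypotheses (L0 : 0 < L) (s0 : 0 < s) (g_smooth : smooth L g).
Hypothesis z_crit : qgrad g s q z = 0.

Lemma svrg_step_le (gi : V -> R) (y y' xt : V) : smooth L gi ->
  (20 * L + s) *: y' = (20 * L) *: y + q - (grad gi y - grad gi xt + grad g xt) ->
  (20 * L + s) * enorm (y' - z) <=
    21 * L * enorm (y - z) + 2 * L * enorm (xt - z).
Proof.
move=> [_ gi_lip] y'E.
have a0 : 0 < 20 * L + s by rewrite addr_gt0 // mulr_gt0.
rewrite -[X in X * _]gtr0_norm // -enormZ.
have -> : (20 * L + s) *: (y' - z) = (20 * L) *: (y - z)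
   + (- (grad gi y - grad gi xt) - (grad g xt - grad g z)).
  rewrite scalerBr y'E; have : grad g z = q - s *: z.
    by apply/eqP; rewrite -subr_eq0 opprB addrA; apply/eqP; exact: z_crit.
  by move=> ->; apply/rowP => i; rewrite !mxE; ring.
apply: (le_trans (enormD _ _)).
rewrite enormZ gtr0_norm; last by rewrite mulr_gt0.
have h1 : enorm (- (grad gi y - grad gi xt) - (grad g xt - grad g z)) <=
    enorm (grad gi y - grad gi xt) + enorm (grad g xt - grad g z).
  apply: (le_trans (enormD _ _)).
  by rewrite (enormN (grad gi y - grad gi xt)) (enormN (grad g xt - grad g z)).
have h2 := gi_lip y xt; have h3 := g_smooth.2 xt z.
have h4 : enorm (y - xt) <= enorm (y - z) + enorm (xt - z).
  rewrite (enormB xt z); apply: le_trans (enormD _ _).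
  by rewrite addrA subrK.
have h5 := ler_wpM2l (ltW L0) h4.
move: h1 h2 h3 h4 h5.
move: (enorm (- (grad gi y - grad gi xt) - (grad g xt - grad g z)))
  (enorm (grad gi y - grad gi xt)) (enorm (grad g xt - grad g z))
  (enorm (y - xt)) (enorm (y - z)) (enorm (xt - z)) => *; lra.
Qed.

Variables (T : nat) (xt : V) (y : nat -> V) (delta : R).
Hypotheses (T0 : (0 < T)%N) (y_init : y 0%N = xt).
Hypothesis y_step : forall t, (1 <= t <= T)%N -> exists2 gi, smooth L gi &
  (20 * L + s) *: y t = (20 * L) *: y t.-1 + q
    - (grad gi (y t.-1) - grad gi xt + grad g xt).
Hypothesis delta_ge : 23 * L <= delta * (20 * L + s).

Let a0 : 0 < 20 * L + s. Proof. by rewrite addr_gt0 // mulr_gt0. Qed.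

Let iterate_le t (B : R) : (1 <= t <= T)%N ->
  enorm (y t.-1 - z) <= B -> enorm (xt - z) <= B ->
  enorm (y t - z) <= delta * B.
Proof.
move=> tT yt xB; have [gi gis yE] := y_step tT.
have h := svrg_step_le gis yE.
have B0 : 0 <= B by apply: le_trans xB; exact: enorm_ge0.
rewrite -(ler_pM2l a0); apply: (le_trans h).
have h1 := ler_wpM2r B0 delta_ge.
have h2 := ler_wpM2l (ltW L0) yt.
have h3 := ler_wpM2l (ltW L0) xB.
lra.
Qed.

Let average_le (b : R) :
  (forall t, (1 <= t <= T)%N -> enorm (y t - z) <= b) ->
  enorm (T%:R^-1 *: (\sum_(1 <= t < T.+1) y t) - z) <= b.
Proof.
move=> yb.
have TR : T%:R != 0 :> R by rewrite pnatr_eq0 -lt0n.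
have -> : T%:R^-1 *: (\sum_(1 <= t < T.+1) y t) - z =
    T%:R^-1 *: \sum_(1 <= t < T.+1) (y t - z).
  rewrite sumrB scalerBr sumr_const_nat subSS subn0; congr (_ - _).
  by rewrite -[z *+ T]scaler_nat scalerA mulVf // scale1r.
rewrite enormZ ger0_norm ?invr_ge0 // ler_pdivrMl ?ltr0n //.
have : enorm (\sum_(1 <= t < T.+1) (y t - z)) <= \sum_(1 <= t < T.+1) b.
  rewrite big_nat [leRHS]big_nat.
  elim/big_ind2 : _ => [|u a v c ua vc|t tT]; first by rewrite enorm0.
    by apply: (le_trans (enormD _ _)); exact: lerD.
  exact: yb.
by rewrite sumr_const_nat subSS subn0 mulr_natl.
Qed.

Local Notation xbar := (T%:R^-1 *: (\sum_(1 <= t < T.+1) y t)).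

Lemma svrg_epoch_contract : delta <= 1 -> enorm (xbar - z) <= delta * enorm (xt - z).
Proof.
move=> d1; apply: average_le.
have n0 := enorm_ge0 (xt - z).
have all_le t : (t <= T)%N -> enorm (y t - z) <= enorm (xt - z).
  elim: t => [_|t IH tT]; first by rewrite y_init.
  apply: (@le_trans _ _ (delta * enorm (xt - z))); last by rewrite ler_piMl.
  by apply: iterate_le => //; exact/IH/ltnW.
move=> t /andP[t1 tT]; apply: iterate_le => //; first by rewrite t1.
by apply: all_le; rewrite (leq_trans (leq_pred t)).
Qed.

Lemma svrg_epoch_growth (rho : R) : 1 <= rho -> delta <= rho ->
  enorm (xbar - z) <= rho ^+ T * enorm (xt - z).
Proof.
move=> r1 dr; apply: average_le.
have n0 := enorm_ge0 (xt - z).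
have all_le t : (t <= T)%N -> enorm (y t - z) <= rho ^+ t * enorm (xt - z).
  elim: t => [_|t IH tT]; first by rewrite y_init expr0 mul1r.
  have B0 : 0 <= rho ^+ t * enorm (xt - z).
    by rewrite mulr_ge0 // exprn_ge0 // (le_trans _ r1).
  apply: (@le_trans _ _ (delta * (rho ^+ t * enorm (xt - z)))).
    apply: iterate_le => //; first exact/IH/ltnW.
    by rewrite ler_peMl // exprn_ege1.
  by rewrite exprS -mulrA ler_wpM2r.
move=> t /andP[t1 tT]; apply: (le_trans (all_le t tT)).
by rewrite ler_wpM2r // ler_weXn2l.
Qed.

End svrg_epoch.

Section finitely_generated.
Context {R : realType} dO (O : measurableType dO).
Variable G : set (set O).

(* [f] takes finitely many values, each on an event of the sigma-algebra
   generated by [G]; such maps compose with arbitrary functions. *)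
Definition simple_wrt {W : Type} (f : O -> W) : Prop :=
  exists A : finType, exists H : O -> A, exists phi : A -> W,
    (forall a, <<s G >> (H @^-1` [set a])) /\ f = phi \o H.

Lemma simple_cst W (c : W) : simple_wrt (fun=> c).
Proof.
exists unit, (fun=> tt), (fun=> c); split => // -[].
rewrite (_ : _ @^-1` _ = [set: O]); last by apply/seteqP.
exact: (@measurableT _ (g_sigma_algebraType G)).
Qed.

Lemma simple_comp W W' (F : W -> W') f : simple_wrt f -> simple_wrt (F \o f).
Proof. by move=> [A [H [phi [mH ->]]]]; exists A, H, (F \o phi). Qed.

Lemma simple_comp2 W1 W2 W' (F : W1 -> W2 -> W') f1 f2 :
  simple_wrt f1 -> simple_wrt f2 -> simple_wrt (fun w => F (f1 w) (f2 w)).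
Proof.
move=> [A1 [H1 [phi1 [m1 ->]]]] [A2 [H2 [phi2 [m2 ->]]]].
exists (A1 * A2)%type, (fun w => (H1 w, H2 w)), (fun a => F (phi1 a.1) (phi2 a.2)).
split => // -[a1 a2].
rewrite (_ : _ @^-1` _ = (H1 @^-1` [set a1]) `&` (H2 @^-1` [set a2])).
  by apply: (@measurableI _ (g_sigma_algebraType G)); [exact: m1|exact: m2].
by apply/seteqP; split => w /= [-> ->].
Qed.

Lemma simple_sum (V : nmodType) (f : nat -> O -> V) m n :
  (forall t, (m <= t < n)%N -> simple_wrt (f t)) ->
  simple_wrt (fun w => \sum_(m <= t < n) f t w).
Proof.
have [mn|nm _] := leqP m n; last first.
  rewrite (_ : (fun w => _) = (fun=> 0)); first exact: simple_cst.
  by apply/funext => w; rewrite big_geq // ltnW.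
elim: n mn => [|n IH]; rewrite ?leqn0.
  move=> /eqP -> _; rewrite (_ : (fun w => _) = (fun=> 0)); first exact: simple_cst.
  by apply/funext => w; rewrite big_geq.
rewrite leq_eqVlt => /predU1P[-> _|mn hf].
  rewrite (_ : (fun w => _) = (fun=> 0)); first exact: simple_cst.
  by apply/funext => w; rewrite big_geq.
rewrite (_ : (fun w => _) = (fun w => \sum_(m <= t < n) f t w + f n w)); last first.
  by apply/funext => w; rewrite big_nat_recr.
apply: (@simple_comp2 _ _ _ +%R).
  by apply: IH => // t /andP[mt tn]; apply: hf; rewrite mt ltnW.
by apply: hf; rewrite leqnn -ltnS mn.
Qed.

Lemma simple_measurable dW (W : measurableType dW) (f : O -> W) : simple_wrt f ->
  measurable_fun [set: g_sigma_algebraType G] (f : g_sigma_algebraType G -> W).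
Proof.
move=> [A [H [phi [mH ->]]]] _ B mB; rewrite setTI.
rewrite (_ : _ @^-1` B = \bigcup_(a in [set a | B (phi a)]) (H @^-1` [set a])).
  by apply: (@fin_bigcup_measurable _ (g_sigma_algebraType G)) => // a _; exact: mH.
apply/seteqP; split => w /=; first by move=> Bw; exists (H w).
by move=> [a /= Ba ->].
Qed.

End finitely_generated.

Lemma prox_linear_step (R : realType) d (v y x y' : 'rV[R]_d) (a mu gam : R) :
  0 < a -> 0 < mu -> 0 <= gam ->
  (forall u, dotr v y' + (2 * mu)^-1 * dotr y' y'
      + gam / 2 * dotr (y' - x) (y' - x) + a / 2 * dotr (y' - y) (y' - y) <=
    dotr v u + (2 * mu)^-1 * dotr u u
      + gam / 2 * dotr (u - x) (u - x) + a / 2 * dotr (u - y) (u - y)) ->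
  (a + stage_modulus mu gam) *: y' = a *: y + gam *: x - v.
Proof.
move=> a0 mu0 gam0 ymin.
have A0 : 0 < a + stage_modulus mu gam by rewrite addr_gt0 ?stage_modulus_gt0.
rewrite (@min_quadratic _ _ (v - a *: y - gam *: x) _ _ A0); last first.
  move=> u; have := ymin u; rewrite /stage_modulus.
  have -> : (2 * mu)^-1 = mu^-1 / 2 by rewrite invfM mulrC.
  rewrite !dotrE !(dotrC _ x) !(dotrC _ y); lra.
by apply/rowP => i; rewrite !mxE; ring.
Qed.

Section svrg.
Context {R : realType} {d : nat}.
Local Notation V := 'rV[R]_d.
Variables (g h : V -> R) (L mu alpha : R) (p : V -> V).
Hypotheses (mu0 : 0 < mu) (mu1 : mu <= 1) (L0 : 0 < L).
Hypotheses (g_convex : convex_lsc g) (g_smooth : smooth L g).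
Variable gam : nat -> R.
Hypothesis gam0 : forall k, 0 <= gam k.
Variables (n : nat) (gs : 'I_n -> V -> R) (T S : nat -> nat) (K : nat) (x1 : V).
Hypothesis gs_smooth : forall i, smooth L (gs i).
Hypothesis T0 : forall k, (1 <= k)%N -> (0 < T k)%N.
Context dO (O : measurableType dO) (P : probability O R).
Variables (I : nat -> nat -> nat -> O -> 'I_n) (tau : {RV P >-> nat})
    (x : nat -> O -> V) (xb : nat -> nat -> O -> V)
    (xi : nat -> nat -> nat -> O -> V).
Hypothesis run : svrg_run g h gs p L mu alpha gam T S K x1 I tau x xb xi.

Local Notation modulus k := (stage_modulus mu (gam k)).
Local Notation slope k y := (stage_slope h mu (gam k) p y).
Local Notation gap := (stage_gap g h mu p gam).

Lemma svrg_iterate k s t w : (1 <= k <= K)%N -> (1 <= s <= S k)%N ->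
  (1 <= t <= T k)%N ->
  (20 * L + modulus k) *: xi k s t w = (20 * L) *: xi k s t.-1 w
    + slope k (x k w)
    - (grad (gs (I k s t w)) (xi k s t.-1 w)
       - grad (gs (I k s t w)) (xb k s.-1 w) + grad g (xb k s.-1 w)).
Proof.
move=> kK sS tT; have := svrg_step run w kK sS tT; rewrite /minimizes /=.
set v := (_ - _ + _) => hmin.
rewrite (@prox_linear_step _ _ v (xi k s t.-1 w) (x k w) _ (20 * L) mu (gam k)) //.
- by rewrite /v /stage_slope; apply/rowP => i; rewrite !mxE; ring.
- by rewrite mulr_gt0.
- move=> u; have := hmin u; rewrite !sqr_enorm.
  have -> : (2 * (5 / 100 / L))^-1 = 20 * L / 2 by field; rewrite gt_eqF.
  rewrite !(dotrDr _ _ v) !(dotrNr _ v); lra.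
Qed.

Let z k w := stage_min g h mu p gam k (x k w).

Let z_crit k w : qgrad g (modulus k) (slope k (x k w)) (z k w) = 0.
Proof. exact: (qgrad_qmin _ L0 (stage_modulus_gt0 mu0 (gam0 k)) g_convex g_smooth). Qed.

Let rho : R := 23 / 20.

Lemma svrg_snapshot_growth k s w : (1 <= k <= K)%N -> (s <= S k)%N ->
  enorm (xb k s w - z k w) <= rho ^+ (T k * s) * enorm (x k w - z k w).
Proof.
move=> kK; elim: s => [_|s IH sS].
  by rewrite (svrg_stage_init run _ kK) muln0 expr0 mul1r.
have kK' := kK; case/andP: kK' => k1 _.
rewrite (svrg_snapshot run) ?sS //.
apply: (le_trans (@svrg_epoch_growth _ _ g L (modulus k) (slope k (x k w)) _ L0
  (stage_modulus_gt0 mu0 (gam0 k)) g_smooth (z_crit k w) (T k) (xb k s w)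
  (fun t => xi k s.+1 t w) rho (T0 k1) _ _ _ rho _ _)) => //.
- by rewrite (svrg_epoch_init run) ?sS.
- move=> t tT; exists (gs (I k s.+1 t w)); first exact: gs_smooth.
  by apply: svrg_iterate; rewrite ?sS.
- have := stage_modulus_gt0 mu0 (gam0 k); rewrite /rho; lra.
- by rewrite /rho; lra.
rewrite mulnS exprD -mulrA ler_wpM2l //; last exact/IH/ltnW.
by rewrite exprn_ge0 // /rho; lra.
Qed.

Lemma svrg_snapshot_contract k s w : 100 * L <= modulus k ->
  (1 <= k <= K)%N -> (1 <= s <= S k)%N ->
  enorm (xb k s w - z k w) <= 5^-1 * enorm (x k w - z k w).
Proof.
move=> Lk kK; elim: s => // s IH sS.
have kK' := kK; case/andP: kK' => k1 _.
rewrite (svrg_snapshot run) ?sS //.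
apply: (le_trans (@svrg_epoch_contract _ _ g L (modulus k) (slope k (x k w)) _ L0
  (stage_modulus_gt0 mu0 (gam0 k)) g_smooth (z_crit k w) (T k) (xb k s w)
  (fun t => xi k s.+1 t w) (5^-1) (T0 k1) _ _ _ _)) => //.
- by rewrite (svrg_epoch_init run) ?sS.
- move=> t tT; exists (gs (I k s.+1 t w)); first exact: gs_smooth.
  by apply: svrg_iterate; rewrite ?sS.
- by rewrite ler_pdivlMl //; move: Lk L0; move: (modulus k) => m ? ?; lra.
- lra.
rewrite ler_wpM2l //; case: s IH sS => [|s] IH sS.
  by rewrite (svrg_stage_init run _ kK).
apply: (le_trans (IH _)); first by case/andP: sS => _ /ltnW ->.
by rewrite ler_piMl ?enorm_ge0 //; lra.
Qed.

Let gapE k y w : gap k (x k w) y <=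
  (L + modulus k / 2) * enorm (y - z k w) ^+ 2.
Proof.
rewrite sqr_enorm.
exact: (qobj_qmin_upper _ L0 (stage_modulus_gt0 mu0 (gam0 k)) g_convex g_smooth).
Qed.

Let gap_lower k w :
  modulus k / 2 * enorm (x k w - z k w) ^+ 2 <= gap k (x k w) (x k w).
Proof.
rewrite sqr_enorm.
exact: (qobj_qmin_lower _ L0 (stage_modulus_gt0 mu0 (gam0 k)) g_convex g_smooth).
Qed.

Let modulus_ge1 k : 1 <= modulus k.
Proof. by rewrite /stage_modulus -[leLHS]addr0 lerD // invf_ge1. Qed.

Lemma gap_ratio k y w (c : R) : (1 <= k <= K)%N -> 0 <= c ->
  enorm (y - z k w) <= c * enorm (x k w - z k w) ->
  gap k (x k w) y <= (2 * L / modulus k + 1) * c ^+ 2 * gap k (x k w) (x k w).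
Proof.
move=> kK c0 hy; apply: (le_trans (gapE _ _ _)).
have s0 := stage_modulus_gt0 mu0 (gam0 k).
have h1 : enorm (y - z k w) ^+ 2 <= c ^+ 2 * enorm (x k w - z k w) ^+ 2.
  by rewrite -exprMn lerXn2r // nnegrE ?enorm_ge0 // mulr_ge0 ?enorm_ge0.
have h2 := gap_lower k w.
have C0 : 0 <= (2 * L / modulus k + 1) * c ^+ 2.
  by rewrite mulr_ge0 ?sqr_ge0 // addr_ge0 // divr_ge0 ?mulr_ge0 // ltW.
have h3 := ler_wpM2l C0 h2; apply: le_trans h3.
have -> : (2 * L / modulus k + 1) * c ^+ 2 * (modulus k / 2 * enorm (x k w - z k w) ^+ 2)
  = (L + modulus k / 2) * (c ^+ 2 * enorm (x k w - z k w) ^+ 2).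
  by field; rewrite gt_eqF.
by rewrite ler_wpM2l // addr_ge0 ?divr_ge0 // ltW.
Qed.

Let gap_ge0 k y u : 0 <= gap k y u.
Proof. exact: (stage_gap_ge0 h p mu0 g_convex g_smooth gam0). Qed.

Definition svrg_growth k : R := (2 * L + 1) * (rho ^+ (T k * S k)) ^+ 2.

Lemma svrg_gap_growth k w : (1 <= k <= K)%N ->
  gap k (x k w) (x k.+1 w) <= svrg_growth k * gap k (x k w) (x k w).
Proof.
move=> kK; rewrite (svrg_output run _ kK).
have r0 : 0 <= rho by rewrite /rho; lra.
apply: (le_trans (gap_ratio kK (exprn_ge0 _ r0) (svrg_snapshot_growth w kK (leqnn _)))).
apply: ler_wpM2r; first exact: gap_ge0.
apply: ler_wpM2r; first exact: sqr_ge0.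
rewrite lerD2r.
by rewrite ler_pdivrMr ?stage_modulus_gt0 // ler_peMr ?modulus_ge1 // mulr_ge0 // ltW.
Qed.

Lemma svrg_gap_half k w : (1 <= k <= K)%N -> (0 < S k)%N -> 100 * L <= modulus k ->
  gap k (x k w) (x k.+1 w) <= 2^-1 * gap k (x k w) (x k w).
Proof.
move=> kK S0 Lk; rewrite (svrg_output run _ kK).
have s0 := stage_modulus_gt0 mu0 (gam0 k).
have sS : (1 <= S k <= S k)%N by rewrite S0 leqnn.
apply: (le_trans (gap_ratio kK _ (svrg_snapshot_contract w Lk kK sS))) => //.
apply: ler_wpM2r; first exact: gap_ge0.
have : 2 * L / modulus k <= 50^-1 by rewrite ler_pdivrMr //; lra.
lra.
Qed.

Lemma svrg_no_epoch k w : (1 <= k <= K)%N -> S k = 0%N -> x k.+1 w = x k w.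
Proof.
by move=> kK S0; rewrite (svrg_output run _ kK) S0 (svrg_stage_init run _ kK).
Qed.

End svrg.

(** * From a controlled run to near criticality *)

Section control.
Context {R : realType} {d : nat}.
Local Notation V := 'rV[R]_d.
Variables (g h : V -> R) (r : V -> \bar R) (L nu alpha : R).

(* What is used of a run: measurability of the stage quantities for a
   sigma-algebra independent of [tau], the standing assumption, and the fact
   that each subproblem halves the optimality gap up to an error [c / k]. *)
Record stage_control (mu : R) (p : V -> V) (gam : nat -> R)
    dO (O : measurableType dO) (P : probability O R) (K : nat)
    (tau : {RV P >-> nat}) (x : nat -> O -> V) (m Delta c : R)
    (G : set (set O)) : Prop := {
  sc_sampled : sampled_index alpha K tau ;
  sc_sub : G `<=` (measurable : set (set O)) ;
  sc_indep : forall (C : set nat) B, <<s G >> B ->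
    P (B `&` tau @^-1` C) = (P B * P (tau @^-1` C))%E ;
  sc_sobj : forall k, (1 <= k <= K.+1)%N ->
    measurable_fun [set: g_sigma_algebraType G]
      ((fun w => sobj g h r mu p (x k w)) : g_sigma_algebraType G -> R) ;
  sc_gap : forall k, (1 <= k <= K)%N ->
    measurable_fun [set: g_sigma_algebraType G]
      ((fun w => stage_gap g h mu p gam k (x k w) (x k w))
        : g_sigma_algebraType G -> R) ;
  sc_gap_next : forall k, (1 <= k <= K)%N ->
    measurable_fun [set: g_sigma_algebraType G]
      ((fun w => stage_gap g h mu p gam k (x k w) (x k.+1 w))
        : g_sigma_algebraType G -> R) ;
  sc_step : forall k, (1 <= k <= K)%N ->
    measurable_fun [set: g_sigma_algebraType G]
      ((fun w => dotr (x k.+1 w - x k w) (x k.+1 w - x k w))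
        : g_sigma_algebraType G -> R) ;
  sc_res : forall k, (1 <= k <= K)%N ->
    measurable_fun [set: g_sigma_algebraType G]
      ((fun w => dotr (x k w - p (x k w)) (x k w - p (x k w)))
        : g_sigma_algebraType G -> R) ;
  sc_Esobj : forall k, (1 <= k <= K)%N ->
    (\int[P]_w (sobj g h r mu p (x k w) - m)%:E <= Delta%:E)%E ;
  sc_Egap : forall k, (1 <= k <= K)%N ->
    (\int[P]_w (stage_gap g h mu p gam k (x k w) (x k.+1 w))%:E <=
     2^-1%:E * \int[P]_w (stage_gap g h mu p gam k (x k w) (x k w))%:E
     + (c / k%:R)%:E)%E
}.

Hypotheses (L0 : 0 < L) (nu0 : 0 < nu) (nu1 : nu <= 1) (alpha1 : 1 <= alpha).
Hypotheses (g_convex : convex_lsc g) (h_convex : convex_lsc h).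
Hypotheses (g_smooth : smooth L g) (h_holder : holder_grad L nu h).
Hypotheses (r_proper : proper r).
Variables (C q b cg : R) (a : nat).
Hypotheses (C0 : 0 < C) (q0 : 0 <= q) (b0 : 0 <= b) (cg0 : 0 < cg).
Hypotheses (qba : q * b <= a%:R) (qnu : 2 * nu + a%:R <= q).
Hypothesis a0 : (0 < a)%N.

Local Notation gam := (fun k : nat => cg * k%:R `^ b).
Local Notation K eps := (natceil (C * (1 / eps) `^ q)).

Definition rate_const (A Delta c : R) : R :=
  (1 + A) + 2 * L * (1 + A) + 1 +
  smoothness_const C L b cg * (2 `^ (alpha + 2) * (Delta + c)) / C.

Let gam0 k : 0 <= gam k. Proof. by rewrite mulr_ge0 ?powR_ge0 // ltW. Qed.

Lemma control_nearly_critical (eps A Delta c m B : R) (p : V -> V)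
    dO (O : measurableType dO) (P : probability O R) (tau : {RV P >-> nat})
    (x : nat -> O -> V) (G : set (set O)) :
  0 < eps < 1 -> 0 <= A -> 0 <= Delta -> 0 <= c ->
  (forall x, is_prox (eps ^+ a) r x (p x)) ->
  (forall y, m <= sobj g h r (eps ^+ a) p y) ->
  stage_control (eps ^+ a) p gam (K eps) tau x m Delta c G ->
  (forall k, (1 <= k <= K eps)%N ->
     \int[P]_w (dotr (x k w - p (x k w)) (x k w - p (x k w)))%:E
     <= (A * eps ^+ 2)%:E)%E ->
  rate_const A Delta c <= B ->
  nearly_critical g h r p nu B eps P (fun w => x (tau w) w).
Proof.
move=> eps01 A0 D0 c0 p_prox m_le sc hN hB.
have e0 : 0 < eps by case/andP: eps01.
have mu0 : 0 < eps ^+ a by rewrite exprn_gt0.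
pose X := 2 `^ (alpha + 2) * (Delta + c).
have X0 : 0 <= X by rewrite mulr_ge0 ?powR_ge0 ?addr_ge0.
pose M := smoothness_const C L b cg * (1 / eps) `^ a%:R.
have M0 : 0 <= M by rewrite mulr_ge0 ?powR_ge0 // ltW // smoothness_const_gt0 //.
apply: (stagewise_nearly_critical r_proper mu0 L0 nu0 nu1 alpha1 g_convex h_convex
  g_smooth h_holder p_prox gam0 (sc_sampled sc) (sc_sub sc) (sc_indep sc)
  (stages_gt0 q C0 eps01) c0 m_le (sc_sobj sc) (sc_gap sc) (sc_gap_next sc) (sc_step sc)
  (sc_res sc) (sc_Esobj sc) (sc_Egap sc) eps01 A0 hN M0 _ _ hB).
- move=> k /andP[_ kK]; exact: (stage_smoothness_le C0 q0 eps01 L0 b0 cg0 qba kK).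
- exact: (gap_rate_le C0 eps01 b L0 cg0 X0 qnu).
Qed.

Definition control_suffices (x1 : V) : Prop :=
  forall Delta c : R, 0 <= Delta -> 0 <= c ->
  exists B : R, forall (eps m : R) (p : V -> V)
    dO (O : measurableType dO) (P : probability O R) (tau : {RV P >-> nat})
    (x : nat -> O -> V) (G : set (set O)),
  0 < eps < 1 ->
  (forall x, is_prox (eps ^+ a) r x (p x)) ->
  attains_min (smoothed_objective g h r (eps ^+ a)) m ->
  (forall w, x 1%N w = x1) ->
  stage_control (eps ^+ a) p gam (K eps) tau x m Delta c G ->
  nearly_critical g h r p nu B eps P (fun w => x (tau w) w).

Lemma lipschitz_control_suffices (x1 : V) : lipschitz_reg r -> control_suffices x1.
Proof.
move=> [rf [l rl]] Delta c D0 c0; exists (rate_const (4 * l ^+ 2) Delta c).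
move=> eps m p dO O P tau x G eps01 p_prox hm _ sc.
have [e0 e1] := andP eps01.
have mu0 : 0 < eps ^+ a by rewrite exprn_gt0.
have A0 : 0 <= 4 * l ^+ 2 by rewrite mulr_ge0 ?sqr_ge0.
apply: (control_nearly_critical eps01 A0 D0 c0 p_prox _ sc _ (lexx _)).
  move=> y; rewrite -lee_fin -(smoothed_objectiveE g h r_proper p_prox); exact: hm.2.
move=> k kK; apply: (@le_trans _ _ (\int[P]_w (4 * l ^+ 2 * eps ^+ 2)%:E)%E).
  apply: ge0_le_integral_nonmeas => w; first by rewrite lee_fin dotr_ge0.
  rewrite lee_fin; have hr := @residual_lipschitz _ _ _ _ _ r_proper mu0 p_prox l (x k w) rf rl.
  apply: (le_trans hr).
  rewrite ler_wpM2l // lerXn2r ?nnegrE ?exprn_ge0 ?(ltW e0) //.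
  by rewrite -[leRHS]expr1 ler_wiXn2l // ltW.
by rewrite integral_cst // [X in (_ * X)%E](_ : _ = 1%E) ?mule1 //; exact: probability_setT.
Qed.

Lemma lower_bounded_control_suffices (x1 : V) : a = 2%N -> lower_bounded r ->
  control_suffices x1.
Proof.
move=> a2 [rb hrb] Delta c D0 c0; have [_ [y ry]] := r_proper.
have [[eps0 [m0 [/andP[e00 e01] hm0]]]|noattain] := pselect (exists eps0 m0 : R,
  0 < eps0 < 1 /\ attains_min (smoothed_objective g h r (eps0 ^+ a)) m0); last first.
  exists 0 => eps m p dO O P tau x G eps01 p_prox hm; exfalso; apply: noattain.
  by exists eps, m.
pose U := g y - h y + fine (r y).
have U0 : 0 <= U - m0.
  by rewrite subr_ge0 (sobj_min_le ry hm0).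
pose eps1 := eps0 / 2; have eps10 : 0 < eps1 by rewrite divr_gt0.
pose kmax := natceil (C * (1 / eps1) `^ q).
pose Qmax := 2 / cg * (Delta + c).
pose A1 := 4 * (Delta + (U - m0)).
pose N1 := 2 * (fine (r y) - rb) + 2 * dotr (y - x1) (y - x1)
            + 2 * 2 ^+ kmax * (kmax%:R * Qmax).
pose A2 := N1 / eps1 ^+ 2.
have Q0 : 0 <= Qmax by rewrite mulr_ge0 ?divr_ge0 ?addr_ge0 // ltW.
have A10 : 0 <= A1 by rewrite mulr_ge0 // addr_ge0.
have N10 : 0 <= N1.
  have h1 : 0 <= fine (r y) - rb by rewrite subr_ge0 -lee_fin fineK.
  have h2 : 0 <= 2 * 2 ^+ kmax * (kmax%:R * Qmax).
    by apply: mulr_ge0; apply: mulr_ge0; rewrite ?exprn_ge0.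
  by apply: addr_ge0 h2; apply: addr_ge0; apply: mulr_ge0 => //; exact: dotr_ge0.
have A20 : 0 <= A2 by rewrite divr_ge0 ?sqr_ge0.
exists (rate_const (A1 + A2) Delta c).
move=> eps m p dO O P tau x G eps01 p_prox hm xinit sc.
have [e0 e1] := andP eps01.
have mu0 : 0 < eps ^+ a by rewrite exprn_gt0.
have m_le z : m <= sobj g h r (eps ^+ a) p z.
  by rewrite -lee_fin -(smoothed_objectiveE g h r_proper p_prox); exact: hm.2.
apply: (control_nearly_critical eps01 (addr_ge0 A10 A20) D0 c0 p_prox m_le sc _ (lexx _)).
move=> k kK; have [small|large] := leP eps eps1.
  have kK1 : (1 <= k <= (K eps).+1)%N by case/andP: kK => -> /leqW.
  apply: (le_trans (integral_residual_minorant r_proper mu0 p_prox _ hm0 hm ry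
    (sub_measurable_fun (sc_sub sc) (sc_sobj sc kK1)) (sc_Esobj sc kK))).
    rewrite a2; apply: (@le_trans _ _ (2 * eps1 ^+ 2)).
      by rewrite ler_wpM2l // lerXn2r // nnegrE ltW.
    by rewrite /eps1; have := sqr_ge0 eps0; lra.
  rewrite lee_fin -/U a2 /A1.
  rewrite [leLHS](_ : _ = 4 * (Delta + (U - m0)) * eps ^+ 2); last by ring.
  by rewrite [leRHS]mulrDl lerDl mulr_ge0 // sqr_ge0.
have Kk : (K eps <= kmax)%N.
  rewrite /kmax /natceil -lez_nat.
  have c1 (s : R) : 0 < s -> (0 <= Num.ceil (C * (1 / s) `^ q)).
    move=> s0; rewrite ceil_ge0 (@lt_le_trans _ _ 0) ?ltrN10 //.
    by rewrite mulr_ge0 ?powR_ge0 // ltW.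
  rewrite !gez0_abs ?c1 // le_ceil // ler_wpM2l ?(ltW C0) // ge0_ler_powR ?nnegrE //.
  - by rewrite divr_ge0 // ltW.
  - by rewrite divr_ge0 // ltW.
  - by rewrite !div1r lef_pV2 ?posrE // ltW.
apply: (le_trans (integral_residual_coarse r_proper mu0 p_prox _ hrb ry xinit Q0 kK Kk _ _)).
- by rewrite exprn_ile1 // ltW.
- by move=> j jK; exact: (sub_measurable_fun (sc_sub sc) (sc_step sc jK)).
- move=> j jK.
  have := expected_step_le r_proper mu0 L0 nu0 nu1 alpha1 g_convex h_convex g_smooth h_holder p_prox gam0
   (sc_sub sc) (stages_gt0 q C0 eps01) c0 m_le (sc_sobj sc) (sc_gap sc) (sc_gap_next sc)
   (sc_step sc) (sc_Esobj sc) (sc_Egap sc) jK.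
  set J := (\int[P]_w _)%E => hJ.
  have g0 : 0 < gam j / 2 by rewrite divr_gt0 // mulr_gt0 // powR_gt0 // ltr0n; case/andP: jK.
  have j1 : 1 <= j%:R `^ b by case/andP: jK => j1 _; apply: (le_trans _ (ler_powR_nat b0 j1)); rewrite powR1.
  rewrite -(@lee_pmul2l _ (gam j / 2)%:E) ?lte_fin //; apply: (le_trans hJ).
  rewrite -EFinM lee_fin /Qmax mulrA; apply: ler_peMl; first exact: addr_ge0.
  rewrite [leRHS](_ : _ = j%:R `^ b) //; field; rewrite gt_eqF //.
- rewrite lee_fin; apply: (@le_trans _ _ (A2 * eps ^+ 2)); last first.
    by rewrite [leRHS]mulrDl lerDr mulr_ge0 // sqr_ge0.
  rewrite -/N1 /A2 mulrAC ler_pdivlMr ?exprn_gt0 // ler_wpM2l //.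
  by rewrite lerXn2r ?nnegrE // ltW.
Qed.

End control.

(** * Control of SVRG runs *)

Lemma stage_rangeW k K : (1 <= k <= K)%N -> (1 <= k <= K.+1)%N.
Proof. lia. Qed.

Lemma stage_rangeS k K : (1 <= k <= K)%N -> (1 <= k.+1 <= K.+1)%N.
Proof. lia. Qed.

Lemma stage_rangeP k K : (1 <= k.+2 <= K)%N -> (1 <= k.+1 <= K)%N.
Proof. lia. Qed.

Section svrg_constants.
Context {R : realType}.
Variables (L : R) (T S : nat -> nat) (Delta : R) (kmax : nat).
Hypotheses (L0 : 0 < L) (Delta0 : 0 <= Delta).

Definition stage_growth k : R := 1 + svrg_growth L T S k.

Definition svrg_bound : R := \prod_(1 <= j < kmax.+1) stage_growth j * Delta.

Definition svrg_error : R := svrg_bound * kmax.+1%:R.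

Lemma stage_growth_ge1 k : 1 <= stage_growth k.
Proof.
rewrite /stage_growth lerDl /svrg_growth mulr_ge0 ?sqr_ge0 // addr_ge0 // mulr_ge0 // ltW //.
Qed.

Lemma prod_growth_ge1 k : 1 <= \prod_(1 <= j < k.+1) stage_growth j.
Proof.
elim: k => [|k IH]; first by rewrite big_nil.
rewrite big_nat_recr //=; apply: (le_trans IH).
by rewrite ler_peMr ?stage_growth_ge1 // (le_trans _ IH).
Qed.

Lemma prod_growth_le k l : (k <= l)%N ->
  \prod_(1 <= j < k.+1) stage_growth j <= \prod_(1 <= j < l.+1) stage_growth j.
Proof.
elim: l => [|l IH]; first by rewrite leqn0 => /eqP ->.
rewrite leq_eqVlt => /predU1P[->//|kl]; apply: (le_trans (IH kl)).
rewrite [leRHS]big_nat_recr //= ler_peMr ?stage_growth_ge1 // (le_trans _ (prod_growth_ge1 l)) //.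
Qed.

Lemma svrg_bound_ge : Delta <= svrg_bound.
Proof. by rewrite /svrg_bound ler_peMl // prod_growth_ge1. Qed.

Lemma svrg_error_ge0 : 0 <= svrg_error.
Proof. by rewrite mulr_ge0 // (le_trans Delta0 svrg_bound_ge). Qed.

End svrg_constants.

Section svrg_control.
Context {R : realType} {d : nat}.
Local Notation V := 'rV[R]_d.
Variables (g h : V -> R) (r : V -> \bar R) (L nu mu alpha : R) (p : V -> V).
Hypotheses (r_proper : proper r) (mu0 : 0 < mu) (mu1 : mu <= 1) (L0 : 0 < L).
Hypotheses (g_convex : convex_lsc g) (h_convex : convex_lsc h).
Hypotheses (g_smooth : smooth L g) (h_holder : holder_grad L nu h).
Hypothesis (p_prox : forall x, is_prox mu r x (p x)).
Variable gam : nat -> R.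
Hypothesis gam0 : forall k, 0 <= gam k.
Variables (n : nat) (gs : 'I_n -> V -> R) (T S : nat -> nat) (K : nat) (x1 : V).
Hypothesis gs_smooth : forall i, smooth L (gs i).
Hypothesis T0 : forall k, (1 <= k)%N -> (0 < T k)%N.
Hypothesis S0 : forall k, (2 <= k)%N -> (0 < S k)%N.
Context dO (O : measurableType dO) (P : probability O R).
Variables (I : nat -> nat -> nat -> O -> 'I_n) (tau : {RV P >-> nat})
    (x : nat -> O -> V) (xb : nat -> nat -> O -> V)
    (xi : nat -> nat -> nat -> O -> V).
Hypothesis run : svrg_run g h gs p L mu alpha gam T S K x1 I tau x xb xi.
Variables (m Delta : R) (kmax : nat).
Hypothesis m_min : attains_min (smoothed_objective g h r mu) m.
Hypothesis start_le : (smoothed_objective g h r mu x1 - m%:E <= Delta%:E)%E.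
Hypothesis regime : 100 * L <= mu^-1 \/ (K <= kmax)%N.

Local Notation gap := (stage_gap g h mu p gam).
Local Notation F := (sobj g h r mu p).
Local Notation growth := (stage_growth L T S).
Local Notation bound := (svrg_bound L T S Delta kmax).
Local Notation error := (svrg_error L T S Delta kmax).

Let m_le y : m <= F y.
Proof. by rewrite -lee_fin -(smoothed_objectiveE g h r_proper p_prox); exact: m_min.2. Qed.

Let start_le' : F x1 - m <= Delta.
Proof. by move: start_le; rewrite (smoothed_objectiveE g h r_proper p_prox) -EFinB lee_fin. Qed.

Let Delta0 : 0 <= Delta.
Proof. by apply: le_trans start_le'; rewrite subr_ge0. Qed.

Let bound_ge : Delta <= bound.
Proof. exact: svrg_bound_ge. Qed.

Let error_ge0 : 0 <= error.
Proof. exact: svrg_error_ge0. Qed.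

Let gap_ge0 k y u : 0 <= gap k y u.
Proof. exact: (stage_gap_ge0 h p mu0 g_convex g_smooth gam0). Qed.

Let gap_le k w : gap k (x k w) (x k w) <= F (x k w) - m.
Proof. exact: (stage_gap_le r_proper h_convex h_holder p_prox gam0 k (x k w) m_le). Qed.

Let F_next k w : F (x k.+1 w) + gap k (x k w) (x k w) <=
  F (x k w) + gap k (x k w) (x k.+1 w).
Proof.
have := stage_descent g r_proper h_convex h_holder p_prox gam k (x k w) (x k.+1 w).
have : 0 <= gam k / 2 * dotr (x k.+1 w - x k w) (x k.+1 w - x k w).
  by rewrite mulr_ge0 ?dotr_ge0 // divr_ge0.
lra.
Qed.

Let good_gap k w : 100 * L <= mu^-1 -> (1 <= k <= K)%N ->
  gap k (x k w) (x k.+1 w) <= gap k (x k w) (x k w) /\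
  ((2 <= k)%N -> gap k (x k w) (x k.+1 w) <= 2^-1 * gap k (x k w) (x k w)).
Proof.
move=> Lmu kK.
have half : (0 < S k)%N -> gap k (x k w) (x k.+1 w) <= 2^-1 * gap k (x k w) (x k w).
  move=> Sk; apply: (svrg_gap_half mu0 L0 g_convex g_smooth gam0 gs_smooth T0 run) => //.
  by rewrite /stage_modulus -[leLHS]addr0 lerD.
split; last by move=> k2; exact/half/S0.
have [Sk|Sk] := eqVneq (S k) 0%N; first by rewrite (svrg_no_epoch run).
rewrite -lt0n in Sk; apply: (le_trans (half Sk)).
by rewrite ler_piMl //; lra.
Qed.

Let F_good k w : 100 * L <= mu^-1 -> (1 <= k <= K)%N -> F (x k w) - m <= Delta.
Proof.
move=> Lmu; elim: k => // -[_ _|k IH kK]; first by rewrite (svrg_init run).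
have kK' := stage_rangeP kK.
have := IH kK'; have := F_next k.+1 w.
have := (good_gap w Lmu kK').1; lra.
Qed.

Let gap_growth k w : (1 <= k <= K)%N ->
  gap k (x k w) (x k.+1 w) <= svrg_growth L T S k * (F (x k w) - m).
Proof.
move=> kK.
apply: (le_trans (svrg_gap_growth mu0 mu1 L0 g_convex g_smooth gam0 gs_smooth T0 run w kK)).
apply: ler_wpM2l => //; have := stage_growth_ge1 T S L0 k; rewrite /stage_growth; lra.
Qed.

Let F_growth k w : (1 <= k <= K.+1)%N ->
  F (x k w) - m <= \prod_(1 <= j < k) growth j * Delta.
Proof.
elim: k => // -[_ _|k IH kK]; first by rewrite (svrg_init run) big_nil mul1r.
have kK' : (1 <= k.+1 <= K)%N by case/andP: kK.
have kK1 := stage_rangeP kK.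
rewrite big_nat_recr //=.
have h1 := IH kK1; have h2 := F_next k.+1 w; have h3 := gap_growth w kK'.
have h4 := gap_ge0 k.+1 (x k.+1 w) (x k.+1 w).
have h5 : F (x k.+2 w) - m <= growth k.+1 * (F (x k.+1 w) - m).
  by rewrite /stage_growth; lra.
apply: (le_trans h5); rewrite mulrC -[leRHS]mulrAC ler_wpM2r //.
by apply: le_trans (stage_growth_ge1 T S L0 k.+1).
Qed.

Lemma svrg_sobj_le k w : (1 <= k <= K)%N -> F (x k w) - m <= bound.
Proof.
move=> kK; case: regime => [Lmu|Kk].
  by apply: le_trans (F_good w Lmu kK) bound_ge.
have kK1 := stage_rangeW kK.
apply: (le_trans (F_growth w kK1)); rewrite /svrg_bound ler_wpM2r //.
have [k1 kK2] := andP kK.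
have := prod_growth_le T S L0 (k := k.-1) (l := kmax); rewrite prednK //; apply.
exact: leq_trans (leq_pred k) (leq_trans kK2 Kk).
Qed.

Lemma svrg_gap_next_le k w : (1 <= k <= K)%N ->
  gap k (x k w) (x k.+1 w) <= 2^-1 * gap k (x k w) (x k w) + error / k%:R.
Proof.
move=> kK; have k0 : 0 < k%:R :> R by rewrite ltr0n; case/andP: kK.
have W0 : 0 <= bound := le_trans Delta0 bound_ge.
have hD := gap_ge0 k (x k w) (x k w).
have err0 : 0 <= error / k%:R by rewrite divr_ge0 ?error_ge0 // ltW.
case: regime => [Lmu|Kk].
  have [k2|] := leqP 2 k; first by have := (good_gap w Lmu kK).2 k2; lra.
  move=> k2; have k1' : k = 1%N by apply/eqP; rewrite eqn_leq; case/andP: kK => ->; rewrite andbT.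
  have h1 := (good_gap w Lmu kK).1; have h2 := gap_le k w.
  have h3 := F_good w Lmu kK.
  have : bound <= error / k%:R.
    by rewrite k1' divr1 /svrg_error ler_peMr // ler1n.
  have := bound_ge; lra.
have h1 := gap_growth w kK.
have kK1 := stage_rangeW kK.
have h2 := F_growth w kK1.
have h3 : gap k (x k w) (x k.+1 w) <= bound.
  apply: (le_trans h1).
  apply: (@le_trans _ _ (growth k * (\prod_(1 <= j < k) growth j * Delta))).
    apply: ler_pM => //; rewrite /stage_growth; have := stage_growth_ge1 T S L0 k;
      rewrite /stage_growth; first lra.
      by rewrite subr_ge0.
    by lra.
  have [k1 kK2] := andP kK.
  rewrite mulrCA mulrA -[_ * growth k](@big_nat_recr _ _ _ k 1) //=.
  apply: ler_wpM2r Delta0 _ _ _.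
  by apply: prod_growth_le => //; exact: leq_trans kK2 Kk.
have : bound <= error / k%:R.
  rewrite ler_pdivlMr // /svrg_error ler_wpM2l // ler_nat.
  by case/andP: kK => _ kK2; exact: leqW (leq_trans kK2 Kk).
lra.
Qed.

Let sources (i : option (nat * nat * nat)) : set (set O) :=
  if i is Some kst then preimage_set_system setT (I kst.1.1 kst.1.2 kst.2) setT
  else sigma_of tau.

Let G : set (set O) := hist sources [set i | isSome i].

Let sources_meas i A : sources i A -> measurable A.
Proof.
rewrite /sources; case: i => [[[k s] t]|] [B mB <-] /=.
  rewrite setTI (_ : _ @^-1` B = \bigcup_(i in B) (I k s t @^-1` [set i])).
    by apply: fin_bigcup_measurable => // i _; exact: (svrg_meas run).
  apply/seteqP; split => w /=; first by move=> Bw; exists (I k s t w).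
  by move=> [i Bi] /= ->.
by rewrite setTI -[X in measurable X]setTI; exact: (measurable_funP tau).
Qed.

Let sources_setT i : sources i setT.
Proof.
by rewrite /sources; case: i => [kst|]; exists setT => //; rewrite setTI preimage_setT.
Qed.

Let sources_setI i : setI_closed (sources i).
Proof.
rewrite /sources; case: i => [kst|] _ _ [A mA <-] [B mB <-]; exists (A `&` B) => //.
- by rewrite preimage_setI !setTI.
- by rewrite preimage_setI !setTI.
Qed.

Let index_simple k s t : simple_wrt G (I k s t).
Proof.
exists 'I_n, (I k s t), id; split => // i.
apply: sub_sigma_algebra; exists (Some (k, s, t)) => //=.
by exists [set i] => //; rewrite setTI.
Qed.

Let inner_simple k s : (1 <= k <= K)%N -> (1 <= s <= S k)%N ->
  simple_wrt G (x k) -> simple_wrt G (xb k s.-1) ->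
  forall t, (t <= T k)%N -> simple_wrt G (xi k s t).
Proof.
move=> kK sS hx hb; elim => [_|t IH tT].
  rewrite (_ : xi k s 0%N = xb k s.-1) //.
  by apply/funext => w; rewrite (svrg_epoch_init run).
have h1 := simple_comp2 pair (simple_comp2 pair hx hb)
  (simple_comp2 pair (IH (ltnW tT)) (index_simple k s t.+1)).
pose s0 := stage_modulus mu (gam k).
have := simple_comp (fun z => (20 * L + s0)^-1 *: ((20 * L) *: z.2.1
    + stage_slope h mu (gam k) p z.1.1
    - (grad (gs z.2.2) z.2.1 - grad (gs z.2.2) z.1.2 + grad g z.1.2))) h1.
congr simple_wrt; apply/funext => w /=.
have A0 : 20 * L + s0 != 0.
  by rewrite gt_eqF // addr_gt0 ?mulr_gt0 // stage_modulus_gt0.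
have tT' : (1 <= t.+1 <= T k)%N by [].
rewrite -(svrg_iterate mu0 L0 gam0 run w kK sS tT').
by rewrite scalerA mulVf // scale1r.
Qed.

Let snapshot_simple k : (1 <= k <= K)%N -> simple_wrt G (x k) ->
  forall s, (s <= S k)%N -> simple_wrt G (xb k s).
Proof.
move=> kK hx; elim => [_|s IH sS].
  rewrite (_ : xb k 0%N = x k) //.
  by apply/funext => w; rewrite (svrg_stage_init run).
have hs := IH (ltnW sS).
have sS' : (1 <= s.+1 <= S k)%N by [].
rewrite (_ : xb k s.+1 = (fun w => (T k)%:R^-1 *: w) \o
    (fun w => \sum_(1 <= t < (T k).+1) xi k s.+1 t w)).
  apply: simple_comp; apply: simple_sum => t /andP[_ tT].
  exact: inner_simple.
by apply/funext => w /=; rewrite (svrg_snapshot run).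
Qed.

Let stage_simple k : (1 <= k <= K.+1)%N -> simple_wrt G (x k).
Proof.
elim: k => // -[_ _|k IH kK].
  rewrite (_ : x 1%N = fun=> x1); first exact: simple_cst.
  by apply/funext => w; rewrite (svrg_init run).
have kK' : (1 <= k.+1 <= K)%N by case/andP: kK.
rewrite (_ : x k.+2 = xb k.+1 (S k.+1)).
  by apply: snapshot_simple => //; apply: IH; exact: stage_rangeW.
by apply/funext => w; rewrite (svrg_output run).
Qed.

Lemma svrg_stage_control :
  stage_control g h r alpha mu p gam K tau x m bound error G.
Proof.
have m_fun (W : Type) (f : O -> W) (F : W -> R) : simple_wrt G f ->
    measurable_fun [set: g_sigma_algebraType G] ((F \o f) : g_sigma_algebraType G -> R).
  by move=> hf; apply: simple_measurable; exact: simple_comp.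
have Gsub : G `<=` (measurable : set (set O)).
  exact: hist_sub_measurable sources_meas _.
have pair_simple k : (1 <= k <= K)%N -> simple_wrt G (fun w => (x k w, x k.+1 w)).
  by move=> kK; apply: (simple_comp2 pair); apply: stage_simple; [exact: stage_rangeW|exact: stage_rangeS].
have mgap k : (1 <= k <= K)%N -> measurable_fun [set: g_sigma_algebraType G]
    ((fun w => gap k (x k w) (x k w)) : g_sigma_algebraType G -> R).
  by move=> kK; apply: (m_fun _ (x k) (fun y => gap k y y)); apply: stage_simple; exact: stage_rangeW.
split => //.
- exact: (svrg_tau run).
- move=> C B hB; rewrite [RHS]muleC; apply: (indep_hist (svrg_indep run) sources_meas sources_setT
    sources_setI (J := [set i | isSome i]) (i := None)) => //=.
  by exists C => //; rewrite setTI.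
- by move=> k kK; apply: (m_fun _ (x k)); exact: stage_simple.
- move=> k kK.
  exact: (m_fun _ _ (fun u => gap k u.1 u.2) (pair_simple k kK)).
- move=> k kK.
  exact: (m_fun _ _ (fun u => dotr (u.2 - u.1) (u.2 - u.1)) (pair_simple k kK)).
- move=> k kK.
  by apply: (m_fun _ (x k) (fun y => dotr (y - p y) (y - p y))); apply: stage_simple; exact: stage_rangeW.
- move=> k kK; apply: (@le_trans _ _ (\int[P]_w bound%:E)%E).
    apply: ge0_le_integral_nonmeas => w; first by rewrite lee_fin subr_ge0.
    by rewrite lee_fin svrg_sobj_le.
  by rewrite integral_cst // [X in (_ * X)%E](_ : _ = 1%E) ?mule1 //; exact: probability_setT.
- move=> k kK.
  have mD := sub_measurable_fun Gsub (mgap k kK).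
  have k0 : 0 <= error / k%:R by rewrite divr_ge0 ?error_ge0.
  apply: (@le_trans _ _ (\int[P]_w ((2^-1)%:E * (gap k (x k w) (x k w))%:E
     + (error / k%:R)%:E))%E).
    apply: ge0_le_integral_nonmeas => w; first by rewrite lee_fin.
    by rewrite -EFinM -EFinD lee_fin svrg_gap_next_le.
  rewrite ge0_integralD //; last 2 first.
  + by move=> w _; rewrite -EFinM lee_fin mulr_ge0.
  + by apply: emeasurable_funM => //; exact/measurable_EFinP.
  rewrite integral_cst // [X in (_ + _ * X)%E](_ : _ = 1%E); last exact: probability_setT.
  rewrite mule1 ge0_integralZl //; first exact/measurable_EFinP.
  by move=> w _; rewrite lee_fin.
Qed.

End svrg_control.

(** * Borel measurability *)

Section borel_vectors.
Context {R : realType} {d : nat}.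
Local Notation V := 'rV[R]_d.

Lemma continuous_borel_measurable (f : V -> R) : continuous f ->
  measurable_fun [set: borel R d] (f : borel R d -> R).
Proof.
move=> cf; apply: (measurability _ (RGenOInfty.measurableE R)).
move=> _ [_ [a ->] <-]; rewrite setTI; apply: sub_sigma_algebra.
by apply: (proj1 (continuousP _) cf); exact: interval_open.
Qed.

Lemma lsc_borel_measurable (f : V -> \bar R) : lower_semicontinuous f ->
  measurable_fun [set: borel R d] (f : borel R d -> \bar R).
Proof.
move=> lf; apply: (measurability _ (ErealGenOInfty.measurableE R)).
move=> _ [_ [a ->] <-]; rewrite setTI; apply: sub_sigma_algebra.
by rewrite preimage_itvoy; move/lower_semicontinuousP : lf; exact.
Qed.

Lemma continuous_borel_borel (f : V -> V) : continuous f ->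
  measurable_fun [set: borel R d] (f : borel R d -> borel R d).
Proof.
move=> cf; apply: (@measurability _ _ _ (borel R d) _ _ (@open V)) => //.
move=> _ [A oA <-]; rewrite setTI; apply: sub_sigma_algebra.
exact: (proj1 (continuousP _) cf).
Qed.

Lemma coord_borel_measurable dT (T : measurableType dT) (f : T -> V) i :
  measurable_fun [set: T] (f : T -> borel R d) ->
  measurable_fun [set: T] (fun t => f t 0 i).
Proof.
move=> mf; apply: (@measurableT_comp _ _ _ _ _ _ (fun u : borel R d => u 0 i)) => //.
by apply: continuous_borel_measurable; exact: continuous_coord.
Qed.

Let box (c : 'rV[rat]_d * nat) : set V :=
  [set v | forall i, `|v 0 i - ratr (c.1 0 i)| < c.2.+1%:R^-1].

Let open_boxes (U : set V) : open U ->
  U = \bigcup_(c in [set c | box c `<=` U]) box c.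
Proof.
move=> oU; apply/seteqP; split => [u Uu|u [c cU] /cU //].
have /nbhs_ballP[e /= e0 eU] : nbhs u U by exact: open_nbhs_nbhs.
have [n /= ne] : exists n : nat, n.+1%:R^-1 < e / 2.
  have e20 : 0 < (e / 2)^-1 by rewrite invr_gt0 divr_gt0.
  exists (natceil (e / 2)^-1); rewrite -[X in _ < X]invrK ltf_pV2 ?posrE //.
  by rewrite (le_lt_trans (natceil_ge (ltW e20))) // ltr_nat.
have cP i : exists q : rat, `|u 0 i - ratr q| < n.+1%:R^-1.
  have [|q] := @rat_in_itvoo R (u 0 i - n.+1%:R^-1) (u 0 i + n.+1%:R^-1).
    by rewrite ltrBlDr -addrA ltrDl addr_gt0.
  by rewrite in_itv /= => /andP[h1 h2]; exists q; rewrite ltr_norml;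
    move: (_^-1) h1 h2 => i0 h1 h2; apply/andP; split; lra.
exists (\row_i sval (cid (cP i)), n) => /=; last first.
  by move=> i /=; rewrite mxE; exact: svalP (cid (cP i)).
move=> v hv; apply: eU; split=> // i j; rewrite ord1 -ball_normE /ball_ /=.
have h1 := hv j; have := svalP (cid (cP j)); rewrite /= mxE in h1.
rewrite /= in h1 *; set q := sval _ in h1 *.
move=> h2; apply: (le_lt_trans (ler_distD (ratr q) _ _)).
rewrite (distrC (ratr q)); apply: (lt_trans (ltrD h2 h1)).
by move: ne; move: (_^-1) => t; lra.
Qed.

Lemma borel_measurable_coord dT (T : measurableType dT) (f : T -> V) :
  (forall i, measurable_fun [set: T] (fun t => f t 0 i)) ->
  measurable_fun [set: T] (f : T -> borel R d).
Proof.
move=> mf; apply: (@measurability _ _ _ (borel R d) _ _ (@open V)) => //.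
move=> _ [U oU <-]; rewrite setTI (open_boxes oU) preimage_bigcup bigcup_mkcond.
apply: countable_bigcupT_measurable => [|c]; first exact: countableP.
case: ifP => // _.
rewrite (_ : _ @^-1` _ = \bigcap_(i in [set: 'I_d])
    (fun t => `|f t 0 i - ratr (c.1 0 i)|) @^-1` `]-oo, c.2.+1%:R^-1[); last first.
  apply/seteqP; split => t /= h i; first by move=> _ /=; rewrite in_itv /=; exact: h.
  by have := h i Logic.I; rewrite /= in_itv.
apply: fin_bigcap_measurable => // i _.
rewrite -[X in measurable X]setTI.
apply: (_ : measurable_fun setT _) => //.
apply: (measurableT_comp (f := fun y : R => `|y|)) => //.
by apply: measurable_funB.
Qed.

Lemma dotr_measurable dT (T : measurableType dT) (f1 f2 : T -> V) :
  measurable_fun [set: T] (f1 : T -> borel R d) ->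
  measurable_fun [set: T] (f2 : T -> borel R d) ->
  measurable_fun [set: T] (fun t => dotr (f1 t) (f2 t)).
Proof.
move=> m1 m2; apply: measurable_sum => i.
by apply: measurable_funM; exact: coord_borel_measurable.
Qed.

Lemma addr_borel_measurable dT (T : measurableType dT) (f1 f2 : T -> V) :
  measurable_fun [set: T] (f1 : T -> borel R d) ->
  measurable_fun [set: T] (f2 : T -> borel R d) ->
  measurable_fun [set: T] ((fun t => f1 t + f2 t) : T -> borel R d).
Proof.
move=> m1 m2; apply: borel_measurable_coord => i.
under eq_fun do rewrite mxE.
by apply: measurable_funD; exact: coord_borel_measurable.
Qed.

Lemma scaler_borel_measurable dT (T : measurableType dT) (a : R) (f : T -> V) :
  measurable_fun [set: T] (f : T -> borel R d) ->
  measurable_fun [set: T] ((fun t => a *: f t) : T -> borel R d).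
Proof.
move=> m1; apply: borel_measurable_coord => i.
under eq_fun do rewrite mxE.
by apply: measurable_funM => //; exact: coord_borel_measurable.
Qed.

Lemma oppr_borel_measurable dT (T : measurableType dT) (f : T -> V) :
  measurable_fun [set: T] (f : T -> borel R d) ->
  measurable_fun [set: T] ((fun t => - f t) : T -> borel R d).
Proof.
move=> mf; have := scaler_borel_measurable (-1) mf.
by under eq_fun do rewrite scaleN1r.
Qed.

Lemma holder_continuous (f : V -> V) (L nu : R) : 0 <= L -> 0 < nu ->
  (forall u v, enorm (f u - f v) <= L * enorm (u - v) `^ nu) -> continuous f.
Proof.
move=> L0 nu0 fL u; apply/(@cvgrPdist_le _ _ _ (nbhs u)) => /= e e0.
pose a := (e / (L + 1)) `^ nu^-1.
have L1 : 0 < L + 1 by rewrite ltr_wpDl.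
have a0 : 0 < a by rewrite powR_gt0 // divr_gt0.
have b0 : 0 < a / d.+1%:R by rewrite divr_gt0.
apply/nbhs_ballP; exists (a / d.+1%:R) => //= v.
rewrite -ball_normE /ball_ /= => uv.
apply: (le_trans (mx_norm_le_enorm _)); apply: (le_trans (fL u v)).
have en : enorm (u - v) <= a.
  apply: (le_trans (enorm_le_mx_norm _)).
  move: uv; rewrite ltr_pdivlMr // => h; apply: le_trans (ltW h).
  by rewrite mulrC ler_wpM2l // ler_nat.
apply: (@le_trans _ _ (L * (e / (L + 1)))); last first.
  by rewrite mulrA ler_pdivrMr // mulrC ler_wpM2l ?(ltW e0) // lerDl.
rewrite ler_wpM2l //.
have -> : e / (L + 1) = a `^ nu.
  rewrite /a -powRrM mulVf ?gt_eqF // powRr1 //.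
  by rewrite divr_ge0 // ltW.
by apply: ge0_ler_powR; rewrite ?nnegrE ?enorm_ge0 // ltW.
Qed.

Lemma lipschitz_continuous (f : V -> V) (L : R) : 0 <= L ->
  (forall u v, enorm (f u - f v) <= L * enorm (u - v)) -> continuous f.
Proof.
move=> L0 fL; apply: (holder_continuous L0 ltr01) => u v.
by rewrite powRr1 ?enorm_ge0.
Qed.

Lemma qmin_lipschitz (g : V -> R) (L s : R) (q1 q2 : V) : 0 < L -> 0 < s ->
  convex_lsc g -> smooth L g ->
  enorm (qmin g s q1 - qmin g s q2) <= s^-1 * enorm (q1 - q2).
Proof.
move=> L0 s0 gc gs; set z1 := qmin g s q1; set z2 := qmin g s q2.
have e1 : grad g z1 + s *: z1 - q1 = 0 := qgrad_qmin q1 L0 s0 gc gs.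
have e2 : grad g z2 + s *: z2 - q2 = 0 := qgrad_qmin q2 L0 s0 gc gs.
have E1 : q1 = grad g z1 + s *: z1 by apply/eqP; rewrite eq_sym -subr_eq0 e1.
have E2 : q2 = grad g z2 + s *: z2 by apply/eqP; rewrite eq_sym -subr_eq0 e2.
have h1 := convex_grad z1 z2 gc gs.1; have h2 := convex_grad z2 z1 gc gs.1.
clearbody z1 z2.
have h : s * dotr (z1 - z2) (z1 - z2) <= dotr (q1 - q2) (z1 - z2).
  rewrite E1 E2; move: h1 h2; rewrite !dotrE (dotrC z2 z1); lra.
have := le_trans h (dotr_enorm _ _); rewrite -sqr_enorm expr2.
have [->|n0] := eqVneq (enorm (z1 - z2)) 0.
  by move=> _; rewrite mulr_ge0 ?enorm_ge0 // invr_ge0 ltW.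
by rewrite mulrA ler_pM2r ?lt_def ?n0 ?enorm_ge0 // ler_pdivlMl.
Qed.

End borel_vectors.

(** * SPG *)

Section centered_noise.
Context {R : realType} {d : nat} dX (X : measurableType dX) (Q : probability X R).
Local Notation V := 'rV[R]_d.

Definition centered (e : X -> V) : Prop := forall i,
  Q.-integrable setT (fun s => (e s 0 i)%:E) /\ (\int[Q]_s (e s 0 i)%:E = 0)%E.

Lemma centered_meas e : centered e ->
  measurable_fun [set: X] (e : X -> borel R d).
Proof.
move=> ce; apply: borel_measurable_coord => i.
exact/measurable_EFinP/(measurable_int Q)/(ce i).1.
Qed.

Lemma centered_dotr e (b : V) : centered e ->
  Q.-integrable setT (fun s => (dotr b (e s))%:E) /\
  (\int[Q]_s (dotr b (e s))%:E = 0)%E.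
Proof.
move=> ce.
have E : (fun s => (dotr b (e s))%:E) =
    (fun s => \sum_(i < d) ((b 0 i)%:E * (e s 0 i)%:E))%E.
  by apply/funext => s; rewrite /dotr -sumEFin.
have I i : Q.-integrable setT (fun s => (b 0 i)%:E * (e s 0 i)%:E)%E.
  by apply: integrableZl => //; exact: (ce i).1.
rewrite E; split; first by apply: integrable_sum => // i _; exact: I.
rewrite integral_sum // big1 // => i _.
by rewrite integralZl //; [rewrite (ce i).2 mule0|exact: (ce i).1].
Qed.

Lemma le_integral_centered e (b : V) (a : R) (f u : X -> \bar R) : centered e ->
  (forall s, 0 <= f s)%E -> (forall s, 0 <= u s)%E -> measurable_fun setT u ->
  (forall s, f s <= (a + dotr b (e s))%:E + u s)%E ->
  (\int[Q]_s f s <= a%:E + \int[Q]_s u s)%E.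
Proof.
move=> ce f0 u0 mu fu.
have [->|uoo] := eqVneq (\int[Q]_s u s)%E +oo%E; first by rewrite addey // leey.
have [bi b0] := centered_dotr b ce.
have iu : Q.-integrable setT u.
  apply/integrableP; split => //.
  rewrite (_ : (fun x => `|u x|)%E = u); last by apply/funext => s; rewrite gee0_abs.
  by rewrite ltey.
have ia : Q.-integrable setT (fun=> a%:E) by exact: finite_measure_integrable_cst.
apply: (le_trans (ge0_le_integral_nonmeas Q f0 fu)).
rewrite integralD //; last first.
  rewrite (_ : (fun s => _) = (fun=> a%:E) \+ (fun s => (dotr b (e s))%:E))%E //.
  exact: integrableD.
under eq_integral do rewrite EFinD.
rewrite integralD // b0 adde0 integral_cst //.
by rewrite [X in (_ * X + _)%E](_ : _ = 1%E) ?mule1 //; exact: probability_setT.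
Qed.

Lemma centered_variance_le (e : X -> V) (c : V) : centered e ->
  (\int[Q]_s (dotr (e s) (e s))%:E <= \int[Q]_s (dotr (e s - c) (e s - c))%:E)%E.
Proof.
move=> ce; rewrite -[leRHS]add0e.
apply: (@le_integral_centered e (2 *: c) 0) => //.
- by move=> s; rewrite lee_fin dotr_ge0.
- by move=> s; rewrite lee_fin dotr_ge0.
- apply/measurable_EFinP; apply: dotr_measurable;
  (apply: addr_borel_measurable; [exact: centered_meas ce|exact: measurable_cst]).
- move=> s; rewrite -EFinD lee_fin; have := dotr_ge0 c.
  rewrite !dotrE !(dotrC (e s)); lra.
Qed.

End centered_noise.

Section oracle.
Context {R : realType} {d : nat}.
Local Notation V := 'rV[R]_d.
Context dX (X : measurableType dX) dY (Y : measurableType dY).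
Variables (QX : probability X R) (QY : probability Y R).

Lemma unbiased_centered (f : V -> R) (fs : V -> X -> R) (D : V -> X -> V) y :
  unbiased_oracle QX f fs D -> centered QX (fun s => D y s - grad f y).
Proof.
move=> [_ _ _ Di Dv] i.
have E : (fun s => ((D y s - grad f y) 0 i)%:E) =
   ((fun s => (D y s 0 i)%:E) \+ (fun=> (- grad f y 0 i)%:E))%E.
  by apply/funext => s; rewrite !mxE.
have ic : QX.-integrable setT (fun=> (- grad f y 0 i)%:E).
  exact: finite_measure_integrable_cst.
rewrite E; split; first exact: integrableD.
rewrite integralD // integral_cst //.
rewrite [X in (_ + _ * X)%E](_ : _ = 1%E); last exact: probability_setT.
rewrite -[in X in (_ + X)%E](Dv y) mxE unlock mule1.
have fin : (\int[QX]_s (D y s 0 i)%:E)%E \is a fin_num by exact: integrable_fin_num.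
by rewrite -[X in (X + _)%E]fineK // -EFinD subrr.
Qed.

End oracle.

Section oracle_variance.
Context {R : realType} {d : nat}.
Local Notation V := 'rV[R]_d.
Context dX (X : measurableType dX) dY (Y : measurableType dY).
Variables (QX : probability X R) (QY : probability Y R).
Variables (eX : X -> V) (eY : Y -> V) (k : V) (G : R).
Hypotheses (cX : centered QX eX) (cY : centered QY eY).

Lemma joint_measurable (c : V) : measurable_fun [set: (X * Y)%type]
  (fun z : (X * Y)%type => (dotr (eX z.1 - eY z.2 - c) (eX z.1 - eY z.2 - c))%:E).
Proof.
have m1 : measurable_fun [set: (X * Y)%type] ((fun z => eX z.1) : (X * Y)%type -> borel R d).
  exact: (measurableT_comp (centered_meas cX) measurable_fst).
have m2 : measurable_fun [set: (X * Y)%type] ((fun z => eY z.2) : (X * Y)%type -> borel R d).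
  exact: (measurableT_comp (centered_meas cY) measurable_snd).
apply/measurable_EFinP; apply: dotr_measurable;
  (apply: addr_borel_measurable; [apply: addr_borel_measurable => //;
    exact: oppr_borel_measurable|exact: measurable_cst]).
Qed.

Lemma joint_variance_fst : (\int[QX]_s (dotr (eX s) (eX s))%:E <=
  \int[QX \x QY]_z (dotr (eX z.1 - eY z.2 - k) (eX z.1 - eY z.2 - k))%:E)%E.
Proof.
rewrite fubini_tonelli1 //; last 2 first.
- exact: joint_measurable.
- by move=> z; rewrite lee_fin dotr_ge0.
apply: (le_trans (centered_variance_le k cX)).
apply: ge0_le_integral_nonmeas => s; first by rewrite lee_fin dotr_ge0.
rewrite /fubini_F /=.
apply: (@le_trans _ _ (\int[QY]_t (dotr (eX s - k) (eX s - k))%:E)%E).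
  by rewrite integral_cst // [X in (_ * X)%E](_ : _ = 1%E) ?mule1 //; exact: probability_setT.
rewrite -[leRHS]add0e.
apply: (@le_integral_centered _ _ _ _ _ eY (2 *: (eX s - k)) 0) => //.
- by move=> t; rewrite lee_fin dotr_ge0.
- by move=> t; rewrite lee_fin dotr_ge0.
- have := joint_measurable k; exact: measurable_fun_pair2.
- move=> t; rewrite -EFinD lee_fin.
  have -> : eX s - eY t - k = (eX s - k) - eY t by rewrite addrAC.
  have := dotr_ge0 (eY t); move: (eX s - k) => v; rewrite !dotrE !(dotrC v); lra.
Qed.

Lemma joint_variance_snd : (\int[QY]_t (dotr (eY t) (eY t))%:E <=
  \int[QX \x QY]_z (dotr (eX z.1 - eY z.2 - k) (eX z.1 - eY z.2 - k))%:E)%E.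
Proof.
rewrite fubini_tonelli2 //; last 2 first.
- exact: joint_measurable.
- by move=> z; rewrite lee_fin dotr_ge0.
apply: (le_trans (centered_variance_le (- k) cY)).
apply: ge0_le_integral_nonmeas => t; first by rewrite lee_fin dotr_ge0.
rewrite /fubini_G /=.
apply: (@le_trans _ _ (\int[QX]_s (dotr (eY t - - k) (eY t - - k))%:E)%E).
  by rewrite integral_cst // [X in (_ * X)%E](_ : _ = 1%E) ?mule1 //; exact: probability_setT.
rewrite -[leRHS]add0e.
apply: (@le_integral_centered _ _ _ _ _ eX (2 *: (eY t - - k)) 0) => //.
- by move=> s; rewrite lee_fin dotr_ge0.
- by move=> s; rewrite lee_fin dotr_ge0.
- have := joint_measurable k; exact: measurable_fun_pair1.
- move=> s; rewrite -EFinD lee_fin.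
  have -> : eX s - eY t - k = eX s - (eY t - - k) by rewrite opprK opprD addrA.
  have := dotr_ge0 (eX s); move: (eY t - - k) => v; rewrite !dotrE !(dotrC v); lra.
Qed.

Lemma joint_noise_le (f : (X * Y)%type -> \bar R) (b : V) (A c V1 V2 : R) :
  0 <= c -> measurable_fun [set: (X * Y)%type] f -> (forall z, 0 <= f z)%E ->
  (\int[QX]_s (dotr (eX s) (eX s))%:E <= V1%:E)%E ->
  (\int[QY]_t (dotr (eY t) (eY t))%:E <= V2%:E)%E ->
  (forall z, f z <= (A + dotr b (eX z.1 - eY z.2)
     + c * dotr (eX z.1 - eY z.2) (eX z.1 - eY z.2))%:E)%E ->
  (\int[QX \x QY]_z f z <= (A + c * (V1 + V2))%:E)%E.
Proof.
move=> c0 mf f0 hV1 hV2 hf; rewrite fubini_tonelli1 //.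
have sq dZ (Z : measurableType dZ) (Q : probability Z R) (e : Z -> V) W :
    centered Q e -> (\int[Q]_s (dotr (e s) (e s))%:E <= W%:E)%E ->
    measurable_fun setT (fun s => (c * dotr (e s) (e s))%:E) /\
    (\int[Q]_s (c * dotr (e s) (e s))%:E <= (c * W)%:E)%E.
  move=> ce hW.
  have m1 : measurable_fun setT (fun s => dotr (e s) (e s)).
    by apply: dotr_measurable; exact: centered_meas ce.
  split; first by apply/measurable_EFinP; exact: measurable_funM.
  under eq_integral do rewrite EFinM.
  rewrite ge0_integralZl //; first by rewrite EFinM; apply: lee_wpmul2l.
  - exact/measurable_EFinP.
  - by move=> s _; rewrite lee_fin dotr_ge0.
have [mX hX] := sq _ _ _ _ _ cX hV1; have [mY hY] := sq _ _ _ _ _ cY hV2.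
have step s : (fubini_F QY f s <= (A + c * V2 + dotr b (eX s))%:E
    + (c * dotr (eX s) (eX s))%:E)%E.
  rewrite /fubini_F.
  apply: (@le_trans _ _ ((A + dotr b (eX s) + c * dotr (eX s) (eX s))%:E +
     \int[QY]_t (c * dotr (eY t) (eY t))%:E)%E).
    apply: (@le_integral_centered _ _ _ _ _ eY (- (b + (2 * c) *: eX s))) => //.
    - by move=> t; rewrite lee_fin mulr_ge0 ?dotr_ge0.
    - move=> t; apply: (le_trans (hf (s, t))); rewrite -EFinD lee_fin /=.
      rewrite !dotrE (dotrC (eY t) (eX s)); lra.
  by apply: (le_trans (leeD2l _ hY)); rewrite -!EFinD lee_fin; lra.
apply: (@le_trans _ _ ((A + c * V2)%:E + \int[QX]_s (c * dotr (eX s) (eX s))%:E)%E).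
  apply: (@le_integral_centered _ _ _ _ _ eX b) => //.
  - by move=> s; apply: integral_ge0 => t _; exact: f0.
  - by move=> s; rewrite lee_fin mulr_ge0 ?dotr_ge0.
by apply: (le_trans (leeD2l _ hX)); rewrite -EFinD lee_fin; lra.
Qed.

End oracle_variance.

Section spg_step.
Context {R : realType} {d : nat}.
Local Notation V := 'rV[R]_d.
Variables (g h : V -> R) (L mu gam : R) (p : V -> V).
Hypotheses (mu0 : 0 < mu) (L0 : 0 < L) (gamL : 3 * L <= gam).
Hypotheses (g_convex : convex_lsc g) (g_smooth : smooth L g).
Context dX (X : measurableType dX) dY (Y : measurableType dY).
Variables (QX : probability X R) (QY : probability Y R).
Variables (Dg : V -> X -> V) (Dh : V -> Y -> V) (G : R).
Hypothesis Dg_centered : forall y, centered QX (fun s => Dg y s - grad g y).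
Hypothesis Dh_centered : forall y, centered QY (fun s => Dh y s - grad h y).
Hypothesis Dg_var : forall y, (\int[QX]_s
  (dotr (Dg y s - grad g y) (Dg y s - grad g y))%:E <= (G ^+ 2)%:E)%E.
Hypothesis Dh_var : forall y, (\int[QY]_s
  (dotr (Dh y s - grad h y) (Dh y s - grad h y))%:E <= (G ^+ 2)%:E)%E.

Let s := stage_modulus mu gam.
Let slope x := stage_slope h mu gam p x.

Definition spg_next (t : nat) (x y : V) (z : (X * Y)%type) : V :=
  (gam * t.+1%:R / 3 + s)^-1 *: ((gam * t.+1%:R / 3) *: y + gam *: x
    - (Dg y z.1 - Dh x z.2 - mu^-1 *: p x)).

Let z x := qmin g s (slope x).

Definition spg_potential (t : nat) (x y : V) : R :=
  gam * t.+1%:R ^+ 2 / 6 * dotr (y - z x) (y - z x).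

Let gam0 : 0 < gam. Proof. by apply: lt_le_trans gamL; rewrite mulr_gt0. Qed.
Let s0 : 0 < s. Proof. by apply: stage_modulus_gt0 => //; exact: ltW. Qed.

Lemma spg_next_expectation t x y : (1 <= t)%N ->
  measurable_fun [set: (X * Y)%type] (fun u => (t.+1%:R *
      (qobj g s (slope x) (spg_next t x y u) - qobj g s (slope x) (z x))
    + spg_potential t.+1 x (spg_next t x y u))%:E) ->
  (\int[QX \x QY]_u (t.+1%:R *
      (qobj g s (slope x) (spg_next t x y u) - qobj g s (slope x) (z x))
    + spg_potential t.+1 x (spg_next t x y u))%:E <=
   (spg_potential t x y + 6 * G ^+ 2 / gam)%:E)%E.
Proof.
move=> t1 mf.
have t2 : 2 <= t.+1%:R :> R by rewrite (ler_nat _ 2).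
pose a := gam * t.+1%:R / 3.
have a0 : 0 < a by rewrite divr_gt0 // mulr_gt0.
have La : 2 * L <= a.
  have := ler_wpM2l (ltW gam0) t2; rewrite /a; move: (t.+1%:R) => u; have := gamL; lra.
have sa0 : 0 < s + a by rewrite addr_gt0.
have sg : gam <= s by rewrite /s /stage_modulus lerDr invr_ge0 ltW.
pose yh := (s + a)^-1 *: (a *: y + slope x - grad g y).
have -> : spg_potential t x y + 6 * G ^+ 2 / gam =
  spg_potential t x y + 3 / gam * (G ^+ 2 + G ^+ 2) by field; rewrite gt_eqF.
apply: (joint_noise_le (Dg_centered y) (Dh_centered x)
  (b := - (t.+1%:R *: (yh - z x)))) => //.
- by rewrite divr_ge0 // ltW.
- move=> u; rewrite lee_fin addr_ge0 //.
    by rewrite mulr_ge0 // subr_ge0; exact: (qmin_min _ s0 g_convex g_smooth).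
  by rewrite /spg_potential mulr_ge0 ?dotr_ge0 // divr_ge0 // mulr_ge0 ?sqr_ge0 // ltW.
move=> u; rewrite lee_fin.
pose e : V := Dg y u.1 - grad g y - (Dh x u.2 - grad h x).
rewrite -/e; set y' := spg_next t x y u.
have y'E : (s + a) *: y' = a *: y + slope x - grad g y - e.
  rewrite /y' /spg_next -/a (addrC s a) scalerA mulfV ?gt_eqF ?(addrC a) // scale1r.
  by rewrite /e /slope /stage_slope; apply/rowP => i; rewrite !mxE; ring.
have yhE : (s + a) *: yh = a *: y + slope x - grad g y.
  by rewrite /yh scalerA mulfV ?gt_eqF // scale1r.
have := qobj_prox_step L0 s0 g_convex g_smooth La y'E yhE.
rewrite -/(z x) dotrNl dotrZl (dotrC e).
have N0 := dotr_ge0 (y' - z x); have e0 := dotr_ge0 e.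
move=> hstep.
have h1 := ler_wpM2l (ler0n R t.+1) hstep.
have h2 : t.+1%:R * ((s + a)^-1 * dotr e e) <= 3 / gam * dotr e e.
  rewrite mulrA ler_wpM2r // ler_pdivrMr //.
  apply: (@le_trans _ _ (3 / gam * a)); last first.
    by rewrite ler_wpM2l ?divr_ge0 ?(ltW gam0) // lerDr ltW.
  by rewrite /a le_eqVlt; apply/orP; left; apply/eqP; field; rewrite gt_eqF.
have h3 : gam * t.+2%:R ^+ 2 / 6 * dotr (y' - z x) (y' - z x) <=
    t.+1%:R * ((s + a) / 2 * dotr (y' - z x) (y' - z x)).
  rewrite [leRHS]mulrA ler_wpM2r //.
  apply: (@le_trans _ _ (t.+1%:R * ((gam + a) / 2))); last first.
    by rewrite ler_wpM2l // ler_wpM2r // lerD2r.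
  rewrite /a -[t.+2%:R]natr1; move: (t.+1%:R) t2 => w w2.
  by have := ler_wpM2l (ltW gam0) w2; have := gam0; nra.
have h4 : t.+1%:R * (a / 2 * dotr (y - z x) (y - z x)) = spg_potential t x y.
  by rewrite /spg_potential /a; field.
rewrite -h4 /spg_potential; move: h1 h2 h3.
move: (t.+1%:R) => w; move: ((s + a)^-1 * _) => E1 h1 h2 h3.
lra.
Qed.

End spg_step.

Lemma hist_mono dO (O : measurableType dO) (I : choiceType) (F : I -> set (set O)) (J J' : set I) :
  J `<=` J' -> hist F J `<=` hist F J'.
Proof. by move=> JJ' A [i /JJ' Ji FA]; exists i. Qed.

Lemma measurable_fun_mono dW (W : measurableType dW) (O : pointedType)
    (G G' : set (set O)) (f : O -> W) : G `<=` G' ->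
  measurable_fun [set: g_sigma_algebraType G] (f : g_sigma_algebraType G -> W) ->
  measurable_fun [set: g_sigma_algebraType G'] (f : g_sigma_algebraType G' -> W).
Proof.
move=> GG' mf _ B mB; have := mf measurableT B mB.
exact: sub_sigma_algebra2.
Qed.

Section stage_measurability.
Context {R : realType} {d : nat}.
Local Notation V := 'rV[R]_d.
Variables (g h : V -> R) (r : V -> \bar R) (L nu mu : R) (p : V -> V).
Variable gam : nat -> R.
Hypothesis r_lsc : lower_semicontinuous r.
Hypotheses (mu0 : 0 < mu) (L0 : 0 < L) (nu0 : 0 < nu).
Hypotheses (g_convex : convex_lsc g).
Hypotheses (g_smooth : smooth L g) (h_holder : holder_grad L nu h).
Hypothesis gam0 : forall k, 0 <= gam k.
Hypothesis p_meas : measurable_fun [set: borel R d] (p : borel R d -> borel R d).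
Context dT (T : measurableType dT).
Variables (f1 f2 : T -> V).
Hypothesis m1 : measurable_fun [set: T] (f1 : T -> borel R d).
Hypothesis m2 : measurable_fun [set: T] (f2 : T -> borel R d).

Lemma continuous_comp_measurable (F : V -> R) : continuous F ->
  measurable_fun [set: T] (fun t => F (f1 t)).
Proof. by move=> cF; exact: (measurableT_comp (continuous_borel_measurable cF) m1). Qed.

Lemma diff_measurable (F : V -> R) : differentiable_everywhere F ->
  measurable_fun [set: T] (fun t => F (f1 t)).
Proof.
move=> dF; apply: continuous_comp_measurable => y.
exact: (differentiable_continuous (dF y)).
Qed.

Lemma prox_measurable : measurable_fun [set: T] ((fun t => p (f1 t)) : T -> borel R d).
Proof. exact: (measurableT_comp p_meas m1). Qed.

Lemma slope_measurable k : measurable_fun [set: T]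
  ((fun t => stage_slope h mu (gam k) p (f1 t)) : T -> borel R d).
Proof.
apply: addr_borel_measurable; first apply: addr_borel_measurable.
- apply: (measurableT_comp (continuous_borel_borel _) m1).
  exact: holder_continuous (ltW L0) nu0 h_holder.2.
- exact: scaler_borel_measurable prox_measurable.
- exact: scaler_borel_measurable.
Qed.

Lemma stage_min_measurable k : measurable_fun [set: T]
  ((fun t => stage_min g h mu p gam k (f1 t)) : T -> borel R d).
Proof.
have s0 : 0 < stage_modulus mu (gam k) by exact: stage_modulus_gt0.
apply: (measurableT_comp (continuous_borel_borel (f := qmin g (stage_modulus mu (gam k))) _)
  (slope_measurable k)).
apply: (@lipschitz_continuous _ _ _ (stage_modulus mu (gam k))^-1).
  by rewrite invr_ge0 ltW.
by move=> u v; exact: (qmin_lipschitz _ _ L0 s0 g_convex g_smooth).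
Qed.

Lemma sobj_measurable : differentiable_everywhere h ->
  (forall x, is_prox mu r x (p x)) ->
  measurable_fun [set: T] (fun t => sobj g h r mu p (f1 t)).
Proof.
move=> dh p_prox; apply: measurable_funD; first apply: measurable_funD.
- by apply: measurable_funB; apply: diff_measurable => //; exact: g_smooth.1.
- apply: measurable_funM => //; apply: dotr_measurable;
  (apply: addr_borel_measurable;
    [exact: prox_measurable|exact: oppr_borel_measurable]).
- have m3 : measurable_fun [set: T] (fun t => r (p (f1 t))).
    exact: (measurableT_comp (lsc_borel_measurable r_lsc) prox_measurable).
  exact: (measurableT_comp (fine_measurable measurableT) m3).
Qed.

Lemma residual_measurable :
  measurable_fun [set: T] (fun t => dotr (f1 t - p (f1 t)) (f1 t - p (f1 t))).
Proof.
apply: dotr_measurable; (apply: addr_borel_measurable => //;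
  apply: oppr_borel_measurable; exact: prox_measurable).
Qed.

Lemma sqr_dist_measurable :
  measurable_fun [set: T] (fun t => dotr (f2 t - f1 t) (f2 t - f1 t)).
Proof.
apply: dotr_measurable; (apply: addr_borel_measurable => //;
  exact: oppr_borel_measurable).
Qed.

End stage_measurability.

Section stage_gap_measurability.
Context {R : realType} {d : nat}.
Local Notation V := 'rV[R]_d.
Variables (g h : V -> R) (L nu mu : R) (p : V -> V).
Variable gam : nat -> R.
Hypotheses (mu0 : 0 < mu) (L0 : 0 < L) (nu0 : 0 < nu).
Hypotheses (g_convex : convex_lsc g).
Hypotheses (g_smooth : smooth L g) (h_holder : holder_grad L nu h).
Hypothesis gam0 : forall k, 0 <= gam k.
Hypothesis p_meas : measurable_fun [set: borel R d] (p : borel R d -> borel R d).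
Context dT (T : measurableType dT).
Variables (f1 f2 : T -> V).
Hypothesis m1 : measurable_fun [set: T] (f1 : T -> borel R d).
Hypothesis m2 : measurable_fun [set: T] (f2 : T -> borel R d).

Let obj_measurable k (f : T -> V) : measurable_fun [set: T] (f : T -> borel R d) ->
  measurable_fun [set: T] (fun t => stage_obj g h mu p gam k (f1 t) (f t)).
Proof.
move=> mf; apply: measurable_funB; first apply: measurable_funD.
- by apply: diff_measurable => //; exact: g_smooth.1.
- by apply: measurable_funM => //; exact: dotr_measurable.
- apply: dotr_measurable => //.
  exact: (slope_measurable mu gam L0 nu0 h_holder p_meas m1).
Qed.

Lemma stage_gap_measurable k :
  measurable_fun [set: T] (fun t => stage_gap g h mu p gam k (f1 t) (f2 t)).
Proof.
apply: measurable_funB; first exact: obj_measurable.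
apply: obj_measurable.
exact: (stage_min_measurable mu0 L0 nu0 g_convex g_smooth h_holder gam0 p_meas m1).
Qed.

End stage_gap_measurability.

Lemma ge0_telescope (R : realType) (a b : nat -> \bar R) (c : R) (n : nat) :
  (forall t, 0 <= a t)%E ->
  (forall t, (1 <= t <= n)%N -> a t + b t.+1 <= b t + c%:E)%E ->
  (\sum_(1 <= t < n.+1) a t + b n.+1 <= b 1%N + (n%:R * c)%:E)%E.
Proof.
move=> a0; elim: n => [|n IH] ab; first by rewrite big_nil add0e mul0r adde0.
rewrite big_nat_recr //= -addeA; apply: (le_trans (leeD2l _ (ab n.+1 (leqnn _)))).
rewrite addeA; apply: (le_trans (leeD2r _ (IH _))).
  by move=> t /andP[t1 tn]; apply: ab; rewrite t1 leqW.
by rewrite -addeA -EFinD -natr1 mulrDl mul1r.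
Qed.

Lemma sum_weights (R : realType) (T : nat) :
  \sum_(2 <= t < T.+2) t%:R = (T%:R * (T%:R + 3)) / 2 :> R.
Proof.
elim: T => [|T IH]; first by rewrite big_nil !mul0r.
by rewrite big_nat_recr //= IH -!natr1; field.
Qed.

Section spg_control.
Context {R : realType} {d : nat}.
Local Notation V := 'rV[R]_d.
Variables (g h : V -> R) (r : V -> \bar R) (L nu mu alpha : R) (p : V -> V).
Hypotheses (r_proper : proper r) (r_lsc : lower_semicontinuous r).
Hypotheses (mu0 : 0 < mu) (L0 : 0 < L) (nu0 : 0 < nu).
Hypothesis g_convex : convex_lsc g.
Hypotheses (g_smooth : smooth L g) (h_holder : holder_grad L nu h).
Hypothesis p_meas : measurable_fun [set: borel R d] (p : borel R d -> borel R d).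
Hypothesis (p_prox : forall x, is_prox mu r x (p x)).
Variables (gam : nat -> R) (T : nat -> nat) (K : nat) (x1 : V).
Hypothesis gam0 : forall k, 0 <= gam k.
Hypothesis gamL : forall k, (1 <= k)%N -> 3 * L <= gam k.
Hypothesis T3 : forall k, (3 <= T k)%N.
Hypothesis gamT : forall k, (1 <= k)%N -> 3 * L * k%:R <= gam k * (T k)%:R.
Context dX (X : measurableType dX) dY (Y : measurableType dY).
Variables (QX : probability X R) (QY : probability Y R).
Variables (Dg : V -> X -> V) (Dh : V -> Y -> V) (G : R).
Hypothesis Dg_meas : measurable_fun [set: (borel R d * X)%type]
  (fun z => Dg z.1 z.2 : borel R d).
Hypothesis Dh_meas : measurable_fun [set: (borel R d * Y)%type]
  (fun z => Dh z.1 z.2 : borel R d).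
Hypothesis Dg_centered : forall y, centered QX (fun s => Dg y s - grad g y).
Hypothesis Dh_centered : forall y, centered QY (fun s => Dh y s - grad h y).
Hypothesis Dg_var : forall y, (\int[QX]_s
  (dotr (Dg y s - grad g y) (Dg y s - grad g y))%:E <= (G ^+ 2)%:E)%E.
Hypothesis Dh_var : forall y, (\int[QY]_s
  (dotr (Dh y s - grad h y) (Dh y s - grad h y))%:E <= (G ^+ 2)%:E)%E.
Context dO (O : measurableType dO) (P : probability O R).
Variables (Z : nat -> nat -> {RV P >-> (X * Y)%type}) (tau : {RV P >-> nat}).
Variables (x : nat -> O -> V) (y : nat -> nat -> O -> V).
Hypothesis run : spg_run p mu alpha gam T K x1 QX QY Dg Dh Z tau x y.
Variables (m Delta : R).
Hypothesis standing : forall k, (1 <= k <= K)%N ->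
  (\int[P]_w (smoothed_objective g h r mu (x k w) - m%:E) <= Delta%:E)%E.

Local Notation gap := (stage_gap g h mu p gam).
Local Notation modulus k := (stage_modulus mu (gam k)).
Local Notation slope k u := (stage_slope h mu (gam k) p u).
Local Notation next k := (spg_next mu (gam k) p Dg Dh).
Local Notation potential k := (spg_potential g h mu (gam k) p).

Let gam_gt0 k : (1 <= k)%N -> 0 < gam k.
Proof. by move=> k1; apply: lt_le_trans (gamL k1); rewrite mulr_gt0. Qed.

Lemma spg_iterate k t w : (1 <= k <= K)%N -> (1 <= t <= T k)%N ->
  y k t.+1 w = next k t (x k w) (y k t w) (Z k t w).
Proof.
move=> kK tT; have k1 : (1 <= k)%N by case/andP: kK.
have := spg_step run w kK tT; rewrite /minimizes.
set v := (_ - _ - _) => hmin.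
have a0 : 0 < gam k * t.+1%:R / 3 by rewrite divr_gt0 // mulr_gt0 // gam_gt0.
have E : (gam k * t.+1%:R / 3 + modulus k) *: y k t.+1 w =
  (gam k * t.+1%:R / 3) *: y k t w + gam k *: x k w - v.
  apply: (prox_linear_step a0 mu0 (gam0 k)) => u.
  have := hmin u; rewrite !sqr_enorm.
  have -> : (2 * (3 / (gam k * t.+1%:R)))^-1 = gam k * t.+1%:R / 3 / 2.
    have t0 : t.+1%:R != 0 :> R by [].
    by move: (t.+1%:R) t0 => c c0; field; rewrite c0 gt_eqF ?gam_gt0.
  rewrite !(dotrC v); lra.
by rewrite /spg_next -E scalerA mulVf ?scale1r // gt_eqF // addr_gt0 // stage_modulus_gt0.
Qed.

Let sources (i : option (nat * nat)) : set (set O) :=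
  if i is Some kt then sigma_of (Z kt.1 kt.2) else sigma_of tau.

Let before (k t : nat) : set (option (nat * nat)) :=
  [set i | exists k' t', i = Some (k', t') /\ ((k' < k)%N \/ k' = k /\ (t' < t)%N)].

Let before_le k t t' : (t <= t')%N -> before k t `<=` before k t'.
Proof.
move=> tt' i [k' [s [-> h0]]]; exists k', s; split => //.
by case: h0 => [h0|[h0 h1]]; [left|right; split => //; exact: leq_trans tt'].
Qed.

Let before_next k t : before k t `<=` before k.+1 1%N.
Proof.
move=> i [k' [s [-> h0]]]; exists k', s; split => //; left.
by case: h0 => [h0|[-> _]]; rewrite ltnS // ltnW.
Qed.

Let sources_sigma i : exists dS (S : measurableType dS) (f : {mfun O >-> S}),
  sources i = sigma_of f.
Proof.
by case: i => [kt|]; [exists _, _, (Z kt.1 kt.2)|exists _, _, tau].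
Qed.

Let sources_meas i A : sources i A -> measurable A.
Proof.
have [dS [S [f ->]]] := sources_sigma i; move=> [B mB <-].
by apply: (measurable_funP f) => //.
Qed.

Let sources_setT i : sources i setT.
Proof.
have [dS [S [f ->]]] := sources_sigma i.
by exists setT => //; rewrite setTI preimage_setT.
Qed.

Let sources_setI i : setI_closed (sources i).
Proof.
have [dS [S [f ->]]] := sources_sigma i => _ _ [A mA <-] [B mB <-].
exists (A `&` B); first exact: measurableI.
by rewrite preimage_setI !setTI.
Qed.

Local Notation H J := (g_sigma_algebraType (hist sources J)).
Local Notation Hmeasurable J f :=
  (measurable_fun [set: H J] (f : H J -> borel R d)).

Let H_mono (J J' : set (option (nat * nat))) (f : O -> V) :
  J `<=` J' -> Hmeasurable J f -> Hmeasurable J' f.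
Proof. by move=> JJ'; apply: measurable_fun_mono; exact: hist_mono. Qed.

Let sample_measurable k t (J : set (option (nat * nat))) : J (Some (k, t)) ->
  measurable_fun [set: H J] (Z k t : H J -> (X * Y)%type).
Proof.
move=> Jkt _ B mB; apply: sub_sigma_algebra.
by exists (Some (k, t)) => //; exists B.
Qed.

Lemma next_measurable k t dS (S : measurableType dS) (f1 f2 : S -> V)
    (f3 : S -> (X * Y)%type) :
  measurable_fun [set: S] (f1 : S -> borel R d) ->
  measurable_fun [set: S] (f2 : S -> borel R d) ->
  measurable_fun [set: S] f3 ->
  measurable_fun [set: S] ((fun s => next k t (f1 s) (f2 s) (f3 s)) : S -> borel R d).
Proof.
move=> m1 m2 m3; apply: scaler_borel_measurable.
have mg : measurable_fun [set: S] ((fun s => Dg (f2 s) (f3 s).1) : S -> borel R d).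
  apply: (measurableT_comp Dg_meas (g := fun s => (f2 s : borel R d, (f3 s).1))).
  by apply: measurable_fun_pair => //; exact: (measurableT_comp measurable_fst m3).
have mh : measurable_fun [set: S] ((fun s => Dh (f1 s) (f3 s).2) : S -> borel R d).
  apply: (measurableT_comp Dh_meas (g := fun s => (f1 s : borel R d, (f3 s).2))).
  by apply: measurable_fun_pair => //; exact: (measurableT_comp measurable_snd m3).
have mp : measurable_fun [set: S] ((fun s => p (f1 s)) : S -> borel R d).
  exact: prox_measurable.
apply: addr_borel_measurable.
  by apply: addr_borel_measurable; exact: scaler_borel_measurable.
apply: oppr_borel_measurable; apply: addr_borel_measurable; last first.
  by apply: oppr_borel_measurable; exact: scaler_borel_measurable.
by apply: addr_borel_measurable => //; exact: oppr_borel_measurable.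
Qed.

Let inner_measurable k : (1 <= k <= K)%N -> Hmeasurable (before k 1) (x k) ->
  forall t, (t <= T k)%N -> Hmeasurable (before k t.+1) (y k t.+1).
Proof.
move=> kK mx; elim=> [_|t IH tT].
  rewrite (_ : y k 1%N = x k) //.
  by apply/funext => w; rewrite (spg_stage_init run).
have tT' : (1 <= t.+1 <= T k)%N by [].
rewrite (_ : y k t.+2 = fun w => next k t.+1 (x k w) (y k t.+1 w) (Z k t.+1 w)); last first.
  by apply/funext => w; rewrite spg_iterate.
apply: next_measurable.
- by apply: (H_mono _ mx); exact: before_le.
- by apply: (H_mono _ (IH (ltnW tT))); exact: before_le.
- by apply: sample_measurable; exists k, t.+1; split => //; right.
Qed.

Let sum_measurable dS (S : measurableType dS) (f : nat -> S -> V) (a b : nat) :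
  (forall t, (a <= t < b)%N -> measurable_fun [set: S] (f t : S -> borel R d)) ->
  measurable_fun [set: S] ((fun s => \sum_(a <= t < b) f t s) : S -> borel R d).
Proof.
move=> mf; apply: borel_measurable_coord => i.
rewrite (_ : (fun s => _) = (fun s => \sum_(a <= t < b)
    (if (a <= t < b)%N then f t s 0 i else 0))).
  apply: measurable_sum => t; case tab : (a <= t < b)%N => //.
  exact: coord_borel_measurable (mf t tab).
by apply/funext => s; rewrite summxE big_nat [RHS]big_nat; apply: eq_bigr => t ->.
Qed.

Let stage_measurable k : (1 <= k <= K.+1)%N -> Hmeasurable (before k 1) (x k).
Proof.
elim: k => // -[_ _|k IH kK].
  rewrite (_ : x 1%N = fun=> x1); first exact: measurable_cst.
  by apply/funext => w; rewrite (spg_init run).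
have kK' : (1 <= k.+1 <= K)%N by case/andP: kK.
rewrite (_ : x k.+2 = fun w => (\sum_(2 <= t < (T k.+1).+2) t%:R)^-1 *:
    \sum_(2 <= t < (T k.+1).+2) t%:R *: y k.+1 t w); last first.
  by apply/funext => w; rewrite (spg_output run).
apply: scaler_borel_measurable; apply: sum_measurable => -[//|t] /andP[t2 tT].
apply: scaler_borel_measurable.
have := inner_measurable kK' (IH (stage_rangeW kK')) (t := t).
move=> /(_ _)/H_mono; apply => //.
Qed.

Let gap_ge0 k u v : 0 <= gap k u v.
Proof. exact: (stage_gap_ge0 h p mu0 g_convex g_smooth gam0). Qed.

Let potential_ge0 k t u v : 0 <= potential k t u v.
Proof.
by rewrite /spg_potential mulr_ge0 ?dotr_ge0 // divr_ge0 // mulr_ge0 ?sqr_ge0.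
Qed.

Let gap_measurable k dS (S : measurableType dS) (f1 f2 : S -> V) :
  measurable_fun [set: S] (f1 : S -> borel R d) ->
  measurable_fun [set: S] (f2 : S -> borel R d) ->
  measurable_fun [set: S] (fun s => gap k (f1 s) (f2 s)).
Proof.
by move=> m1 m2; exact: (stage_gap_measurable mu0 L0 nu0 g_convex g_smooth
  h_holder gam0 p_meas m1 m2 k).
Qed.

Let potential_measurable k t dS (S : measurableType dS) (f1 f2 : S -> V) :
  measurable_fun [set: S] (f1 : S -> borel R d) ->
  measurable_fun [set: S] (f2 : S -> borel R d) ->
  measurable_fun [set: S] (fun s => potential k t (f1 s) (f2 s)).
Proof.
move=> m1 m2; apply: measurable_funM => //.
apply: (sqr_dist_measurable _ m2).
exact: (stage_min_measurable mu0 L0 nu0 g_convex g_smooth h_holder gam0 p_meas m1).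
Qed.

Let Gsub J : hist sources J `<=` (measurable : set (set O)).
Proof. exact: hist_sub_measurable sources_meas _. Qed.

Let Omeasurable (J : set (option (nat * nat))) (f : O -> V) :
  Hmeasurable J f -> measurable_fun [set: O] (f : O -> borel R d).
Proof. by move=> mf; exact: (sub_measurable_fun (@Gsub J) mf). Qed.

Let x_measurable k : (1 <= k <= K.+1)%N -> measurable_fun [set: O] (x k : O -> borel R d).
Proof. by move=> kK; exact: Omeasurable (stage_measurable kK). Qed.

Let y_measurable k t : (1 <= k <= K)%N -> (1 <= t <= (T k).+1)%N ->
  measurable_fun [set: O] (y k t : O -> borel R d).
Proof.
case: t => // t kK tT.
exact: Omeasurable (inner_measurable kK (stage_measurable (stage_rangeW kK)) _).
Qed.

Lemma spg_step_expectation k t : (1 <= k <= K)%N -> (1 <= t <= T k)%N ->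
  (\int[P]_w (t.+1%:R * gap k (x k w) (y k t.+1 w))%:E
   + \int[P]_w (potential k t.+1 (x k w) (y k t.+1 w))%:E
   <= \int[P]_w (potential k t (x k w) (y k t w))%:E
      + (6 * G ^+ 2 / gam k)%:E)%E.
Proof.
move=> kK tT.
have k1 : (1 <= k)%N by case/andP: kK.
have mx : Hmeasurable (before k t) (x k).
  apply: (H_mono _ (stage_measurable (stage_rangeW kK))).
  by apply: before_le; case/andP: tT.
have my : Hmeasurable (before k t) (y k t).
  case: t tT mx => // t tT mx.
  by apply: (inner_measurable kK (stage_measurable (stage_rangeW kK))); exact: ltnW.
have tT1 : (1 <= t <= (T k).+1)%N by case/andP: tT => -> /leqW.
have tT2 : (1 <= t.+1 <= (T k).+1)%N by case/andP: tT.
have mxO := x_measurable (stage_rangeW kK).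
have myO := y_measurable kK tT1; have myO' := y_measurable kK tT2.
rewrite -ge0_integralD //; last 4 first.
- by move=> w _; rewrite lee_fin mulr_ge0.
- by apply/measurable_EFinP; apply: measurable_funM => //; exact: gap_measurable.
- by move=> w _; rewrite lee_fin.
- by apply/measurable_EFinP; exact: potential_measurable.
pose phi (u : ((borel R d * borel R d) * (X * Y))%type) : \bar R :=
  (t.+1%:R * gap k u.1.1 (next k t u.1.1 u.1.2 u.2)
   + potential k t.+1 u.1.1 (next k t u.1.1 u.1.2 u.2))%:E.
have mphi dS (S : measurableType dS) (f1 f2 : S -> V) f3 :
    measurable_fun [set: S] (f1 : S -> borel R d) ->
    measurable_fun [set: S] (f2 : S -> borel R d) ->
    measurable_fun [set: S] (f3 : S -> (X * Y)%type) ->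
    measurable_fun [set: S] (fun s => phi ((f1 s, f2 s), f3 s)).
  move=> m1 m2 m3; have m4 := next_measurable k t m1 m2 m3.
  apply/measurable_EFinP; apply: measurable_funD; last exact: potential_measurable.
  by apply: measurable_funM => //; exact: gap_measurable.
pose f (w : O) : (borel R d * borel R d)%type := (x k w, y k t w).
have mf : measurable_fun [set: H (before k t)]
    (f : H (before k t) -> (borel R d * borel R d)%type).
  exact: measurable_fun_pair mx my.
rewrite [leLHS](_ : _ = (\int[P]_w phi (f w, Z k t w))%E); last first.
  by apply: eq_integral => w _; rewrite /phi /f /= spg_iterate.
have ind B C : <<s hist sources (before k t) >> B -> measurable C ->
    P (B `&` Z k t @^-1` C) = (P B * P (Z k t @^-1` C))%E.
  move=> hB mC; rewrite [RHS]muleC.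
  apply: (indep_hist (spg_indep run) sources_meas sources_setT sources_setI
    (J := before k t) (i := Some (k, t))) => //.
    by move=> [k' [t' [[<- <-] [|[_]]]]]; rewrite ltnn.
  by exists C => //; rewrite setTI.
rewrite (ge0_integral_joint (@Gsub _) mf (spg_law run k t) ind); last 2 first.
- have m2 := @measurable_snd _ _ (borel R d * borel R d)%type (X * Y)%type.
  have m1 := @measurable_fst _ _ (borel R d * borel R d)%type (X * Y)%type.
  have := mphi _ _ (fun u : ((borel R d * borel R d) * (X * Y))%type => u.1.1)
    (fun u => u.1.2) (fun u => u.2)
    (measurableT_comp measurable_fst m1) (measurableT_comp measurable_snd m1) m2.
  by congr measurable_fun; apply/funext => -[[]].
- move=> u; rewrite lee_fin.
  exact: addr_ge0 (mulr_ge0 (ler0n _ _) (gap_ge0 _ _ _)) (potential_ge0 _ _ _ _).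
apply: (@le_trans _ _ (\int[P]_w ((potential k t (x k w) (y k t w))%:E
    + (6 * G ^+ 2 / gam k)%:E))%E).
  apply: ge0_le_integral_nonmeas => w.
    apply: integral_ge0 => u _; rewrite lee_fin.
    exact: addr_ge0 (mulr_ge0 (ler0n _ _) (gap_ge0 _ _ _)) (potential_ge0 _ _ _ _).
  rewrite -EFinD.
  apply: (spg_next_expectation mu0 L0 (gamL k1) g_convex g_smooth
    Dg_centered Dh_centered Dg_var Dh_var); first by case/andP: tT.
  exact: (mphi _ _ (cst (x k w)) (cst (y k t w)) id).
rewrite ge0_integralD //; last 3 first.
- by move=> w _; rewrite lee_fin.
- by apply/measurable_EFinP; exact: potential_measurable.
- by move=> w _; rewrite lee_fin divr_ge0 // mulr_ge0 // sqr_ge0.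
by rewrite integral_cst // [X in (_ + _ * X)%E](_ : _ = 1%E) ?mule1 //; exact: probability_setT.
Qed.

Definition spg_error : R := 4 * G ^+ 2 / L.

Lemma spg_error_ge0 : 0 <= spg_error.
Proof. by rewrite divr_ge0 ?(ltW L0) // mulr_ge0 // sqr_ge0. Qed.

Let output_gap_le k w : (1 <= k <= K)%N ->
  gap k (x k w) (x k.+1 w) <= ((T k)%:R * ((T k)%:R + 3) / 2)^-1 *
    \sum_(1 <= t < (T k).+1) t.+1%:R * gap k (x k w) (y k t.+1 w).
Proof.
move=> kK; have s0 : 0 < modulus k by exact: stage_modulus_gt0.
have TR : 0 < (T k)%:R :> R by rewrite ltr0n; exact: leq_trans (T3 k).
have W0 : 0 < (T k)%:R * ((T k)%:R + 3) / 2 :> R.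
  by rewrite divr_gt0 // mulr_gt0 // addr_gt0.
rewrite ler_pdivlMl // -sum_weights.
have := qobj_convex (slope k (x k w)) s0 g_convex g_smooth
  (r := index_iota 2 (T k).+2) (w := fun t => t%:R) (y := fun t => y k t w)
  (m := x k.+1 w) (fun t => ler0n _ t).
rewrite sum_weights gt_eqF // -sum_weights => /(_ isT (spg_output run w kK)).
set W := \sum_(2 <= t < _) _ => hW.
have <- : \sum_(2 <= t < (T k).+2) t%:R * gap k (x k w) (y k t w) =
    \sum_(1 <= t < (T k).+1) t.+1%:R * gap k (x k w) (y k t.+1 w).
  by rewrite big_add1.
rewrite /stage_gap; under [leRHS]eq_bigr do rewrite mulrBr.
rewrite sumrB -mulr_suml -/W mulrBr lerB //.
Qed.

Lemma spg_gap_next_le k : (1 <= k <= K)%N ->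
  (\int[P]_w (gap k (x k w) (x k.+1 w))%:E <=
   2^-1%:E * \int[P]_w (gap k (x k w) (x k w))%:E + (spg_error / k%:R)%:E)%E.
Proof.
move=> kK; have k1 : (1 <= k)%N by case/andP: kK.
have mx := x_measurable (stage_rangeW kK).
have s0 : 0 < modulus k by exact: stage_modulus_gt0.
have g0 := gam_gt0 k1.
set TR := (T k)%:R : R.
have T3R : 3 <= TR by rewrite /TR (ler_nat _ 3).
have TR0 : 0 < TR by apply: lt_le_trans T3R.
pose W := TR * (TR + 3) / 2.
have W0 : 0 < W by rewrite divr_gt0 // mulr_gt0 // addr_gt0.
pose a t := (\int[P]_w (t.+1%:R * gap k (x k w) (y k t.+1 w))%:E)%E.
pose b t := (\int[P]_w (potential k t (x k w) (y k t w))%:E)%E.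
have a0 t : (0 <= a t)%E by apply: integral_ge0 => w _; rewrite lee_fin mulr_ge0.
have b0 t : (0 <= b t)%E by apply: integral_ge0 => w _; rewrite lee_fin.
have tel := ge0_telescope a0 (fun t tT => spg_step_expectation kK tT).
rewrite -/b in tel.
have b1 : (b 1%N <= (4 / 3)%:E * \int[P]_w (gap k (x k w) (x k w))%:E)%E.
  have mg := gap_measurable k mx mx.
  rewrite -ge0_integralZl //; last 2 first.
  - exact/measurable_EFinP.
  - by move=> w _; rewrite lee_fin.
  apply: ge0_le_integral_nonmeas => w; first by rewrite lee_fin.
  rewrite -EFinM lee_fin (spg_stage_init run w kK).
  have h1 : modulus k / 2 * dotr (x k w - stage_min g h mu p gam k (x k w))
      (x k w - stage_min g h mu p gam k (x k w)) <= gap k (x k w) (x k w).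
    exact: (qobj_qmin_lower _ L0 s0 g_convex g_smooth).
  rewrite /spg_potential -/(stage_min g h mu p gam k (x k w)).
  have N0 := dotr_ge0 (x k w - stage_min g h mu p gam k (x k w)).
  move: (dotr _ _) N0 h1 => N N0 h1.
  have h2 : gam k * N <= modulus k * N.
    by rewrite ler_wpM2r // /stage_modulus lerDr invr_ge0 ltW.
  lra.
have SW : (\sum_(1 <= t < (T k).+1) a t <=
    (4 / 3)%:E * \int[P]_w (gap k (x k w) (x k w))%:E + (TR * (6 * G ^+ 2 / gam k))%:E)%E.
  apply: le_trans (leeD2r _ b1); apply: le_trans tel.
  by rewrite leeDl //; exact: b0.
have iW0 : 0 <= W^-1 by rewrite invr_ge0 ltW.
have my t : (t < (T k).+1)%N -> measurable_fun [set: O] (y k t.+1 : O -> borel R d).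
  by move=> tT; apply: y_measurable.
pose wgap t w := if (t < (T k).+1)%N then t.+1%:R * gap k (x k w) (y k t.+1 w) else 0.
have mY t : measurable_fun [set: O] (fun w => (wgap t w)%:E).
  apply/measurable_EFinP; rewrite /wgap; case tT : (t < (T k).+1)%N => //.
  by apply: measurable_funM => //; exact: gap_measurable mx (my t tT).
have Y0 t w : (0 <= (wgap t w)%:E)%E.
  by rewrite lee_fin /wgap; case: ifP => // _; rewrite mulr_ge0.
apply: (@le_trans _ _ (W^-1%:E * \sum_(1 <= t < (T k).+1) a t)%E).
  have -> : (\sum_(1 <= t < (T k).+1) a t =
      \int[P]_w (\sum_(1 <= t < (T k).+1) (wgap t w)%:E))%E.
    rewrite ge0_integral_sum // big_nat [RHS]big_nat.
    apply: eq_bigr => t /andP[_ tT]; rewrite /a.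
    by apply: eq_integral => w _; rewrite /wgap tT.
  rewrite -ge0_integralZl //; last 2 first.
  - exact: emeasurable_sum.
  - by move=> w _; exact: sume_ge0.
  apply: ge0_le_integral_nonmeas => w; first by rewrite lee_fin.
  rewrite sumEFin -EFinM lee_fin; apply: (le_trans (output_gap_le w kK)).
  rewrite -/W ler_wpM2l // big_nat [leRHS]big_nat; apply: ler_sum => t /andP[_ tT].
  by rewrite /wgap tT.
apply: (le_trans (lee_wpmul2l _ SW)); first by rewrite lee_fin.
have h1 : W^-1 * (4 / 3) <= 2^-1.
  rewrite ler_pdivrMl // /W; nra.
have h2 : W^-1 * (TR * (6 * G ^+ 2 / gam k)) <= spg_error / k%:R.
  rewrite ler_pdivrMl // /W /spg_error.
  have kR : 0 < k%:R :> R by rewrite ltr0n.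
  have hT : 3 * L * k%:R <= gam k * (TR + 3).
    by apply: (le_trans (gamT k1)); rewrite -/TR ler_wpM2l ?(ltW g0) // lerDl.
  rewrite [leLHS](_ : _ = TR * G ^+ 2 * 2 / (gam k * L * k%:R) * (3 * L * k%:R)); last first.
    by field; rewrite !gt_eqF.
  rewrite [leRHS](_ : _ = TR * G ^+ 2 * 2 / (gam k * L * k%:R) * (gam k * (TR + 3))); last first.
    by field; rewrite !gt_eqF.
  rewrite ler_wpM2l // divr_ge0 //; last by rewrite !mulr_ge0 // ltW.
  by rewrite mulr_ge0 // mulr_ge0 ?sqr_ge0 // ltW.
have E0 : (0 <= \int[P]_w (gap k (x k w) (x k w))%:E)%E.
  by apply: integral_ge0 => w _; rewrite lee_fin.
rewrite ge0_muleDr; last 2 first.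
- by rewrite mule_ge0 // lee_fin.
- by rewrite lee_fin mulr_ge0 ?(ltW TR0) // divr_ge0 ?(ltW g0) // mulr_ge0 // sqr_ge0.
rewrite muleA -!EFinM leeD //.
by apply: lee_wpmul2r => //; rewrite lee_fin.
Qed.

Lemma spg_stage_control : exists S : set (set O),
  stage_control g h r alpha mu p gam K tau x m Delta spg_error S.
Proof.
pose J : set (option (nat * nat)) := [set i | isSome i].
have JJ k t : before k t `<=` J by move=> _ [k' [t' [-> _]]].
have mx k : (1 <= k <= K.+1)%N -> Hmeasurable J (x k).
  by move=> kK; exact: H_mono (@JJ _ _) (stage_measurable kK).
exists (hist sources J); split.
- exact: (spg_tau run).
- exact: Gsub.
- move=> C B hB; rewrite [RHS]muleC; apply: (indep_hist (spg_indep run) sources_meas sources_setT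
    sources_setI (J := J) (i := None)) => //=.
  by exists C => //; rewrite setTI.
- move=> k kK; apply: (sobj_measurable r_lsc g_smooth p_meas (mx k kK) h_holder.1 p_prox).
- by move=> k kK; apply: gap_measurable; apply: mx; exact: stage_rangeW.
- by move=> k kK; apply: gap_measurable; apply: mx; [exact: stage_rangeW|exact: stage_rangeS].
- move=> k kK; apply: (sqr_dist_measurable (mx k (stage_rangeW kK)) (mx k.+1 (stage_rangeS kK))).
- move=> k kK; exact: (residual_measurable p_meas (mx k (stage_rangeW kK))).
- move=> k kK; apply: le_trans (standing kK).
  rewrite le_eqVlt; apply/orP; left; apply/eqP; apply: eq_integral => w _.
  by rewrite (smoothed_objectiveE g h r_proper p_prox) EFinB.
- by move=> k kK; exact: spg_gap_next_le.
Qed.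

End spg_control.

(** * Assembly *)

Lemma nearly_critical_le (R : realType) d (g h : 'rV[R]_d -> R)
    (r : 'rV[R]_d -> \bar R) p (nu B B' eps : R) dO (O : measurableType dO)
    (P : probability O R) (xtau : O -> 'rV[R]_d) : 0 <= eps -> B <= B' ->
  nearly_critical g h r p nu B eps P xtau -> nearly_critical g h r p nu B' eps P xtau.
Proof.
move=> e0 BB [h1 h2]; split; [apply: (le_trans h1)|apply: (le_trans h2)];
  by rewrite lee_fin ler_wpM2r ?powR_ge0.
Qed.

Section spg_assembly.
Context {R : realType} {d : nat}.
Local Notation V := 'rV[R]_d.
Variables (g h : V -> R) (r : V -> \bar R) (L nu alpha Delta : R) (x1 : V).
Hypotheses (L0 : 0 < L) (nu0 : 0 < nu).
Hypothesis Delta0 : 0 < Delta.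
Hypothesis g_convex : convex_lsc g.
Hypotheses (g_smooth : smooth L g) (h_holder : holder_grad L nu h).
Hypotheses (r_proper : proper r) (r_lsc : lower_semicontinuous r).
Context dX (X : measurableType dX) dY (Y : measurableType dY).
Variables (QX : probability X R) (QY : probability Y R).
Variables (gs : V -> X -> R) (hs : V -> Y -> R).
Variables (Dg : V -> X -> V) (Dh : V -> Y -> V) (G : R).
Hypothesis Dg_unbiased : unbiased_oracle QX g gs Dg.
Hypothesis Dh_unbiased : unbiased_oracle QY h hs Dh.
Hypothesis variance : forall x, (\int[QX \x QY]_z
     (enorm ((Dg x z.1 - Dh x z.2) -
             vexp (QX \x QY)%E (fun z' => Dg x z'.1 - Dh x z'.2)) ^+ 2)%:E
   <= (G ^+ 2)%:E)%E.
Variable b : R.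
Hypotheses (b0 : 0 <= b) (b1 : b <= 1).

Let gam := fun k : nat => 3 * L * k%:R `^ b.
Let T := spg_iters L gam.

Let Dg_centered y : centered QX (fun s => Dg y s - grad g y).
Proof. exact: unbiased_centered Dg_unbiased. Qed.

Let Dh_centered y : centered QY (fun s => Dh y s - grad h y).
Proof. exact: unbiased_centered Dh_unbiased. Qed.

Let joint_var y : exists k : V, (\int[QX \x QY]_z
   (dotr ((Dg y z.1 - grad g y) - (Dh y z.2 - grad h y) - k)
         ((Dg y z.1 - grad g y) - (Dh y z.2 - grad h y) - k))%:E <= (G ^+ 2)%:E)%E.
Proof.
exists (vexp (QX \x QY)%E (fun z' => Dg y z'.1 - Dh y z'.2) - grad g y + grad h y).
apply: le_trans (variance y); rewrite le_eqVlt; apply/orP; left; apply/eqP.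
apply: eq_integral => z _; rewrite sqr_enorm.
set v := vexp _ _; congr ((dotr _ _)%:E); apply/rowP => i; rewrite !mxE; ring.
Qed.

Let Dg_var y : (\int[QX]_s
  (dotr (Dg y s - grad g y) (Dg y s - grad g y))%:E <= (G ^+ 2)%:E)%E.
Proof.
have [k hk] := joint_var y.
exact: le_trans (joint_variance_fst k (Dg_centered y) (Dh_centered y)) hk.
Qed.

Let Dh_var y : (\int[QY]_s
  (dotr (Dh y s - grad h y) (Dh y s - grad h y))%:E <= (G ^+ 2)%:E)%E.
Proof.
have [k hk] := joint_var y.
exact: le_trans (joint_variance_snd k (Dg_centered y) (Dh_centered y)) hk.
Qed.

Let gam0 k : 0 <= gam k.
Proof. by rewrite mulr_ge0 ?powR_ge0 // mulr_ge0 // ltW. Qed.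

Let gamL k : (1 <= k)%N -> 3 * L <= gam k.
Proof.
move=> k1; rewrite ler_peMr ?mulr_ge0 ?(ltW L0) //.
by have := ler_powR_nat b0 k1; rewrite powR1.
Qed.

Let ratio0 k : 0 <= 3 * L * k%:R / gam k.
Proof. by rewrite divr_ge0 // mulr_ge0 // mulr_ge0 // ltW. Qed.

Let T_ge k : 3 * L * k%:R / gam k + 3 <= (T k)%:R.
Proof. by rewrite natceil_ge // addr_ge0. Qed.

Let T3 k : (3 <= T k)%N.
Proof.
have : 3 <= (T k)%:R :> R.
  by have := ratio0 k; have := T_ge k; set u := _ / _; lra.
by rewrite (ler_nat R 3).
Qed.

Let gamT k : (1 <= k)%N -> 3 * L * k%:R <= gam k * (T k)%:R.
Proof.
move=> k1; have g0 : 0 < gam k by apply: lt_le_trans (gamL k1); rewrite mulr_gt0.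
by rewrite [leRHS]mulrC -ler_pdivrMr //; have := T_ge k; set u := _ / _; lra.
Qed.

Lemma spg_control (mu m : R) (K : nat) (p : V -> V) : 0 < mu ->
  measurable_fun [set: borel R d] (p : borel R d -> borel R d) ->
  (forall x, is_prox mu r x (p x)) ->
  forall dO (O : measurableType dO) (P : probability O R)
    (Z : nat -> nat -> {RV P >-> (X * Y)%type}) (tau : {RV P >-> nat})
    (x : nat -> O -> V) (y : nat -> nat -> O -> V),
    spg_run p mu alpha gam T K x1 QX QY Dg Dh Z tau x y ->
    (forall k, (1 <= k <= K)%N ->
      (\int[P]_w (smoothed_objective g h r mu (x k w) - m%:E) <= Delta%:E)%E) ->
  exists S : set (set O),
    stage_control g h r alpha mu p gam K tau x m Delta (spg_error L G) S.
Proof.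
move=> mu0 p_meas p_prox dO O P Z tau x y run standing.
have [_ _ Dg_meas _ _] := Dg_unbiased; have [_ _ Dh_meas _ _] := Dh_unbiased.
exact: (spg_stage_control r_proper r_lsc mu0 L0 nu0 g_convex g_smooth
  h_holder p_meas p_prox gam0 gamL T3 gamT Dg_meas Dh_meas Dg_centered Dh_centered
  Dg_var Dh_var run standing).
Qed.

Lemma spg_iterations_le (K : nat) :
  (\sum_(1 <= k < K.+1) T k)%:R <= 5 * K%:R `^ (2 - b).
Proof.
case: K => [|K]; first by rewrite big_nil mulr_ge0 ?powR_ge0.
rewrite natr_sum.
have K1 : 1 <= K.+1%:R :> R by rewrite ler1n.
have KP : 1 <= K.+1%:R `^ (1 - b).
  by have := @ler_powR_nat R 1 K.+1 (1 - b); rewrite powR1; apply; rewrite ?subr_ge0.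
apply: (@le_trans _ _ (\sum_(1 <= k < K.+2) 5 * K.+1%:R `^ (1 - b))).
  rewrite big_nat [leRHS]big_nat; apply: ler_sum => k /andP[k1 kK].
  apply: (le_trans (natceil_le _)); first by rewrite addr_ge0.
  have kR : 0 < k%:R :> R by rewrite ltr0n.
  have -> : 3 * L * k%:R / gam k = k%:R `^ (1 - b).
    rewrite powRB ?powRr1 ?(ltW kR) //; last by apply/implyP => _; rewrite gt_eqF.
    by rewrite /gam; field; rewrite !gt_eqF // powR_gt0.
  have : k%:R `^ (1 - b) <= K.+1%:R `^ (1 - b) by apply: ler_powR_nat; rewrite ?subr_ge0.
  lra.
rewrite sumr_const_nat subSS subn0 -[leLHS]mulr_natl.
rewrite mulrCA ler_wpM2l // (_ : 2 - b = 1 + (1 - b)); last by ring.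
by rewrite [leRHS]powRD ?powRr1 //; apply/implyP => _; rewrite pnatr_eq0.
Qed.

Lemma spg_conclusion (C q : R) (a : nat) : 0 < C -> 0 <= q ->
  control_suffices g h r nu alpha C q b (3 * L) a x1 ->
  exists B : R, forall eps : R, 0 < eps < 1 ->
    let K := natceil (C * (1 / eps) `^ q) in
    [/\ spg_guarantee g h r nu alpha Delta x1 QX QY Dg Dh gam T K (eps ^+ a) B eps,
        (\sum_(1 <= k < K.+1) T k)%:R <= B * K%:R `^ (2 - b) &
        (\sum_(1 <= k < K.+1) T k)%:R <= B * (1 / eps) `^ (q * (2 - b))].
Proof.
move=> C0 q0 suff.
have [B1 HB1] := suff _ _ (ltW Delta0) (spg_error_ge0 L0 G).
pose D := (C + 1) `^ (2 - b); have D0 : 0 <= D by exact: powR_ge0.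
have b2 : 0 <= 2 - b by have := b1; lra.
exists (`|B1| + 5 + 5 * D) => eps eps01 K; have [e0 _] := andP eps01.
have N0 : 0 <= `|B1| by [].
split.
- move=> p p_meas p_prox dO O P Z tau x y run [m hm standing].
  have [S sc] := spg_control (exprn_gt0 a e0) p_meas p_prox run standing.
  apply: nearly_critical_le (ltW e0) _ (HB1 _ _ _ _ _ _ _ _ _ eps01 p_prox hm (spg_init run) sc).
  by have := ler_norm B1; lra.
- apply: (le_trans (spg_iterations_le K)).
  by rewrite ler_wpM2r ?powR_ge0 //; lra.
- apply: (le_trans (spg_iterations_le K)).
  apply: (@le_trans _ _ (5 * (D * (1 / eps) `^ (q * (2 - b))))).
    by rewrite ler_wpM2l //; exact: stages_powR_le.
  by rewrite mulrA ler_wpM2r ?powR_ge0 //; lra.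
Qed.

End spg_assembly.

Section svrg_assembly.
Context {R : realType} {d : nat}.
Local Notation V := 'rV[R]_d.
Variables (g h : V -> R) (r : V -> \bar R) (L nu alpha Delta : R) (x1 : V).
Hypothesis L0 : 0 < L.
Hypothesis Delta0 : 0 < Delta.
Hypotheses (g_convex : convex_lsc g) (h_convex : convex_lsc h).
Hypotheses (g_smooth : smooth L g) (h_holder : holder_grad L nu h).
Hypotheses (r_proper : proper r).
Variables (b c C q : R) (a : nat).
Hypotheses (b0 : 0 <= b) (c0 : 0 < c) (C0 : 0 < C) (q0 : 0 <= q) (a0 : (0 < a)%N).

Let gam := fun k : nat => c * k%:R `^ b.
Let S := svrg_epochs R.
Let K := fun eps : R => natceil (C * (1 / eps) `^ q).

Let gam0 k : 0 <= gam k.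
Proof. by rewrite mulr_ge0 ?powR_ge0 // ltW. Qed.

Let ln2 : 0 < ln 2 :> R. Proof. by rewrite ln_gt0 // ltr1n. Qed.

Let S0 k : (2 <= k)%N -> (0 < S k)%N.
Proof.
by move=> k2; rewrite /S /svrg_epochs natceil_gt0 // divr_gt0 // ln_gt0 // ltr1n.
Qed.

Section run.
Variables (n1 : nat) (gs : 'I_n1 -> V -> R) (T : nat -> nat).
Hypothesis gs_smooth : forall i, smooth L (gs i).
Hypothesis T_ge : forall k, (1 <= k)%N -> svrg_iters_lb L gam k <= (T k)%:R.

Let T0 k : (1 <= k)%N -> (0 < T k)%N.
Proof.
move=> k1; rewrite -(ltr_nat R); apply: lt_le_trans (T_ge k1).
by rewrite /svrg_iters_lb lt_max ltr0n.
Qed.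

(* Below this threshold for [eps] the modulus [1 / eps ^+ a] of the subproblems
   dominates [L], which makes SVRG a contraction; above it there are at most
   [svrg_kmax] stages. *)
Definition svrg_threshold : R := (100 * L + 1)^-1.
Definition svrg_kmax : nat := K svrg_threshold.

Lemma svrg_control (eps m : R) (p : V -> V) : 0 < eps < 1 ->
  (forall x, is_prox (eps ^+ a) r x (p x)) ->
  forall dO (O : measurableType dO) (P : probability O R)
    (I : nat -> nat -> nat -> O -> 'I_n1) (tau : {RV P >-> nat})
    (x : nat -> O -> V) (xb : nat -> nat -> O -> V) (xi : nat -> nat -> nat -> O -> V),
    svrg_run g h gs p L (eps ^+ a) alpha gam T S (K eps) x1 I tau x xb xi ->
    attains_min (smoothed_objective g h r (eps ^+ a)) m ->
    (smoothed_objective g h r (eps ^+ a) x1 - m%:E <= Delta%:E)%E ->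
  exists G : set (set O), stage_control g h r alpha (eps ^+ a) p gam (K eps) tau x m
    (svrg_bound L T S Delta svrg_kmax) (svrg_error L T S Delta svrg_kmax) G.
Proof.
move=> eps01 p_prox dO O P I tau x xb xi run hm start.
have [e0 e1] := andP eps01.
have mu0 : 0 < eps ^+ a by rewrite exprn_gt0.
have mu1 : eps ^+ a <= 1 by rewrite exprn_ile1 // ltW.
have LL : 0 < 100 * L + 1 by rewrite addr_gt0 // mulr_gt0.
have th0 : 0 < svrg_threshold by rewrite invr_gt0.
have regime : 100 * L <= (eps ^+ a)^-1 \/ (K eps <= svrg_kmax)%N.
  have [small|large] := leP eps svrg_threshold; [left|right].
    apply: (@le_trans _ _ eps^-1).
      apply: (@le_trans _ _ (100 * L + 1)); first by rewrite lerDl.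
      by rewrite -[leLHS]invrK lef_pV2 ?posrE.
    by rewrite lef_pV2 ?posrE // -[leRHS]expr1 ler_wiXn2l // ltW.
  rewrite /svrg_kmax /K /natceil -lez_nat.
  have c1 (s : R) : 0 < s -> (0 <= Num.ceil (C * (1 / s) `^ q)).
    move=> s0; rewrite ceil_ge0 (@lt_le_trans _ _ 0) ?ltrN10 //.
    by rewrite mulr_ge0 ?powR_ge0 // ltW.
  rewrite !gez0_abs ?c1 // le_ceil // ler_wpM2l ?(ltW C0) // ge0_ler_powR ?nnegrE //.
  - by rewrite divr_ge0 // ltW.
  - by rewrite divr_ge0 // ltW.
  - by rewrite !div1r lef_pV2 ?posrE // ltW.
eexists; exact: (svrg_stage_control r_proper mu0 mu1 L0 g_convex h_convex g_smooth
  h_holder p_prox gam0 gs_smooth T0 S0 run hm start regime).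
Qed.

End run.

Let S_le k eps : 0 < eps < 1 -> (1 <= k <= K eps)%N ->
  (S k)%:R <= (1 + (ln (C + 1) + q) / ln 2) * (1 + ln (1 / eps)).
Proof.
move=> eps01 /andP[k1 kK]; have [e0 e1] := andP eps01.
have kR : 1 <= k%:R :> R by rewrite ler1n.
have le0 : 0 <= ln (1 / eps) by rewrite ln_ge0 // div1r invf_ge1 // ltW.
have lC : 0 <= ln (C + 1) by rewrite ln_ge0 // lerDr ltW.
apply: (le_trans (natceil_le _)); first exact: divr_ge0 (ln_ge0 kR) (ltW ln2).
have : ln k%:R <= ln (C + 1) + q * ln (1 / eps).
  rewrite -ln_powR -lnM ?posrE ?powR_gt0 ?divr_gt0 ?addr_gt0 //.
  rewrite ler_ln ?posrE ?mulr_gt0 ?powR_gt0 ?divr_gt0 ?addr_gt0 ?ltr0n //.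
  by apply: le_trans (stages_le C0 q0 eps01); rewrite ler_nat.
move=> h1.
have h2 : ln k%:R / ln 2 <= (ln (C + 1) + q * ln (1 / eps)) / ln 2.
  by rewrite ler_wpM2r // invr_ge0 ltW.
have h3 : (ln (C + 1) + q * ln (1 / eps)) / ln 2 <=
    (ln (C + 1) + q) / ln 2 * (1 + ln (1 / eps)).
  rewrite mulrAC ler_wpM2r ?invr_ge0 ?(ltW ln2) // mulrDr mulr1 mulrDl.
  have := mulr_ge0 lC le0; have := q0; lra.
have h4 : 0 <= (ln (C + 1) + q) / ln 2 by rewrite divr_ge0 ?addr_ge0 // ltW.
nra.
Qed.

Lemma svrg_complexity (M : R) : exists B' : R, forall (n1 n2 : nat) (T : nat -> nat),
  (0 < n1)%N ->
  (forall k, (1 <= k)%N -> (T k)%:R <= M * svrg_iters_lb L gam k) ->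
  forall eps : R, 0 < eps < 1 ->
    (\sum_(1 <= k < (K eps).+1) (n1 + n2 + T k) * S k)%N%:R
      <= B' * (1 + ln (1 / eps)) ^+ 1 * ((n1 + n2)%:R * (1 / eps) `^ q).
Proof.
pose MT := `|M| * (2 + 200 * L / c).
pose s0 := 1 + (ln (C + 1) + q) / ln 2.
exists ((C + 1) * (1 + MT) * s0) => n1 n2 T n10 T_le eps eps01; rewrite expr1.
have [e0 e1] := andP eps01.
have lc0 : 0 <= 200 * L / c by rewrite divr_ge0 ?mulr_ge0 // ltW.
have MT0 : 0 <= MT by rewrite mulr_ge0 // addr_ge0.
have N1 : 1 <= (n1 + n2)%:R :> R by rewrite ler1n addn_gt0 n10.
have s00 : 0 <= s0.
  by rewrite addr_ge0 // divr_ge0 ?(ltW ln2) // addr_ge0 // ln_ge0 // lerDr ltW.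
have l0 : 0 <= ln (1 / eps) by rewrite ln_ge0 // div1r invf_ge1 // ltW.
set l := 1 + ln (1 / eps); have l1 : 0 <= l by rewrite addr_ge0.
rewrite natr_sum.
apply: (@le_trans _ _ (\sum_(1 <= k < (K eps).+1) ((n1 + n2)%:R * (1 + MT)) * (s0 * l))).
  rewrite big_nat [leRHS]big_nat; apply: ler_sum => k /andP[k1 kK].
  have kK' : (1 <= k <= K eps)%N by rewrite k1.
  rewrite natrM ler_pM //; last exact: S_le.
  rewrite natrD mulrDr mulr1 lerD2l.
  apply: (@le_trans _ _ MT); last by rewrite ler_peMl.
  apply: (le_trans (T_le k k1)).
  have lb0 : 0 <= svrg_iters_lb L gam k by rewrite /svrg_iters_lb le_max ler0n.
  apply: (@le_trans _ _ (`|M| * svrg_iters_lb L gam k)).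
    by rewrite ler_wpM2r // ler_norm.
  rewrite ler_wpM2l // /svrg_iters_lb ge_max; apply/andP; split; first by rewrite lerDl.
  apply: (@le_trans _ _ (200 * L / c)); last by rewrite lerDr.
  rewrite ler_wpM2l ?mulr_ge0 ?(ltW L0) // lef_pV2 ?posrE //.
    by rewrite /gam ler_peMr ?(ltW c0) //; have := ler_powR_nat b0 k1; rewrite powR1.
  by rewrite /gam mulr_gt0 // powR_gt0 // ltr0n.
rewrite sumr_const_nat subSS subn0 -[leLHS]mulr_natl.
have h1 := stages_le C0 q0 eps01; rewrite -/(K eps) in h1.
rewrite [leRHS](_ : _ = (C + 1) * (1 / eps) `^ q * ((n1 + n2)%:R * (1 + MT) * (s0 * l))); last by ring.
by rewrite ler_wpM2r // !mulr_ge0 // addr_ge0.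
Qed.

Lemma svrg_conclusion (M : R) :
  control_suffices g h r nu alpha C q b c a x1 ->
  exists (B' : R) (m : nat),
  forall (n1 n2 : nat) (gs : 'I_n1 -> V -> R) (hs : 'I_n2 -> V -> R),
    finite_sum g gs -> finite_sum h hs -> (forall i, smooth L (gs i)) ->
  forall T : nat -> nat,
    (forall k, (1 <= k)%N -> svrg_iters_lb L gam k <= (T k)%:R) ->
    (exists B : R, forall eps : R, 0 < eps < 1 ->
       svrg_guarantee g h r L nu alpha Delta x1 gs gam T S (K eps)
         (eps ^+ a) B eps) /\
    ((forall k, (1 <= k)%N -> (T k)%:R <= M * svrg_iters_lb L gam k) ->
     forall eps : R, 0 < eps < 1 ->
       (\sum_(1 <= k < (K eps).+1) (n1 + n2 + T k) * S k)%N%:R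
         <= B' * (1 + ln (1 / eps)) ^+ m * ((n1 + n2)%:R * (1 / eps) `^ q)).
Proof.
move=> suff; have [B' HB'] := svrg_complexity M.
exists B', 1%N => n1 n2 gs hs [n10 _] _ gs_smooth T T_ge; split; last first.
  by move=> T_le; exact: HB'.
have bound0 : 0 <= svrg_bound L T S Delta svrg_kmax.
  exact: le_trans (ltW Delta0) (svrg_bound_ge T S svrg_kmax L0 (ltW Delta0)).
have error0 : 0 <= svrg_error L T S Delta svrg_kmax.
  exact: svrg_error_ge0 (ltW Delta0).
have [B HB] := suff _ _ bound0 error0.
exists B => eps eps01 p p_prox dO O P I tau x xb xi run [m hm start].
have [G sc] := svrg_control gs_smooth T_ge eps01 p_prox run hm start.
exact: (HB _ _ _ _ _ _ _ _ _ eps01 p_prox hm (svrg_init run) sc).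
Qed.

End svrg_assembly.

Theorem theorem14 (R : realType) (d : nat) (g h : 'rV[R]_d -> R)
    (r : 'rV[R]_d -> \bar R) (L nu alpha Delta : R) (x1 : 'rV[R]_d)
    (L_gt0 : 0 < L) (nu_gt0 : 0 < nu) (nu_le1 : nu <= 1)
    (alpha_ge1 : 1 <= alpha) (Delta_gt0 : 0 < Delta)
    (g_convex : convex_lsc g) (h_convex : convex_lsc h)
    (g_smooth : smooth L g) (h_holder : holder_grad L nu h)
    (r_proper : proper r) (r_lsc : lower_semicontinuous r) :
  (* (a) *)
  (lipschitz_reg r ->
   forall dX (X : measurableType dX) dY (Y : measurableType dY)
     (QX : probability X R) (QY : probability Y R)
     (gs : 'rV[R]_d -> X -> R) (hs : 'rV[R]_d -> Y -> R)
     (Dg : 'rV[R]_d -> X -> 'rV[R]_d) (Dh : 'rV[R]_d -> Y -> 'rV[R]_d),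
     stochastic_gradient QX g gs Dg -> stochastic_subgradient QY h hs Dh ->
     bounded_variance QX QY Dg Dh ->
   forall C : R, 0 < C ->
   let gam := fun k : nat => 3 * L * k%:R `^ (1 / 3) in
   let T := spg_iters L gam in
   exists B : R, forall eps : R, 0 < eps < 1 ->
     let K := natceil (C * (1 / eps) `^ (3 * (1 + nu) / 2)) in
     [/\ spg_guarantee g h r nu alpha Delta x1 QX QY Dg Dh gam T K eps B eps,
         (\sum_(1 <= k < K.+1) T k)%:R <= B * K%:R `^ (5 / 3) &
         (\sum_(1 <= k < K.+1) T k)%:R
           <= B * (1 / eps) `^ (5 * (1 + nu) / 2)]) /\
  (* (b) *)
  (finite_lower_bounded r ->
   forall dX (X : measurableType dX) dY (Y : measurableType dY)
     (QX : probability X R) (QY : probability Y R)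
     (gs : 'rV[R]_d -> X -> R) (hs : 'rV[R]_d -> Y -> R)
     (Dg : 'rV[R]_d -> X -> 'rV[R]_d) (Dh : 'rV[R]_d -> Y -> 'rV[R]_d),
     stochastic_gradient QX g gs Dg -> stochastic_subgradient QY h hs Dh ->
     bounded_variance QX QY Dg Dh ->
   forall C : R, 0 < C ->
   let gam := fun k : nat => 3 * L * k%:R `^ (1 / 2) in
   let T := spg_iters L gam in
   exists B : R, forall eps : R, 0 < eps < 1 ->
     let K := natceil (C * (1 / eps) `^ (4 * (2 + nu) / 3)) in
     [/\ spg_guarantee g h r nu alpha Delta x1 QX QY Dg Dh gam T K
           (eps ^+ 2) B eps,
         (\sum_(1 <= k < K.+1) T k)%:R <= B * K%:R `^ (3 / 2) &
         (\sum_(1 <= k < K.+1) T k)%:R <= B * (1 / eps) `^ (2 * (2 + nu))]) /\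
  (* (c) *)
  (lipschitz_reg r ->
   forall c C M : R, 0 < c -> 0 < C ->
   let gam := fun k : nat => c * k%:R `^ (1 / 3) in
   let S := svrg_epochs R in
   let K := fun eps : R => natceil (C * (1 / eps) `^ (3 * (1 + nu) / 2)) in
   exists (B' : R) (m : nat),
   forall (n1 n2 : nat) (gs : 'I_n1 -> 'rV[R]_d -> R)
     (hs : 'I_n2 -> 'rV[R]_d -> R),
     finite_sum g gs -> finite_sum h hs -> (forall i, smooth L (gs i)) ->
   forall T : nat -> nat,
     (forall k, (1 <= k)%N -> svrg_iters_lb L gam k <= (T k)%:R) ->
     (exists B : R, forall eps : R, 0 < eps < 1 ->
        svrg_guarantee g h r L nu alpha Delta x1 gs gam T S (K eps)
          eps B eps) /\
     ((forall k, (1 <= k)%N -> (T k)%:R <= M * svrg_iters_lb L gam k) ->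
      forall eps : R, 0 < eps < 1 ->
        (\sum_(1 <= k < (K eps).+1) (n1 + n2 + T k) * S k)%N%:R
          <= B' * (1 + ln (1 / eps)) ^+ m
             * ((n1 + n2)%:R * (1 / eps) `^ (3 * (1 + nu) / 2)))) /\
  (* (d) *)
  (finite_lower_bounded r \/ level_bounded_reg g h r ->
   forall c C M : R, 0 < c -> 0 < C ->
   let gam := fun k : nat => c * k%:R `^ (1 / 2) in
   let S := svrg_epochs R in
   let K := fun eps : R => natceil (C * (1 / eps) `^ (4 * (2 + nu) / 3)) in
   exists (B' : R) (m : nat),
   forall (n1 n2 : nat) (gs : 'I_n1 -> 'rV[R]_d -> R)
     (hs : 'I_n2 -> 'rV[R]_d -> R),
     finite_sum g gs -> finite_sum h hs -> (forall i, smooth L (gs i)) ->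
   forall T : nat -> nat,
     (forall k, (1 <= k)%N -> svrg_iters_lb L gam k <= (T k)%:R) ->
     (exists B : R, forall eps : R, 0 < eps < 1 ->
        svrg_guarantee g h r L nu alpha Delta x1 gs gam T S (K eps)
          (eps ^+ 2) B eps) /\
     ((forall k, (1 <= k)%N -> (T k)%:R <= M * svrg_iters_lb L gam k) ->
      forall eps : R, 0 < eps < 1 ->
        (\sum_(1 <= k < (K eps).+1) (n1 + n2 + T k) * S k)%N%:R
          <= B' * (1 + ln (1 / eps)) ^+ m
             * ((n1 + n2)%:R * (1 / eps) `^ (4 * (2 + nu) / 3)))).
Proof.
pose third := (1 / 3 : R); pose half := (1 / 2 : R).
pose qa := 3 * (1 + nu) / 2; pose qb := 4 * (2 + nu) / 3.
have third01 : 0 <= third /\ third <= 1 by rewrite /third; split; lra.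
have half01 : 0 <= half /\ half <= 1 by rewrite /half; split; lra.
have qa0 : 0 <= qa by rewrite /qa; have := nu_gt0; lra.
have qb0 : 0 <= qb by rewrite /qb; have := nu_gt0; lra.
have qa1 : qa * third <= 1%:R by rewrite /qa /third; have := nu_le1; lra.
have qb2 : qb * half <= 2%:R by rewrite /qb /half; have := nu_le1; lra.
have qa_nu : 2 * nu + 1%:R <= qa by rewrite /qa; have := nu_le1; lra.
have qb_nu : 2 * nu + 2%:R <= qb by rewrite /qb; have := nu_le1; lra.
have suff_a (C cg : R) : 0 < C -> 0 < cg -> lipschitz_reg r ->
    control_suffices g h r nu alpha C qa third cg 1 x1.
  move=> C0 cg0; exact: (lipschitz_control_suffices L_gt0 nu_gt0 nu_le1 alpha_ge1
    g_convex h_convex g_smooth h_holder r_proper C0 qa0 third01.1 cg0 qa1 qa_nu).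
have suff_b (C cg : R) : 0 < C -> 0 < cg -> lower_bounded r ->
    control_suffices g h r nu alpha C qb half cg 2 x1.
  move=> C0 cg0; exact: (lower_bounded_control_suffices L_gt0 nu_gt0 nu_le1 alpha_ge1
    g_convex h_convex g_smooth h_holder r_proper C0 qb0 half01.1 cg0 qb2 qb_nu).
have L3 : 0 < 3 * L by rewrite mulr_gt0.
split=> [r_lip|]; [|split=> [r_lb|]; [|split=> [r_lip|r_lb]]].
- move=> dX X dY Y QX QY gs hs Dg Dh [uDg _] [uDh _] [G _ var] C C0.
  have [B HB] := spg_conclusion L_gt0 nu_gt0 Delta_gt0 g_convex g_smooth
    h_holder r_proper r_lsc uDg uDh var third01.1 third01.2 C0 qa0
    (suff_a _ _ C0 L3 r_lip).
  exists B => eps eps01; have := HB eps eps01.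
  have -> : 2 - third = 5 / 3 by rewrite /third; field.
  by have -> : qa * (5 / 3) = 5 * (1 + nu) / 2 by rewrite /qa; field.
- move=> dX X dY Y QX QY gs hs Dg Dh [uDg _] [uDh _] [G _ var] C C0.
  have [B HB] := spg_conclusion L_gt0 nu_gt0 Delta_gt0 g_convex g_smooth
    h_holder r_proper r_lsc uDg uDh var half01.1 half01.2 C0 qb0
    (suff_b _ _ C0 L3 r_lb.1).
  exists B => eps eps01; have := HB eps eps01.
  have -> : 2 - half = 3 / 2 by rewrite /half; field.
  by have -> : qb * (3 / 2) = 2 * (2 + nu) by rewrite /qb; field.
- move=> c C M c0 C0.
  exact: (svrg_conclusion L_gt0 Delta_gt0 g_convex h_convex g_smooth h_holder
    r_proper third01.1 c0 C0 qa0 (ltn0Sn 0) M (suff_a _ _ C0 c0 r_lip)).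
- move=> c C M c0 C0.
  have lb : lower_bounded r by case: r_lb => -[].
  exact: (svrg_conclusion L_gt0 Delta_gt0 g_convex h_convex g_smooth h_holder
    r_proper half01.1 c0 C0 qb0 (ltn0Sn 1) M (suff_b _ _ C0 c0 lb)).
Qed.
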